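(* Let $\mathcal Z\subseteq\mathbb R^d$ be a nonempty closed convex set, let $F_1,\dots,F_n:\mathcal Z\to\mathbb R^d$, let $F=\frac1n\sum_{i=1}^nF_i$, and let $L,\mu,\delta>0$. Assume: (1) each $F_i$ is $L$-Lipschitz on $\mathcal Z$: $\|F_i(u)-F_i(v)\|\le L\|u-v\|$ for all $u,v\in\mathcal Z$; (2) $F$ is $\mu$-strongly monotone on $\mathcal Z$: $\langle F(u)-F(v),u-v\rangle\ge\mu\|u-v\|^2$ for all $u,v\in\mathcal Z$, and each $F_i$ is monotone on $\mathcal Z$: $\langle F_i(u)-F_i(v),u-v\rangle\ge 0$; (3) for every $j\in\{1,\dots,n\}$ and all $u,v\in\mathcal Z$, $\frac1n\sum_{i=1}^n\|F_i(u)-F_j(u)-F_i(v)+F_j(v)\|^2\le\delta^2\|u-v\|^2$. Let $z^*\in\mathcal Z$ be the solution of the variational inequality $\langle F(z^* ),z-z^*\rangle\ge0$ for all $z\in\mathcal Z$. Let $\{z^k\}_{k\ge0}$ be the iterates of the Three Pillars Algorithm (defined in the context, with permutation compressors) with parameters $$\tau=p\le\tfrac14,\qquad \gamma=\min\left\{\frac{p}{3\mu},\ \frac{\sqrt p}{4\delta},\ \frac1L\left(\frac{H}{4\log\frac{40L}{\mu p}}-1\right)\right\},\qquad \eta=\frac{1}{4\left(L+\frac1\gamma\right)},\qquad H\ge 8\log\frac{40L}{\mu p}.$$ Then for every $K\ge 0$, $$\mathbb E\left[\|z^K-z^*\|^2\right]\le\left(1-\frac{\gamma\mu}{2}\right)^K\cdot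 2\|z^0-z^*\|^2 .$$
   Context: $\|\cdot\|$ is the Euclidean norm, $\mathrm{proj}_{\mathcal Z}$ the Euclidean projection onto $\mathcal Z$, $\log$ the natural logarithm. Permutation compressors $Q_1,\dots,Q_n:\mathbb R^d\to\mathbb R^d$ (random maps). If $d\ge n$, assume $d=qn$ with $q\ge1$ an integer; let $\pi$ be a uniformly random permutation of $\{1,\dots,d\}$ and set $Q_i(u)=n\sum_{j=q(i-1)+1}^{qi}u_{\pi_j}e_{\pi_j}$. If $d\le n$, $n>1$, assume $n=qd$ with $q\ge1$ an integer; let $\pi=(\pi_1,\dots,\pi_n)$ be a uniformly random permutation of the multiset in which each of $1,\dots,d$ occurs exactly $q$ times and set $Q_i(u)=d\,u_{\pi_i}e_{\pi_i}$. Here $e_j$ is the $j$-th standard basis vector. The same $\pi$ is used by all $i$ within one iteration. Three Pillars Algorithm. Parameters: $\gamma,\eta>0$, $\tau$, $p\in(0,1]$, integer $H\ge1$. Start from any $z^0=m^0\in\mathcal Z$. For $k=0,1,2,\dots$: (a) set $u_0^k=z^k$; for $t=0,\dots,H-1$ compute $u^k_{t+1/2}=\mathrm{proj}_{\mathcal Z}\big[u^k_t-\eta\big(F_1(u^k_t)-F_1(m^k)+F(m^k)+\frac1\gamma(u^k_t-z^k-\tau(m^k-z^k))\big)\big]$, $u^k_{t+1}=\mathrm{proj}_{\mathcal Z}\big[u^k_t-\eta\big(F_1(u^k_{t+1/2})-F_1(m^k)+F(m^k)+\frac1\gamma(u^k_{t+1/2}-z^k-\tau(m^k-z^k))\big)\big]$;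 (b) draw fresh permutation compressors $Q_1,\dots,Q_n$ independent of the past and set $z^{k+1}=\mathrm{proj}_{\mathcal Z}\big[u^k_H+\gamma\cdot\frac1n\sum_{i=1}^nQ_i\big(F_i(m^k)-F_1(m^k)-F_i(u^k_H)+F_1(u^k_H)\big)\big]$; (c) independently of the past, set $m^{k+1}=z^k$ with probability $p$ and $m^{k+1}=m^k$ with probability $1-p$. *)

(* Defs.v *)
From HB Require Import structures.
From mathcomp Require Import all_boot all_order all_algebra all_fingroup.
From mathcomp Require Import all_classical all_reals all_analysis.
Set Implicit Arguments.
Unset Strict Implicit.
Unset Printing Implicit Defensive.
Import Order.TTheory GRing.Theory Num.Theory.
Import numFieldNormedType.Exports.
Local Open Scope classical_set_scope.
Local Open Scope ring_scope.

(* The library's norm on 'rV[R]_d is the sup norm; it induces the same topology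
   (hence the same closed sets) as the Euclidean norm [enorm]. *)
Definition dotp (R : realType) (d : nat) (u v : 'rV[R]_d) : R :=
  \sum_(i < d) u 0 i * v 0 i.

Definition enorm (R : realType) (d : nat) (u : 'rV[R]_d) : R :=
  Num.sqrt (dotp u u).

(* A Euclidean-nearest point of Z to x. It exists and is unique when Z is
   nonempty, closed and convex; otherwise the default value x is irrelevant. *)
Definition eproj (R : realType) (d : nat) (Z : set 'rV[R]_d) (x : 'rV[R]_d) :
    'rV[R]_d :=
  xget x [set y | Z y /\ forall w, Z w -> enorm (x - y) <= enorm (x - w)].

Definition enorm_lipschitz_on (R : realType) (d : nat) (Z : set 'rV[R]_d) (L : R)
    (G : 'rV[R]_d -> 'rV[R]_d) : Prop :=
  forall u v, Z u -> Z v -> enorm (G u - G v) <= L * enorm (u - v).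

Definition monotone_on (R : realType) (d : nat) (Z : set 'rV[R]_d)
    (G : 'rV[R]_d -> 'rV[R]_d) : Prop :=
  forall u v, Z u -> Z v -> 0 <= dotp (G u - G v) (u - v).

Definition strongly_monotone_on (R : realType) (d : nat) (Z : set 'rV[R]_d)
    (mu : R) (G : 'rV[R]_d -> 'rV[R]_d) : Prop :=
  forall u v, Z u -> Z v ->
    mu * enorm (u - v) ^+ 2 <= dotp (G u - G v) (u - v).

Definition favg (R : realType) (d n : nat) (F : 'I_n -> 'rV[R]_d -> 'rV[R]_d)
    (u : 'rV[R]_d) : 'rV[R]_d :=
  n%:R^-1 *: \sum_(i < n) F i u.

Definition delta_similar_on (R : realType) (d n : nat) (Z : set 'rV[R]_d)
    (delta : R) (F : 'I_n -> 'rV[R]_d -> 'rV[R]_d) : Prop :=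
  forall (j : 'I_n) u v, Z u -> Z v ->
    n%:R^-1 * \sum_(i < n) enorm (F i u - F j u - F i v + F j v) ^+ 2
      <= delta ^+ 2 * enorm (u - v) ^+ 2.

Definition VI_solution (R : realType) (d : nat) (Z : set 'rV[R]_d)
    (G : 'rV[R]_d -> 'rV[R]_d) (zs : 'rV[R]_d) : Prop :=
  Z zs /\ forall z, Z z -> 0 <= dotp (G zs) (z - zs).

(* A family (Q_i)_{i < n} of random maps on R^d driven by one common draw,
   which is uniform on [arrangements]. *)
Record compressors (R : realType) (d n : nat) := Compressors {
  draw : finType;
  arrangements : {set draw};
  compress : draw -> 'I_n -> 'rV[R]_d -> 'rV[R]_d }.

(* d = q n. Indices start at 0, so the i-th block of positions is
   q i <= j < q (i + 1). *)
Definition perm_compressors_ge (R : realType) (d n q : nat) :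
    compressors R d n :=
  @Compressors R d n {perm 'I_d} [set: {perm 'I_d}]%SET
    (fun pi i u =>
       n%:R *: \sum_(j < d | (q * i <= j < q * i.+1)%N)
                  (u 0 (pi j) *: delta_mx 0 (pi j))).

(* n = q d. A permutation of the multiset with q copies of each index is a word
   of length n over 'I_d in which every letter occurs q times. *)
Definition perm_compressors_le (R : realType) (d n q : nat) :
    compressors R d n :=
  @Compressors R d n {ffun 'I_n -> 'I_d}
    [set pi : {ffun 'I_n -> 'I_d} |
       [forall l, #|[set j | pi j == l]| == q]]%SET
    (fun pi i u => d%:R *: (u 0 (pi i) *: delta_mx 0 (pi i))).

Variant is_perm_compressors (R : realType) (d n : nat) :
    compressors R d n -> Prop :=
| Perm_ge (q : nat) of (1 <= q)%N & d = (q * n)%N :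
    is_perm_compressors (perm_compressors_ge R d n q)
| Perm_le (q : nat) of (1 < n)%N & (1 <= q)%N & n = (q * d)%N :
    is_perm_compressors (perm_compressors_le R d n q).

Section algorithm.
Variables (R : realType) (d n : nat) (Z : set 'rV[R]_d).
Variables (F : 'I_n -> 'rV[R]_d -> 'rV[R]_d) (i1 : 'I_n).
Variables (C : compressors R d n) (gamma eta tau : R) (H : nat).

Definition inner_op (z m v : 'rV[R]_d) : 'rV[R]_d :=
  F i1 v - F i1 m + favg F m + gamma^-1 *: (v - z - tau *: (m - z)).

Definition inner_step (z m u : 'rV[R]_d) : 'rV[R]_d :=
  let uhalf := eproj Z (u - eta *: inner_op z m u) in
  eproj Z (u - eta *: inner_op z m uhalf).

Definition inner_loop (z m : 'rV[R]_d) : 'rV[R]_d :=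
  iter H (inner_step z m) z.

Definition outer_step (s : draw C) (z m : 'rV[R]_d) : 'rV[R]_d :=
  let u := inner_loop z m in
  eproj Z (u + gamma *: (n%:R^-1 *: \sum_(i < n)
    compress s i (F i m - F i1 m - F i u + F i1 u))).

(* The pair (z^k, m^k) along a fixed realization of the draws [pi] and of the
   coins [c]. *)
Fixpoint three_pillars (pi : nat -> draw C) (c : nat -> bool)
    (z0 : 'rV[R]_d) (k : nat) : 'rV[R]_d * 'rV[R]_d :=
  if k is k'.+1 then
    let: (z, m) := three_pillars pi c z0 k' in
    (outer_step (pi k') z m, if c k' then z else m)
  else (z0, z0).

End algorithm.

(* Random variables valued in a finite type, with all its subsets as events. *)
Definition discrete_rv (disp : measure_display) (Omega : measurableType disp)
    (S : finType) (X : Omega -> S) : Prop :=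
  forall A : set S, measurable (X @^-1` A).

Definition events_of (disp : measure_display) (Omega : measurableType disp)
    (S : finType) (X : Omega -> S) : set (set Omega) :=
  [set X @^-1` A | A in [set: set S]].

Definition mutually_independent (disp : measure_display)
    (Omega : measurableType disp) (R : realType) (P : probability Omega R)
    (I : choiceType) (E : I -> set (set Omega)) : Prop :=
  forall (J : seq I) (A : I -> set Omega), uniq J ->
    (forall i, i \in J -> E i (A i)) ->
    P (\bigcap_(i in [set` J]) A i) = (\big[*%E/1%E]_(i <- J) P (A i))%E.

Definition uniform_on (disp : measure_display) (Omega : measurableType disp)
    (R : realType) (P : probability Omega R) (S : finType) (B : {set S})
    (X : Omega -> S) : Prop :=
  forall s, P (X @^-1` [set s]) =
    (if s \in B then #|B|%:R^-1 else 0)%:E.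

(* At every step k, pi k drives the compressors and c k says whether m^{k+1} is
   set to z^k; all these variables are jointly independent. *)
Definition algorithm_randomness (disp : measure_display)
    (Omega : measurableType disp) (R : realType) (P : probability Omega R)
    (d n : nat) (C : compressors R d n) (p : R)
    (pi : nat -> Omega -> draw C) (c : nat -> Omega -> bool) : Prop :=
  [/\ forall k, discrete_rv (pi k) /\ discrete_rv (c k),
      forall k, uniform_on P (arrangements C) (pi k),
      forall k, P (c k @^-1` [set true]) = p%:E &
      mutually_independent P (fun i : nat + nat =>
        match i with
        | inl k => events_of (pi k)
        | inr k => events_of (c k)
        end)].

(* Main.v *)
Require Import Defs.
From HB Require Import structures.
From mathcomp Require Import all_boot all_order all_algebra all_fingroup.
From mathcomp Require Import all_classical all_reals all_analysis.
From mathcomp Require Import measurable_realfun ring lra.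
Set Implicit Arguments.
Unset Strict Implicit.
Unset Printing Implicit Defensive.
Import Order.TTheory GRing.Theory Num.Theory.
Import numFieldNormedType.Exports.
Local Open Scope classical_set_scope.
Local Open Scope ring_scope.

(** Let x^2 = mu p / (40 L), let s be the exact solution of the inner problem at
    (z, m), N its residual and u the output of the inner loop.  The energy inequality
    at s, together with the unbiasedness and the second moment bound of the
    compressors, gives E [|z+ - z*|^2 + |m+ - z*|^2] <=
    (1 - gamma mu / 2) (|z - z*|^2 + |m - z*|^2) as soon as
    |u - s|^2 <= (gamma mu / 10) |s - z|^2.  Since extragradient contracts
    |. - s|^2 to a fraction x^3 (even x^6 when gamma L is small), this settles the
    case x^5 <= gamma mu.

    If gamma mu < x^5, then gamma L is tiny and the first-order bias
    2 <s - z*, u - s> cannot be absorbed within one iteration.  But then extragradient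
    follows the segment from z to s: u is (1 - k) s + k z up to a remainder of second
    order.  One tracks each point together with an ideal anchor that moves by
    y+ = (1 - k) s + k y, and an approximate normal vector at the anchor.  The squared
    residuals, squared offsets and VI potentials of these anchors form an auxiliary
    Lyapunov function whose dissipation, with a weight t^2 that grows along the run,
    pays for the remainder.  A factor in [1, 3/2] in front of |z - z*|^2, decreasing
    in t, takes care of the rest, and this is where the constant 2 is used up.

    In both cases the bound is propagated by backward induction on the number of
    remaining iterations, conditional expectations being finite averages over the
    draws and coins. *)

(** * Euclidean space and projections *)

(** The threshold [x^5] comes from the bias [2 <s - z*, u - s>]. Young's inequality charges a
    fraction of [gamma mu |s - z*|^2] and leaves a multiple of [|u - s|^2 / (gamma mu)], which the
    gain in [|s - z|^2] covers once the squared contraction of the inner loop is at most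
    [gamma mu / 10]. The hypothesis on [H] reads [H >= 16 ln (1 / x)] and yields [x^6] for tiny
    [gamma L]. Since [40 x^2 gamma L = p gamma mu], below the threshold [gamma L <= p x^3 / 40].
    There the Lipschitz constant [2 L] of [F_1 - F] can replace [delta], and the inner problem is
    close to a projection, on which an extragradient step of length [t] near [1/4] multiplies the
    distance by about [1 - t (1 - t)]; [k <= x^3] is the [H]-th power of this factor. The part
    [k (z - s)] of [u - s] is harmless: [2 <s - z*, z - s> = |z - z*|^2 - |s - z*|^2 - |s - z|^2]
    only changes weights. Anchors are tracked because [z+] carries the compressor noise, whereas the
    normal [N] at [s] is still an approximate normal at [(1 - k) s + k y], with error
    [k <N, s - y>]. *)

Lemma dotpC (R : realType) (d : nat) (u v : 'rV[R]_d) : dotp u v = dotp v u.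
Proof. by apply: eq_bigr => i _; rewrite mulrC. Qed.

(* [lra] treats [dotp u v] and [dotp v u] as distinct atoms; these tactics
   orient them the same way throughout the goal. *)
Ltac comm2 a b := rewrite ?(dotpC b a).
Ltac comm3 a b c := comm2 a b; comm2 a c; comm2 b c.
Ltac comm4 a b c d := comm3 a b c; comm2 a d; comm2 b d; comm2 c d.
Ltac comm5 a b c d e := comm4 a b c d; comm2 a e; comm2 b e; comm2 c e; comm2 d e.
Ltac comm6 a b c d e f :=
  comm5 a b c d e; comm2 a f; comm2 b f; comm2 c f; comm2 d f; comm2 e f.
Ltac comm7 a b c d e f g :=
  comm6 a b c d e f; comm2 a g; comm2 b g; comm2 c g; comm2 d g; comm2 e g;
  comm2 f g.

(* Arithmetic decision procedures are slow on vector atoms: abstract them. *)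
Ltac dotp_gen := repeat match goal with
  | |- context [@dotp ?R ?d ?a ?b] =>
      let x := fresh "x" in generalize (@dotp R d a b); intro x
  end.

Section euclid.
Variables (R : realType) (d : nat).
Implicit Types (u v w : 'rV[R]_d) (t : R).

Definition sq u : R := dotp u u.

Lemma sqE u : sq u = dotp u u. Proof. by []. Qed.

Lemma dotpDl u v w : dotp (u + v) w = dotp u w + dotp v w.
Proof. by rewrite -big_split; apply: eq_bigr => i _; rewrite !mxE mulrDl. Qed.

Lemma dotpZl t u v : dotp (t *: u) v = t * dotp u v.
Proof. by rewrite mulr_sumr; apply: eq_bigr => i _; rewrite !mxE mulrA. Qed.

Lemma dotpNl u v : dotp (- u) v = - dotp u v.
Proof. by rewrite -scaleN1r dotpZl mulN1r. Qed.

Lemma dotpDr u v w : dotp u (v + w) = dotp u v + dotp u w.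
Proof. by rewrite dotpC dotpDl !(dotpC u). Qed.

Lemma dotpZr t u v : dotp u (t *: v) = t * dotp u v.
Proof. by rewrite dotpC dotpZl (dotpC u). Qed.

Lemma dotpNr u v : dotp u (- v) = - dotp u v.
Proof. by rewrite dotpC dotpNl (dotpC u). Qed.

Definition dotpE := (dotpDl, dotpDr, dotpNl, dotpNr, dotpZl, dotpZr).

Lemma dotp0l u : dotp 0 u = 0.
Proof. by rewrite -(scale0r (0 : 'rV[R]_d)) dotpZl mul0r. Qed.

Lemma dotp_suml (I : Type) (r : seq I) (P : pred I) (F : I -> 'rV[R]_d) v :
  dotp (\sum_(i <- r | P i) F i) v = \sum_(i <- r | P i) dotp (F i) v.
Proof.
elim/big_rec2: _ => [|i y1 y2 _ <-]; [exact: dotp0l|exact: dotpDl].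
Qed.

Lemma sq_ge0 u : 0 <= sq u.
Proof. by apply: sumr_ge0 => i _; rewrite -expr2 sqr_ge0. Qed.

Lemma sq0 : sq 0 = 0. Proof. exact: dotp0l. Qed.

Lemma sq_eq0 u : (sq u == 0) = (u == 0).
Proof.
apply/eqP/eqP => [/eqP|->]; last exact: sq0.
rewrite psumr_eq0 => [/allP h|i _]; last by rewrite -expr2 sqr_ge0.
apply/rowP => i; rewrite mxE; apply/eqP.
by have := h i (mem_index_enum _); rewrite /= mulf_eq0 orbb.
Qed.

Lemma sqN u : sq (- u) = sq u.
Proof. by rewrite /sq !dotpE opprK. Qed.

Lemma sqBC u v : sq (u - v) = sq (v - u).
Proof. by rewrite -sqN opprB. Qed.

Lemma sqZ t u : sq (t *: u) = t ^+ 2 * sq u.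
Proof. by rewrite /sq !dotpE mulrA. Qed.

Lemma sqD u v : sq (u + v) = sq u + 2 * dotp u v + sq v.
Proof. by rewrite /sq !dotpE (dotpC v u); ring. Qed.

Lemma sqB u v : sq (u - v) = sq u - 2 * dotp u v + sq v.
Proof. by rewrite sqD dotpNr sqN mulrN. Qed.

Lemma dotp_young t u v : 0 < t -> 2 * dotp u v <= t * sq u + t^-1 * sq v.
Proof.
move=> t0; have h := sq_ge0 (t *: u - v).
rewrite sqB sqZ dotpZl in h.
rewrite -(ler_pM2l t0) mulrDr !mulrA divff ?gt_eqF// mul1r -subr_ge0.
by rewrite [X in 0 <= X](_ : _ = t ^+ 2 * sq u - 2 * (t * dotp u v) + sq v)//; ring.
Qed.

Lemma dotp_youngN t u v : 0 < t -> - (t * sq u + t^-1 * sq v) <= 2 * dotp u v.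
Proof. by move=> t0; have := dotp_young (- u) v t0; rewrite sqN dotpNl; lra. Qed.

Lemma sqD_young t u v : 0 < t -> sq (u + v) <= (1 + t) * sq u + (1 + t^-1) * sq v.
Proof. by move=> t0; rewrite sqD; have := dotp_young u v t0; lra. Qed.

Lemma sqD2 u v : sq (u + v) <= 2 * sq u + 2 * sq v.
Proof. by have := sqD_young u v ltr01; rewrite invr1; lra. Qed.

Lemma dotp_CS u v : dotp u v ^+ 2 <= sq u * sq v.
Proof.
have [/eqP u0|u0] := boolP (sq u == 0).
  by move/eqP: (u0); rewrite sq_eq0 => /eqP ->; rewrite dotp0l sq0 expr0n mul0r.
have up : 0 < sq u by rewrite lt_def u0 sq_ge0.
have := sq_ge0 (sq u *: v - dotp u v *: u).
rewrite sqB !sqZ !dotpE (dotpC v u).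
rewrite [X in 0 <= X](_ : _ = sq u * (sq u * sq v - dotp u v ^+ 2)); last by ring.
by rewrite pmulr_rge0// subr_ge0.
Qed.

Lemma enorm_sq u : enorm u ^+ 2 = sq u.
Proof. by rewrite sqr_sqrtr// sq_ge0. Qed.

Lemma enorm_ge0 u : 0 <= enorm u. Proof. exact: sqrtr_ge0. Qed.

Lemma enorm_le_sq t u v : 0 <= t -> enorm u <= t * enorm v -> sq u <= t ^+ 2 * sq v.
Proof.
move=> t0 h; rewrite -!enorm_sq -exprMn ler_sqr ?nnegrE ?mulr_ge0 ?enorm_ge0//.
Qed.

Lemma sqr_coord_le u i : (u 0 i) ^+ 2 <= sq u.
Proof.
rewrite /sq /dotp (bigD1 i)//= expr2 lerDl; apply: sumr_ge0 => j _.
by rewrite -expr2 sqr_ge0.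
Qed.

Lemma sq_le_norm u : sq u <= d%:R * `|u| ^+ 2.
Proof.
rewrite /sq /dotp (le_trans (ler_sum (G := fun=> `|u| ^+ 2) _ _))//.
  move=> i _; rewrite -expr2 -real_normK ?num_real// ler_sqr ?nnegrE//.
  by rewrite [leRHS]/Num.Def.normr/= mx_normrE; apply: (le_bigmax _ (fun ij => `|u ij.1 ij.2|) (0, i)).
by rewrite sumr_const card_ord mulr_natl.
Qed.

Lemma norm_le_sq u t : 0 <= t -> sq u <= t ^+ 2 -> `|u| <= t.
Proof.
move=> t0 h; rewrite /Num.Def.normr/= mx_normrE; apply: bigmax_le => //= -[i j] _ /=.
rewrite ord1 -ler_sqr ?nnegrE// real_normK ?num_real//.
exact: le_trans (sqr_coord_le _ _) h.
Qed.

Lemma sq_lipschitz_continuous t (G : 'rV[R]_d -> 'rV[R]_d) : 0 <= t ->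
  (forall u v, sq (G u - G v) <= t * sq (u - v)) -> continuous G.
Proof.
move=> t0 hG u.
have FF : Filter (nbhs u) := nbhs_filter u.
apply: (iffRL (@cvgrPdist_le R _ _ (nbhs u) FF G (G u))) => e e0.
pose M := t * d%:R.
have M0 : 0 <= M by rewrite mulr_ge0.
have r0 : 0 < Num.sqrt (e ^+ 2 / (M + 1)).
  by rewrite sqrtr_gt0 divr_gt0 ?exprn_gt0// ltr_wpDl.
apply: filterS (@cvgr_dist_le R 'rV[R]_d 'rV[R]_d (nbhs u) FF id u
  (@cvg_id _ _) _ r0) => v h.
apply: norm_le_sq; first exact: ltW.
apply: (le_trans (hG _ _)); apply: (le_trans (ler_wpM2l t0 (sq_le_norm _))).
rewrite mulrA -/M.
rewrite -(ler_sqr) ?nnegrE ?sqrtr_ge0// sqr_sqrtr in h; last first.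
  by rewrite divr_ge0 ?sqr_ge0// addr_ge0.
apply: (le_trans (ler_wpM2l M0 h)); rewrite mulrCA ler_piMr ?sqr_ge0//.
by rewrite ler_pdivrMr ?mul1r ?lerDl// ltr_wpDl.
Qed.

Lemma sq_continuous : continuous sq.
Proof.
move=> u; rewrite /sq /dotp.
have addc : continuous (fun x : R * R => x.1 + x.2).
  by move=> x; apply: cvgD; [exact: cvg_fst|exact: cvg_snd].
have F i : continuous (fun v : 'rV[R]_d => v 0 i * v 0 i).
  move=> v.
  exact: (@cvgM R _ (nbhs v) (nbhs_filter v) _ _ _ _
    (@coord_continuous R 1 d 0 i v) (@coord_continuous R 1 d 0 i v)).
exact: (@continuous_big R 'I_d +%R 0 xpredT addc 'rV[R]_d (index_enum _)
  (fun i v => v 0 i * v 0 i) (fun i _ => F i) u).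
Qed.

Lemma sq_ball_compact u t : 0 <= t -> compact [set v | sq (v - u) <= t].
Proof.
move=> t0; apply: bounded_closed_compact.
  exists (`|u| + Num.sqrt t); split; first exact: num_real.
  move=> M hM v /= hv; apply: le_trans (ltW hM).
  rewrite -(subrK u v) addrC (le_trans (ler_normD _ _))// lerD2l.
  by apply: norm_le_sq; rewrite ?sqrtr_ge0// sqr_sqrtr.
rewrite [X in closed X](_ : _ = (fun v => sq (v - u)) @^-1` [set r | r <= t])//.
apply: preimage_closed; last exact: closed_le.
move=> v _; apply: (@continuous_comp _ _ _ (fun v => v - u) sq).
  apply: (@sq_lipschitz_continuous 1) => // a b.
  by rewrite mul1r opprB addrA subrK.
exact: sq_continuous.
Qed.

(** * Projections onto a closed convex set, and a fixed point theorem *)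

Section projection.
Variable Z : set 'rV[R]_d.
Hypotheses (Z0 : Z !=set0) (Zcl : closed Z).
Hypothesis Zcv : convex_set (Z : set (convex_lmodType 'rV[R]_d)).

Lemma convex_mem t u v : 0 <= t -> t <= 1 -> Z u -> Z v ->
  Z (t *: u + (1 - t) *: v).
Proof.
move=> t0 t1 Zu Zv.
have := Zcv (Itv01 t0 t1) (mem_set Zu) (mem_set Zv).
by move/set_mem.
Qed.

(** One point of [Z] confines the search to a closed ball, whose trace on [Z] is compact; points
    outside that ball are farther away. *)
Lemma eproj_ex u : exists2 y, Z y & forall v, Z v -> sq (u - y) <= sq (u - v).
Proof.
have [z0 Zz0] := Z0.
pose K := Z `&` [set v | sq (v - u) <= sq (z0 - u)].
have K0 : K !=set0 by exists z0; split => /=.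
have cK : compact K.
  rewrite /K setIC; apply: compact_closedI => //.
  exact/sq_ball_compact/sq_ge0.
have [|y /set_mem [Zy _] hy] :=
    @compact_EVT_min _ R (fun v => sq (v - u)) K K0 cK.
  apply: continuous_subspaceT => v.
  apply: (@continuous_comp _ _ _ (fun v => v - u) (@sq)).
    apply: (@sq_lipschitz_continuous 1) => // a b.
    by rewrite mul1r opprB addrA subrK.
  exact: sq_continuous.
exists y => // v Zv; rewrite !(sqBC u).
have [h|/ltW h] := leP (sq (v - u)) (sq (z0 - u)).
  by apply: hy; rewrite inE.
by apply: le_trans h; apply: hy; rewrite inE; split => /=.
Qed.

Lemma eprojP u : Z (eproj Z u) /\
  forall v, Z v -> dotp (u - eproj Z u) (v - eproj Z u) <= 0.
Proof.
have [y0 Zy0 hy0] := eproj_ex u.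
have : [set y | Z y /\ forall w, Z w -> enorm (u - y) <= enorm (u - w)] (eproj Z u).
  rewrite /eproj; case: xgetP => [y _ //|/(_ y0) h]; exfalso; apply: h.
  by split => // w Zw; rewrite ler_sqrt ?sq_ge0//; exact: hy0.
move=> [Zp hp]; split => // v Zv; set q := eproj Z u in Zp hp *.
(* Compare [q] with the point at parameter [t] on the segment from [q] to [v], then divide by
   [t]. *)
have h t : 0 < t -> t <= 1 -> 2 * dotp (u - q) (v - q) <= t * sq (v - q).
  move=> t0 t1; have := hp _ (convex_mem (ltW t0) t1 Zv Zp).
  rewrite ler_sqrt ?sq_ge0// -/(sq _) -/(sq _).
  rewrite (_ : u - (t *: v + (1 - t) *: q) = (u - q) - t *: (v - q)); last first.
    by apply/rowP => i; rewrite !mxE; ring.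
  rewrite [X in _ <= X]sqB sqZ dotpZr => {}hp; rewrite -(ler_pM2l t0); lra.
rewrite leNgt; apply/negP => h0.
set D := dotp _ _ in h h0; set S := sq _ in h.
have S0 : 0 <= S := sq_ge0 _.
(* If [D > 0], this [t] gives [t * S <= D < 2 * D], a contradiction; the [+ 1] covers [S = 0]. *)
have := h (Num.min 1 (D / (S + 1))).
have SS : 0 < S + 1 by lra.
rewrite lt_min ltr01 ge_min lexx /= divr_gt0// => /(_ isT isT).
rewrite leNgt => /negP; apply.
apply: (@le_lt_trans _ _ (D / (S + 1) * S)).
  by apply: ler_wpM2r => //; rewrite ge_min lexx orbT.
rewrite -mulrA (@le_lt_trans _ _ D)//; last by lra.
by rewrite ler_piMr ?(ltW h0)// mulrC ler_pdivrMr// mul1r; lra.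
Qed.

Lemma eproj_in u : Z (eproj Z u). Proof. by case: (eprojP u). Qed.

Lemma eproj_dotp u v : Z v -> dotp (u - eproj Z u) (v - eproj Z u) <= 0.
Proof. by case: (eprojP u) => _; apply. Qed.

Lemma eproj_uniq u q : Z q -> (forall v, Z v -> dotp (u - q) (v - q) <= 0) ->
  eproj Z u = q.
Proof.
move=> Zq hq; have h1 := hq _ (eproj_in u); have h2 := eproj_dotp u Zq.
apply/eqP; rewrite -subr_eq0 -sq_eq0; apply/eqP/le_anti; rewrite sq_ge0 andbT.
set a := eproj Z u in h1 h2 *.
by clearbody a; move: h1 h2; rewrite /sq !dotpE; comm3 u q a; dotp_gen; lra.
Qed.

Lemma eproj_nonexp u v : sq (eproj Z u - eproj Z v) <= sq (u - v).
Proof.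
have h1 := eproj_dotp u (eproj_in v); have h2 := eproj_dotp v (eproj_in u).
have h3 := sq_ge0 ((u - v) - (eproj Z u - eproj Z v)).
set a := eproj Z u in h1 h2 h3 *; set b := eproj Z v in h1 h2 h3 *.
by clearbody a b; move: h1 h2 h3; rewrite /sq !dotpE; comm4 u v a b; dotp_gen; lra.
Qed.

Lemma eproj_dist u v : Z v -> sq (eproj Z u - v) <= sq (u - v).
Proof.
move=> Zv; have h := eproj_dotp u Zv; have h3 := sq_ge0 (u - eproj Z u).
set a := eproj Z u in h h3 *.
by clearbody a; move: h h3; rewrite /sq !dotpE; comm3 u v a; dotp_gen; lra.
Qed.

(** By compactness instead of iteration: some ball is mapped into itself and contains a minimiser
    [y] of the displacement. The displacement at [T y] is smaller by the factor [c], so it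
    vanishes. *)
Lemma contraction_fixpoint (T : 'rV[R]_d -> 'rV[R]_d) c :
  0 <= c -> c < 1 -> (forall u v, sq (T u - T v) <= c * sq (u - v)) ->
  exists u, T u = u.
Proof.
move=> c0 c1 hT.
pose s := (1 - c) / 2.
have s0 : 0 < s by rewrite /s; lra.
(* Invariance of the ball: Young's inequality with parameter [s] gives at most [(1 + s) c r + s r],
   and [(1 + s) c <= 1 - s]. *)
pose r := (1 + s^-1) * sq (T 0 - 0) / s.
have sV : 0 < s^-1 by rewrite invr_gt0.
have r0 : 0 <= r by rewrite /r divr_ge0 ?mulr_ge0 ?sq_ge0//; lra.
have K0 : [set v | sq (v - 0) <= r] !=set0 by exists 0; rewrite /= subr0 sq0.
have [|y /set_mem Ky hy] := @compact_EVT_min _ R (fun v => sq (T v - v)) _ K0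
    (@sq_ball_compact 0 r r0).
  apply: continuous_subspaceT => v.
  apply: (@continuous_comp _ _ _ (fun v => T v - v) (@sq)).
    apply: (@sq_lipschitz_continuous (2 * c + 2)) => [|a b]; first by lra.
    rewrite (_ : T a - a - (T b - b) = (T a - T b) - (a - b)); last first.
      by rewrite !opprB addrACA [RHS]addrACA; congr (_ + _); rewrite addrC.
    by apply: (le_trans (sqD2 _ _)); rewrite sqN; have := hT a b; lra.
  exact: sq_continuous.
exists y; apply/eqP; rewrite -subr_eq0 -sq_eq0.
have KT : sq (T y - 0) <= r.
  rewrite (_ : T y - 0 = (T y - T 0) + (T 0 - 0)); last by rewrite addrA subrK.
  apply: (le_trans (sqD_young _ _ s0)).
  have hr : (1 + s^-1) * sq (T 0 - 0) = s * r.
    by rewrite /r [RHS]mulrC divfK ?gt_eqF.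
  rewrite hr; have := hT y 0; have := sq_ge0 (y - 0).
  have h1 : (1 + s) * c <= 1 - s by rewrite /s; nra.
  move=> q1 q2; have : (1 + s) * sq (T y - T 0) <= (1 + s) * (c * sq (y - 0)).
    by rewrite ler_pM2l//; lra.
  have : (1 + s) * c * sq (y - 0) <= (1 - s) * r.
    apply: ler_pM => //; rewrite ?mulr_ge0//; lra.
  lra.
have := hy (T y) (mem_set KT); have := hT (T y) y; have := sq_ge0 (T y - y).
by move=> q1 q2 q3; apply/eqP; nra.
Qed.

End projection.
End euclid.

Ltac dot_gen := dotp_gen; repeat match goal with
  | |- context [@sq ?R ?d ?a] =>
      let x := fresh "x" in generalize (@sq R d a); intro x
  end.

(** * Permutation compressors *)

Section average.
Variables (R : realType) (S : finType) (A : {set S}).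
Implicit Types (f g : S -> R) (x : R).

Definition avg f : R := #|A|%:R^-1 * \sum_(s in A) f s.

Lemma avg_le f g : (forall s, s \in A -> f s <= g s) -> avg f <= avg g.
Proof. by move=> h; rewrite ler_wpM2l ?invr_ge0 ?ler0n//; exact: ler_sum. Qed.

Lemma avgD f g : avg (fun s => f s + g s) = avg f + avg g.
Proof. by rewrite /avg big_split mulrDr. Qed.

Lemma avgZ x f : avg (fun s => x * f s) = x * avg f.
Proof. by rewrite /avg -mulr_sumr mulrCA. Qed.

Hypothesis A0 : A != finset.set0.

Lemma avg_cst x : avg (fun=> x) = x.
Proof.
rewrite /avg sumr_const -[x *+ _]mulr_natl mulrA mulVf ?mul1r//.
by rewrite pnatr_eq0 -lt0n card_gt0.
Qed.

Lemma avg_affine x y1 y2 f g :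
  avg (fun s => x + y1 * f s + y2 * g s) = x + y1 * avg f + y2 * avg g.
Proof. by rewrite !avgD !avgZ avg_cst. Qed.

End average.

Section scatter.
Variables (R : realType) (d : nat) (I : finType).
Implicit Types (f : I -> 'I_d) (a : I -> R) (v : 'rV[R]_d).

(** Common form of the two compressors: [f] sends a position to the coordinate that it transmits, a
    permutation in one case and a word in the other. *)
Definition scatter f a : 'rV[R]_d := \sum_j a j *: delta_mx 0 (f j).

Lemma scatterE f a l : scatter f a 0 l = \sum_(j | f j == l) a j.
Proof.
rewrite /scatter summxE [RHS]big_mkcond; apply: eq_bigr => j _.
by rewrite !mxE eqxx /= eq_sym; case: eqP => _; rewrite ?mulr1 ?mulr0.
Qed.

Lemma dotp_scatter f a v : dotp (scatter f a) v = \sum_j a j * v 0 (f j).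
Proof.
rewrite /scatter dotp_suml; apply: eq_bigr => j _; rewrite dotpZl; congr (_ * _).
rewrite /dotp (bigD1 (f j))//= !mxE !eqxx mul1r big1 ?addr0// => i /negPf h.
by rewrite mxE eqxx h mul0r.
Qed.

(** Cauchy-Schwarz read off from a variance: the squares of [m a_j - s] add up to
    [m (m t - s^2)]. *)
Lemma sqr_sum_le (P : pred I) a :
  (\sum_(j | P j) a j) ^+ 2 <= #|P|%:R * \sum_(j | P j) a j ^+ 2.
Proof.
set s := \sum_(j | P j) a j; set t := \sum_(j | P j) a j ^+ 2.
pose m : R := #|P|%:R.
have h : 0 <= \sum_(j | P j) (m * a j - s) ^+ 2 by apply: sumr_ge0 => j _; exact: sqr_ge0.
have e : \sum_(j | P j) (m * a j - s) ^+ 2 = m * (m * t - s ^+ 2).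
  transitivity (\sum_(j | P j) (m ^+ 2 * a j ^+ 2 - 2 * m * s * a j + s ^+ 2)).
    by apply: eq_bigr => j _; ring.
  rewrite big_split sumrB -!mulr_sumr sumr_const -/s -/t -[_ *+ _]mulr_natl -/m /=; ring.
rewrite e in h; case: (posnP #|P|) => [P0|P0].
  have s0 : s = 0 by rewrite /s big_pred0// => j; exact: (card0_eq P0 j).
  by rewrite s0 P0 mul0r expr0n.
by rewrite -subr_ge0 -(pmulr_rge0 _ (_ : 0 < m)) ?ltr0n.
Qed.

Lemma sq_scatter f a (q : nat) : (forall l, #|[pred j | f j == l]| <= q)%N ->
  sq (scatter f a) <= q%:R * \sum_j a j ^+ 2.
Proof.
move=> hq; rewrite /sq /dotp (partition_big f xpredT)//= mulr_sumr.
apply: ler_sum => l _; rewrite scatterE -expr2.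
apply: (le_trans (sqr_sum_le _ _)); apply: ler_wpM2r.
  by apply: sumr_ge0 => j _; exact: sqr_ge0.
by rewrite ler_nat; exact: hq.
Qed.

End scatter.

(* By symmetry all positions contribute equally, and together they count every letter
   [q] times. *)
Lemma avg_position (R : realType) (S J K : finType) (A : {set S}) (f : S -> J -> K)
    (q : nat) (h : K -> R) (j : J) : A != finset.set0 ->
  (forall (g : K -> R) (i : J), \sum_(s in A) g (f s i) = \sum_(s in A) g (f s j)) ->
  (forall s l, s \in A -> #|[pred i | f s i == l]| = q) -> (0 < #|J|)%N ->
  avg A (fun s => h (f s j)) = q%:R / #|J|%:R * \sum_l h l.
Proof.
move=> A0 sym hq J0.
have e : #|J|%:R * \sum_(s in A) h (f s j) = #|A|%:R * (q%:R * \sum_l h l).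
  transitivity (\sum_(i : J) \sum_(s in A) h (f s i)).
    rewrite [RHS](eq_bigr (fun=> \sum_(s in A) h (f s j))) => [|i _]; last exact: sym.
    by rewrite sumr_const mulr_natl.
  rewrite exchange_big /= (eq_bigr (fun=> q%:R * \sum_l h l)) => [|s sA].
    by rewrite sumr_const -[LHS]mulr_natl.
  rewrite (partition_big (f s) xpredT)//= mulr_sumr; apply: eq_bigr => l _.
  rewrite (eq_bigr (fun=> h l)) => [|i /eqP -> //].
  by rewrite sumr_const -[LHS]mulr_natl (hq s l sA).
have J1 : #|J|%:R != 0 :> R by rewrite pnatr_eq0 -lt0n.
have A1 : #|A|%:R != 0 :> R by rewrite pnatr_eq0 -lt0n card_gt0.
apply: (mulfI J1); apply: (mulfI A1).
rewrite /avg mulrCA mulVKf// e; field; exact: J1.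
Qed.

Section avg_scatter.
Variables (R : realType) (d : nat) (S J : finType) (A : {set S}) (f : S -> J -> 'I_d).
Variables (q : nat) (D : J -> 'rV[R]_d).
Hypothesis A0 : A != finset.set0.
Hypothesis sym : forall (g : 'I_d -> R) (i j : J),
  \sum_(s in A) g (f s i) = \sum_(s in A) g (f s j).
Hypothesis hq : forall s l, s \in A -> #|[pred i | f s i == l]| = q.
Hypothesis J0 : (0 < #|J|)%N.

Let scat s := scatter (f s) (fun j => D j 0 (f s j)).

Lemma avg_sum (K : finType) (g : K -> S -> R) :
  avg A (fun s => \sum_j g j s) = \sum_j avg A (g j).
Proof. by rewrite /avg exchange_big /= mulr_sumr. Qed.

Lemma avg_scatter_dotp (v : 'rV[R]_d) :
  avg A (fun s => dotp (scat s) v) = q%:R / #|J|%:R * \sum_j dotp (D j) v.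
Proof.
rewrite (_ : (fun s => _) = (fun s => \sum_j D j 0 (f s j) * v 0 (f s j))); last first.
  by apply/funext => s; rewrite dotp_scatter.
rewrite (avg_sum (fun j s => D j 0 (f s j) * v 0 (f s j))) mulr_sumr.
apply: eq_bigr => j _.
exact: (avg_position (fun l => D j 0 l * v 0 l) A0 (fun g i => sym g i j) hq J0).
Qed.

Lemma avg_scatter_sq :
  avg A (fun s => sq (scat s)) <= q%:R * (q%:R / #|J|%:R * \sum_j sq (D j)).
Proof.
apply: (@le_trans _ _ (avg A (fun s => q%:R * \sum_j D j 0 (f s j) ^+ 2))).
  apply: avg_le => s sA; apply: sq_scatter => l.
  by rewrite (hq l sA).
rewrite avgZ (avg_sum (fun j s => D j 0 (f s j) ^+ 2)) ler_wpM2l// mulr_sumr.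
apply: ler_sum => j _.
rewrite (avg_position (fun l => D j 0 l ^+ 2) A0 (fun g i => sym g i j) hq J0).
by rewrite /sq /dotp; under [in leRHS]eq_bigr do rewrite -expr2.
Qed.

End avg_scatter.

Lemma block_eq (q i j : nat) : (0 < q)%N -> (q * i <= j < q * i.+1)%N = (i == (j %/ q)%N).
Proof.
move=> q0; rewrite mulnC -leq_divRL// mulnC -ltn_divLR// ltnS.
by rewrite eqn_leq.
Qed.

Lemma card_block (d n q : nat) (i : 'I_n) : d = (q * n)%N ->
  #|[pred j : 'I_d | (q * i <= j < q * i.+1)%N]| = q.
Proof.
move=> dE; rewrite -sum1_card.
rewrite -(big_mkord (fun j => (q * i <= j < q * i.+1)%N) (fun=> 1%N)).
have le1 : (q * i.+1 <= d)%N by rewrite dE leq_mul2l ltn_ord orbT.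
transitivity (\sum_(q * i <= j < q * i.+1) 1)%N; last first.
  by rewrite sum_nat_const_nat muln1 mulnS addnK.
rewrite (big_nat_widen _ _ _ _ _ le1) [RHS](big_nat_widenl _ 0)//=.
by apply: eq_bigl => j; rewrite andbC.
Qed.

Section compressors.
Variables (R : realType) (d n : nat).
Hypothesis n0 : (0 < n)%N.

Definition aggregate (C : compressors R d n) (D : 'I_n -> 'rV[R]_d) (s : draw C) : 'rV[R]_d :=
  n%:R^-1 *: \sum_(i < n) compress s i (D i).

(** The moment bound concerns the aggregate. A single compressor has second moment of order [n] or
    [d]; the shared draw spreads the transmitted coordinates and brings the constant down to 1. *)
Definition unbiased (C : compressors R d n) : Prop :=
  [/\ arrangements C != finset.set0,
   forall D v, avg (arrangements C) (fun s => dotp (aggregate D s) v) =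
     dotp (n%:R^-1 *: \sum_(i < n) D i) v &
   forall D, avg (arrangements C) (fun s => sq (aggregate D s)) <=
     n%:R^-1 * \sum_(i < n) sq (D i)].

Let n1 : n%:R != 0 :> R. Proof. by rewrite pnatr_eq0 -lt0n. Qed.

Lemma perm_ge_unbiased (q : nat) : (1 <= q)%N -> d = (q * n)%N ->
  unbiased (perm_compressors_ge R d n q).
Proof.
move=> q0 dE.
have d0 : (0 < d)%N by rewrite dE muln_gt0 q0.
have d1 : d%:R != 0 :> R by rewrite pnatr_eq0 -lt0n.
have bP (j : 'I_d) : (j %/ q < n)%N by rewrite ltn_divLR// mulnC -dE.
(* The compressor that owns position [j]. Its factor [n] cancels the averaging, so all positions
   together form one [scatter] in which every coordinate occurs once. *)
pose b j := Ordinal (bP j).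
have aE D (pi : {perm 'I_d}) : @aggregate (perm_compressors_ge R d n q) D pi =
    scatter pi (fun j => D (b j) 0 (pi j)).
  rewrite /aggregate /= -scaler_sumr scalerA mulVf// scale1r /scatter.
  rewrite (exchange_big_dep xpredT)//=; apply: eq_bigr => j _.
  rewrite (big_pred1 (b j))// => i /=.
  by rewrite block_eq.
have S0 : [set: {perm 'I_d}]%SET != finset.set0.
  by apply/set0Pn; exists 1%g; rewrite inE.
have sym (g : 'I_d -> R) (i j : 'I_d) :
    \sum_(s in [set: {perm 'I_d}]%SET) g (s i) = \sum_(s in [set: {perm 'I_d}]%SET) g (s j).
  rewrite (reindex_inj (mulgI (tperm i j))) /=.
  by apply: eq_big => [s|s _]; rewrite ?inE// permM tpermL.
have hq (s : {perm 'I_d}) (l : 'I_d) : s \in [set: {perm 'I_d}]%SET ->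
    #|[pred i | s i == l]| = 1%N.
  move=> _; rewrite (eq_card (B := pred1 (s^-1 l)%g)) ?card1// => i.
  by rewrite !inE; apply/eqP/eqP => [<-|->]; rewrite ?permK ?permKV.
have J0 : (0 < #|'I_d|)%N by rewrite card_ord.
have blk (g : 'I_n -> R) : \sum_j g (b j) = q%:R * \sum_i g i.
  transitivity (\sum_(j < d) \sum_(i < n | (q * i <= j < q * i.+1)%N) g i).
    apply: eq_bigr => j _; rewrite (big_pred1 (b j))// => i /=.
    by rewrite block_eq.
  rewrite (exchange_big_dep xpredT)//= mulr_sumr; apply: eq_bigr => i _.
  by rewrite sumr_const -[LHS]mulr_natl -[in RHS](card_block i dE).
have dR : d%:R = q%:R * n%:R :> R by rewrite dE natrM.
have qR : q%:R != 0 :> R by rewrite pnatr_eq0 -lt0n.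
split=> //.
  move=> D v; rewrite (_ : (fun s => _) = (fun s : {perm 'I_d} =>
      dotp (scatter s (fun j => D (b j) 0 (s j))) v)); last first.
    by apply/funext => s; rewrite aE.
  rewrite (avg_scatter_dotp _ S0 sym hq J0) card_ord.
  rewrite (blk (fun i => dotp (D i) v)) dotpZl dotp_suml dR; field; rewrite ?n1 ?qR//.
move=> D; rewrite (_ : (fun s => _) = (fun s : {perm 'I_d} =>
      sq (scatter s (fun j => D (b j) 0 (s j))))); last first.
  by apply/funext => s; rewrite aE.
apply: (le_trans (avg_scatter_sq _ S0 sym hq J0)); rewrite card_ord.
rewrite (blk (fun i => sq (D i))) dR le_eqVlt; apply/orP; left; apply/eqP.
by field; rewrite ?n1 ?qR.
Qed.

Lemma perm_le_unbiased (q : nat) : (1 <= q)%N -> n = (q * d)%N ->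
  unbiased (perm_compressors_le R d n q).
Proof.
move=> q0 nE.
have d0 : (0 < d)%N by move: n0; rewrite nE muln_gt0 => /andP[].
have d1 : d%:R != 0 :> R by rewrite pnatr_eq0 -lt0n.
set A := arrangements (perm_compressors_le R d n q).
have aE D (w : {ffun 'I_n -> 'I_d}) : @aggregate (perm_compressors_le R d n q) D w =
    (d%:R / n%:R) *: scatter w (fun j => D j 0 (w j)).
  rewrite /aggregate /= -scaler_sumr scalerA mulrC; congr (_ *: _).
have hq (w : {ffun 'I_n -> 'I_d}) (l : 'I_d) : w \in A -> #|[pred i | w i == l]| = q.
  by rewrite inE => /forallP /(_ l) /eqP <-; rewrite cardsE.
have S0 : A != finset.set0.
  (* The word that lists each letter [q] times in a row shows that arrangements exist. *)
  have bP (j : 'I_n) : (j %/ q < d)%N by rewrite ltn_divLR// mulnC -nE.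
  apply/set0Pn; exists [ffun j => Ordinal (bP j)]; rewrite inE.
  apply/forallP => l; rewrite cardsE -[X in _ == X](card_block l nE); apply/eqP/eq_card => j.
  by rewrite !unfold_in /= ffunE block_eq// eq_sym.
have sym (g : 'I_d -> R) (i j : 'I_n) : \sum_(s in A) g (s i) = \sum_(s in A) g (s j).
  (* Exchanging two positions keeps the letter counts, hence permutes the arrangements. *)
  pose t (w : {ffun 'I_n -> 'I_d}) : {ffun 'I_n -> 'I_d} := [ffun k => w (tperm i j k)].
  have tK : involutive t by move=> w; apply/ffunP => k; rewrite !ffunE tpermK.
  rewrite (reindex_inj (inv_inj tK)) /=.
  apply: eq_big => [w|w _]; last by rewrite ffunE tpermL.
  rewrite !inE; apply: eq_forallb => l; congr (_ == q).
  rewrite -!sum1dep_card (reindex_inj (@perm_inj _ (tperm i j))) /=.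
  by apply: eq_bigl => k; rewrite ffunE tpermK.
have J0 : (0 < #|'I_n|)%N by rewrite card_ord.
have nR : n%:R = q%:R * d%:R :> R by rewrite nE natrM.
have qR : q%:R != 0 :> R by rewrite pnatr_eq0 -lt0n.
split=> //.
  move=> D v; rewrite (_ : (fun s => _) = (fun s : {ffun 'I_n -> 'I_d} =>
      (d%:R / n%:R) * dotp (scatter s (fun j => D j 0 (s j))) v)); last first.
    by apply/funext => s; rewrite aE dotpZl.
  rewrite avgZ (avg_scatter_dotp _ S0 sym hq J0) card_ord.
  by rewrite dotpZl dotp_suml nR; field; rewrite ?d1 ?qR.
move=> D; rewrite (_ : (fun s => _) = (fun s : {ffun 'I_n -> 'I_d} =>
      (d%:R / n%:R) ^+ 2 * sq (scatter s (fun j => D j 0 (s j))))); last first.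
  by apply/funext => s; rewrite aE sqZ.
rewrite avgZ; apply: (le_trans (ler_wpM2l (sqr_ge0 _) (avg_scatter_sq _ S0 sym hq J0))).
rewrite card_ord nR le_eqVlt; apply/orP; left; apply/eqP.
by field; rewrite ?d1 ?qR.
Qed.

Lemma perm_unbiased (C : compressors R d n) : is_perm_compressors C -> unbiased C.
Proof.
by case=> [q q0 dE|q _ q0 nE]; [exact: perm_ge_unbiased|exact: perm_le_unbiased].
Qed.

End compressors.

(** * Finite histories of the algorithm *)

Section finite_expectation.
Variables (disp : measure_display) (Omega : measurableType disp) (R : realType).
Variables (P : probability Omega R) (U : eqType) (Y : Omega -> U) (r : seq U) (f : U -> R).

Lemma finite_expectation : uniq r -> (forall w, Y w \in r) ->
  (forall u, u \in r -> measurable (Y @^-1` [set u])) -> (forall u, 0 <= f u) ->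
  ('E_P[fun w => f (Y w)] = \sum_(u <- r) (f u)%:E * P (Y @^-1` [set u]))%E.
Proof.
move=> ru rY mY f0; rewrite unlock.
(* Empty outside [r], so that every [A u] is measurable, as exchanging sum and integral requires. *)
pose A u := if u \in r then Y @^-1` [set u] else set0.
have mA u : measurable (A u) by rewrite /A; case: ifPn => [/mY|_]; [|exact: measurable0].
transitivity (\int[P]_w (\sum_(u <- r) (f u * \1_(A u) w)%:E))%E.
  apply: eq_integral => w _; rewrite (bigD1_seq (Y w))//= big_seq_cond big1 => [|u].
    by rewrite adde0 /A rY indicE mem_set// mulr1.
  by case/andP=> ur uY; rewrite /A ur indicE memNset ?mulr0// => /= e; rewrite e eqxx in uY.
rewrite ge0_integral_sum//; last 2 first.
- move=> u; apply/measurable_EFinP; apply: measurable_funM; first exact: measurable_cst.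
  exact: measurable_indic.
- by move=> u w _; rewrite lee_fin mulr_ge0.
apply: eq_big_seq => u ur.
under eq_integral do rewrite EFinM.
rewrite ge0_integralZl_EFin//; last first.
- apply/measurable_EFinP; exact: measurable_indic.
- by rewrite integral_indic// setIT /A ur.
Qed.

End finite_expectation.

Section histories.
Variable T : finType.

Fixpoint histories (K : nat) : seq (seq T) :=
  if K is k.+1 then [seq x :: h | x <- enum T, h <- histories k] else [:: [::]].

Lemma mem_histories K h : (h \in histories K) = (size h == K).
Proof.
elim: K h => [|K ih] h; first by rewrite inE size_eq0.
apply/allpairsP/idP => [[[x g] /= [_ hg ->]]|]; first by rewrite /= eqSS -ih.
by case: h => //= x h; rewrite eqSS -ih => hh; exists (x, h); split; rewrite ?mem_enum.
Qed.

Lemma histories_uniq K : uniq (histories K).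
Proof.
elim: K => //= K ih; apply: allpairs_uniq => //; first exact: enum_uniq.
by move=> [x g] [y h] _ _ /= [-> ->].
Qed.

Lemma sum_histories (R : nmodType) K (F : seq T -> R) :
  \sum_(h <- histories K.+1) F h = \sum_x \sum_(h <- histories K) F (x :: h).
Proof. by rewrite big_allpairs_dep /= big_enum. Qed.

End histories.

Section randomness.
Variables (disp : measure_display) (Omega : measurableType disp) (R : realType).
Variables (P : probability Omega R) (d n : nat) (C : compressors R d n) (p : R).
Variables (pi : nat -> Omega -> draw C) (co : nat -> Omega -> bool).
Hypothesis rand : algorithm_randomness P p pi co.

Let T : finType := (draw C * bool)%type.
Let B := arrangements C.

Definition unif (s : draw C) : R := if s \in B then #|B|%:R^-1 else 0.
Definition coin (b : bool) : R := if b then p else 1 - p.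
Definition mass (x : T) : R := unif x.1 * coin x.2.
Definition history (K : nat) (w : Omega) : seq T := mkseq (fun k => (pi k w, co k w)) K.

Let mpi k (s : draw C) : measurable (pi k @^-1` [set s]).
Proof. by case: rand => h _ _ _; case: (h k) => h1 _; exact: h1. Qed.

Let mco k (b : bool) : measurable (co k @^-1` [set b]).
Proof. by case: rand => h _ _ _; case: (h k) => _ h1; exact: h1. Qed.

Lemma coin_prob k b : P (co k @^-1` [set b]) = (coin b)%:E.
Proof.
case: rand => _ _ h _; case: b; first exact: h.
rewrite (_ : co k @^-1` [set false] = ~` (co k @^-1` [set true])); last first.
  by apply/seteqP; split => w /=; case: (co k w).
by rewrite probability_setC// h.
Qed.

Section prefix.
Variables (x0 : T) (h : seq T).

Let ev (i : nat + nat) : set Omega :=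
  match i with
  | inl k => pi k @^-1` [set (nth x0 h k).1]
  | inr k => co k @^-1` [set (nth x0 h k).2]
  end.
Let idx := [seq inl k | k <- iota 0 (size h)] ++ [seq inr k | k <- iota 0 (size h)].

Lemma history_preimage : history (size h) @^-1` [set h] = \bigcap_(i in [set` idx]) ev i.
Proof.
apply/seteqP; split => w /=.
  move=> e i hi; have {hi} : i \in idx := hi.
  rewrite /idx mem_cat => /orP[] /mapP[k]; rewrite mem_iota add0n => /= hk ->;
  by rewrite /= -e nth_mkseq.
move=> e; apply: (@eq_from_nth _ x0); rewrite size_mkseq// => k hk.
have m : k \in iota 0 (size h) by rewrite mem_iota.
rewrite nth_mkseq// [RHS]surjective_pairing.
have e1 : ev (inl k) w by apply: e; change (inl k \in idx); rewrite /idx mem_cat map_f.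
have e2 : ev (inr k) w by apply: e; change (inr k \in idx); rewrite /idx mem_cat orbC map_f.
by rewrite -[(nth _ _ _).1]e1 -[(nth _ _ _).2]e2.
Qed.

Lemma history_measurable : measurable (history (size h) @^-1` [set h]).
Proof.
rewrite history_preimage; apply: fin_bigcap_measurable; first exact: finite_seq.
by move=> [k|k] _ /=; [exact: mpi|exact: mco].
Qed.

(** The event fixes one draw and one coin per iteration, so it is an intersection of independent
    events, [inl] indexing the draws and [inr] the coins. *)
Lemma history_prob : P (history (size h) @^-1` [set h]) = (\prod_(x <- h) mass x)%:E.
Proof.
case: (rand) => _ hu _ hi; rewrite history_preimage hi; last 2 first.
- rewrite cat_uniq !map_inj_uniq ?iota_uniq//= ?andbT; last 2 first.
  + by move=> ? ? [].
  + by move=> ? ? [].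
  by apply/hasPn => i /mapP[k _ ->]; apply/mapP => -[].
- by move=> [k|k] _ /=; exists [set (nth x0 h k).1] || exists [set (nth x0 h k).2].
rewrite big_cat !big_map /=.
rewrite (eq_bigr (fun k => (unif (nth x0 h k).1)%:E)) => [|k _]; last exact: hu.
rewrite [X in (_ * X)%E](eq_bigr (fun k => (coin (nth x0 h k).2)%:E)) => [|k _]; last exact: coin_prob.
rewrite !prodEFin -EFinM -big_split /=; congr (_%:E).
by rewrite [RHS](big_nth x0) /index_iota subn0.
Qed.

End prefix.
End randomness.

#[local] Opaque dotp sq.

(** * Extragradient on the regularised problem *)

(** [A], [B], [C] are the squared distances from the half step to the solution, from the half step
    to the start, and from the start to the solution. With [a = 2 (1 + g)], the Young parameter
    [16 / (15 a)] turns the bound on [C] into [a + 16/15] times the decrease [A / a + 15/16 B]. *)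
Lemma eg_rate (R : realType) (g A B C N : R) : 0 < g ->
  N <= C - 2 * (4 * (1 + g))^-1 * A - 15 / 16 * B ->
  (forall t, 0 < t -> C <= (1 + t) * A + (1 + t^-1) * B) ->
  N <= (1 - (2 * (1 + g) + 16 / 15)^-1) * C.
Proof.
move=> g0 hN hC; pose a := 2 * (1 + g).
have a0 : 0 < a by rewrite /a; lra.
have ea : 2 * (4 * (1 + g))^-1 = a^-1 by rewrite /a; field; lra.
have t0 : 0 < 16 / 15 / a by rewrite divr_gt0//; lra.
have := hC _ t0; rewrite invf_div -/a.
have c0 : 0 < (a + 16 / 15)^-1 by rewrite invr_gt0; lra.
rewrite -(ler_pM2l c0).
rewrite (_ : (a + 16 / 15)^-1 * (_ + _) = a^-1 * A + 15 / 16 * B); last first.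
  by field; rewrite !gt_eqF//; lra.
by move: hN; rewrite ea; lra.
Qed.

Section extragradient.
Variables (R : realType) (d : nat) (Z : set 'rV[R]_d).
Hypotheses (Z0 : Z !=set0) (Zcl : closed Z).
Hypothesis Zcv : convex_set (Z : set (convex_lmodType 'rV[R]_d)).
Variables (G : 'rV[R]_d -> 'rV[R]_d) (w b : 'rV[R]_d) (gamma L : R).
Hypotheses (g0 : 0 < gamma) (L0 : 0 < L).
Hypothesis Gmono : forall u v : 'rV[R]_d, Z u -> Z v -> 0 <= dotp (G u - G v) (u - v).
Hypothesis Glip : forall u v : 'rV[R]_d, Z u -> Z v -> sq (G u - G v) <= L ^+ 2 * sq (u - v).
Implicit Types u v : 'rV[R]_d.
Let theta := (4 * (1 + gamma * L))^-1.

(* The inner operator scaled by [gamma]: the identity plus [gamma] times a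
   monotone [L]-Lipschitz map. *)
Definition reg_op u := (u - w) + gamma *: (G u + b).
Definition eg_half u := eproj Z (u - theta *: reg_op u).
Definition eg_next u := eproj Z (u - theta *: reg_op (eg_half u)).

Let gL0 : 0 < gamma * L. Proof. exact: mulr_gt0. Qed.
Let theta0 : 0 < theta. Proof. by rewrite invr_gt0; have := gL0; lra. Qed.
Let thetaE : theta * (1 + gamma * L) = 4^-1.
Proof. by rewrite /theta; field; have := gL0; lra. Qed.

Lemma eproj_id u : Z u -> eproj Z u = u.
Proof. by move=> Zu; apply: eproj_uniq => // v Zv; rewrite subrr dotp0l. Qed.

Lemma reg_op_mono u v : Z u -> Z v -> sq (u - v) <= dotp (reg_op u - reg_op v) (u - v).
Proof.
move=> Zu Zv; have := mulr_ge0 (ltW g0) (Gmono Zu Zv).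
by rewrite /reg_op sqE !dotpE; lra.
Qed.

Lemma reg_op_lip u v : Z u -> Z v ->
  sq (reg_op u - reg_op v) <= (1 + gamma * L) ^+ 2 * sq (u - v).
Proof.
move=> Zu Zv.
rewrite (_ : reg_op u - reg_op v = (u - v) + gamma *: (G u - G v)); last first.
  by apply/rowP => i; rewrite !mxE; ring.
apply: (le_trans (sqD_young _ _ gL0)); rewrite sqZ.
have h : gamma ^+ 2 * sq (G u - G v) <= (gamma * L) ^+ 2 * sq (u - v).
  by rewrite exprMn -[leRHS]mulrA; exact: (ler_wpM2l (sqr_ge0 _) (Glip Zu Zv)).
have i0 : 0 <= 1 + (gamma * L)^-1 by rewrite addr_ge0// invr_ge0 ltW.
have := ler_wpM2l i0 h.
have -> : (1 + (gamma * L)^-1) * ((gamma * L) ^+ 2 * sq (u - v)) =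
    (gamma * L + (gamma * L) ^+ 2) * sq (u - v) by field; rewrite !gt_eqF.
lra.
Qed.

(** The solution is a fixed point of a projected step of length [t = 1 / l]: strong monotonicity
    with modulus 1 and the squared Lipschitz constant [l] give the squared factor
    [1 - 2 t + t^2 l = 1 - t]. *)
Lemma reg_sol_ex : exists2 s : 'rV[R]_d, Z s & forall v, Z v -> dotp (- reg_op s) (v - s) <= 0.
Proof.
pose l := (1 + gamma * L) ^+ 2; pose t := l^-1.
have l1 : 1 < l by rewrite /l expr2; have := gL0; nra.
have t0 : 0 < t by rewrite invr_gt0; lra.
have tl : t * l = 1 by rewrite mulVf//; lra.
have t1 : t < 1 by rewrite invf_lt1; lra.
(* Projecting first evaluates the operator inside [Z], where its bounds hold, and makes [T] a
   contraction of the whole space. *)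
pose T u := eproj Z (eproj Z u - t *: reg_op (eproj Z u)).
have [|||s sE] := @contraction_fixpoint R d T (1 - t).
- lra.
- lra.
- move=> u v; apply: (le_trans (eproj_nonexp Z0 Zcl Zcv _ _)).
  set a := eproj Z u; set c := eproj Z v.
  have Za : Z a by exact: eproj_in.
  have Zc : Z c by exact: eproj_in.
  rewrite (_ : _ - _ = (a - c) - t *: (reg_op a - reg_op c)); last first.
    by apply/rowP => i; rewrite !mxE; ring.
  rewrite [leLHS]sqB sqZ dotpZr dotpC.
  have h1 := reg_op_mono Za Zc; have h2 := reg_op_lip Za Zc.
  have h3 : sq (a - c) <= sq (u - v) by exact: eproj_nonexp.
  have h4 := ler_wpM2l (sqr_ge0 t) h2.
  rewrite -/l mulrA (_ : t ^+ 2 * l = t) in h4; last by rewrite expr2 -mulrA tl mulr1.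
  have h5 := ler_wpM2l (ltW t0) h1.
  have h6 : (1 - t) * sq (a - c) <= (1 - t) * sq (u - v) by apply: ler_wpM2l => //; lra.
  lra.
have Zs : Z s by rewrite -sE; exact: eproj_in.
exists s => // v Zv; have := eproj_dotp Z0 Zcl Zcv (s - t *: reg_op s) Zv.
have -> : eproj Z (s - t *: reg_op s) = s by rewrite -[RHS]sE /T (eproj_id Zs).
rewrite (_ : s - _ - s = t *: (- reg_op s)); last first.
  by apply/rowP => i; rewrite !mxE; ring.
by rewrite dotpZl pmulr_rle0.
Qed.

Variable s : 'rV[R]_d.
Hypotheses (Zs : Z s) (hs : forall v : 'rV[R]_d, Z v -> dotp (- reg_op s) (v - s) <= 0).

Lemma eg_half_in u : Z (eg_half u). Proof. exact: eproj_in. Qed.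
Lemma eg_next_in u : Z (eg_next u). Proof. exact: eproj_in. Qed.

(** The classical estimate. As [theta (1 + gamma L) = 1/4], the change of the operator between [u]
    and the half step costs 1/16 of [|h - u|^2], while strong monotonicity at [h] gains
    [2 theta |h - s|^2]. *)
Lemma eg_contract u : Z u ->
  sq (eg_next u - s) <=
  (1 - (2 * (1 + gamma * L) + 16 / 15)^-1) * sq (u - s).
Proof.
move=> Zu; set h := eg_half u; set n := eg_next u.
have Zh : Z h := eg_half_in _; have Zn : Z n := eg_next_in _.
have p1 : dotp (u - theta *: reg_op h - n) (s - n) <= 0 by exact: eproj_dotp.
have p2 : dotp (u - theta *: reg_op u - h) (n - h) <= 0 by exact: eproj_dotp.
have p3 := ler_wpM2l (ltW theta0) (reg_op_mono Zh Zs).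
have p4 := ler_wpM2l (ltW theta0) (hs Zh).
have p5 := ler_wpM2l (sqr_ge0 theta) (reg_op_lip Zu Zh).
rewrite mulrA -exprMn thetaE in p5.
have p6 := sq_ge0 (theta *: (reg_op u - reg_op h) - (n - h)).
set Bh := reg_op h in p1 p3 p5 p6 *; set Bu := reg_op u in p2 p5 p6 *.
set Bs := reg_op s in p3 p4.
have key : sq (n - s) <= sq (u - s) - 2 * theta * sq (h - s) - 15 / 16 * sq (h - u).
    move: p1 p2 p3 p4 p5 p6 => {Zh Zn}; clearbody h n Bh Bu Bs; generalize theta => th.
  by rewrite !sqE !dotpE; comm7 u n s h Bh Bu Bs; dot_gen; lra.
apply: (eg_rate gL0 key) => t t0.
have := sqD_young (h - s) (u - h) t0.
by rewrite (_ : h - s + (u - h) = u - s) 1?(sqBC u h)// addrC addrA subrK.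
Qed.

End extragradient.

(** * The extragradient trajectory follows a segment when [gamma L] is small *)

Section drift_vec.
Variables (R : realType) (d : nat).
Implicit Types (s u h n q N a b : 'rV[R]_d) (t k : R).

(** In these lemmas [t] is the step size, [N] the normal at the solution [s], [h] and [n] the half
    and full steps from [u], and [a], [b] the perturbations by the Lipschitz part. Without
    constraints and perturbations, [h = (1 - t) u + t s] and [n - s = (1 - t (1 - t)) (u - s)];
    deviations from these two formulas are measured. *)
Lemma eg_drift_half s u h N a t : 0 < t -> t < 1 ->
  dotp N (h - s) <= 0 ->
  dotp (u - t *: (u - s) + t *: N - a - h) ((1 - t) *: u + t *: s - h) <= 0 ->
  sq ((1 - t) *: u + t *: s - h) <=
    t * (1 - t) * dotp N (s - u) + dotp a ((1 - t) *: u + t *: s - h).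
Proof.
move=> t0 t1 h1; have := ler_wpM2l (ltW t0) h1; move=> {h1}.
by rewrite !sqE !dotpE; comm6 s u h N a N; dot_gen; lra.
Qed.

Lemma eg_drift_next s u h n q N b t k : 0 < t ->
  dotp (u - t *: (h - s) + t *: N - b - n)
    (s - ((1 - t * (1 - t)) * k) *: q - n) <= 0 ->
  sq (n - s + ((1 - t * (1 - t)) * k) *: q) + 2 * t * dotp N (s - n) <=
  sq ((1 - t * (1 - t)) *: (u - s + k *: q) + t *: ((1 - t) *: u + t *: s - h) - b)
  + 2 * t * ((1 - t * (1 - t)) * k) * dotp N q.
Proof.
move=> t0.
have := sq_ge0 ((1 - t * (1 - t)) *: (u - s + k *: q) +
  t *: ((1 - t) *: u + t *: s - h) - b - (n - s + ((1 - t * (1 - t)) * k) *: q)).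
by rewrite !sqE !dotpE; comm7 s u h n q N b; dot_gen; lra.
Qed.

Lemma eg_drift_first s u h q N a t : 0 < t -> t < 1 ->
  dotp N (h - s) <= 0 ->
  dotp (u - t *: (u - s) + t *: N - a - h) (s - (1 - t) *: q - h) <= 0 ->
  sq (h - s + (1 - t) *: q) + dotp a (h - s + (1 - t) *: q) <=
    (1 - t) * dotp (u - s + q) (h - s + (1 - t) *: q) + t * (1 - t) * dotp N q.
Proof.
move=> t0 t1 h1; have := ler_wpM2l (ltW t0) h1; move=> {h1}.
by rewrite !sqE !dotpE; comm6 s u h q N a; dot_gen; lra.
Qed.

Lemma eg_drift_scalar (A D P Sa Sb U V K X t e r : R) :
  31 / 125 <= t -> t <= 1 / 4 -> 0 <= e -> e <= 1 / 100 / 100 ->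
  0 <= A -> 0 <= D -> 0 <= P -> 0 <= Sa -> 0 <= Sb -> 0 <= U -> 0 <= K ->
  D <= t * (1 - t) * P + 5 / 2 * Sa + D / 10 ->
  X <= 53 / 50 * ((1 - t * (1 - t)) ^+ 2 * A)
       + 53 / 3 * (11 / 10 * (t ^+ 2 * D) + 11 * Sb) ->
  V <= 2 * ((1 - t) ^+ 2 * U) + 2 * D ->
  U <= 2 * A + 2 * K ->
  Sa <= t ^+ 2 * e * U -> Sb <= t ^+ 2 * e * V ->
  X + r <= 71 / 100 * (A + 2 * t * P) + r + 30 * e * K.
Proof.
move=> t0 t1 e0 e1 A0 D0 P0 Sa0 Sb0 U0 K0 hD hX hV hU ha hb.
have q1 : t * (1 - t) <= 3 / 16 by nra.
have q2 : t ^+ 2 <= 1 / 16 by nra.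
have q3 : (1 - t * (1 - t)) ^+ 2 <= 53 / 80.
  have : 0 <= 1 - t * (1 - t) <= 83 / 102 by apply/andP; split; nra.
  by move=> /andP[? ?]; nra.
have q4 : (1 - t) ^+ 2 <= 17 / 30 by nra.
have h1 := ler_wpM2r P0 q1; have h2 := ler_wpM2r D0 q2.
have h3 := ler_wpM2r A0 q3; have h4 := ler_wpM2r U0 q4.
have eU : e * U <= 2 * (1 / 100 / 100) * A + 2 * e * K.
  have := ler_wpM2l e0 hU; have := ler_wpM2r A0 e1; lra.
have eD := ler_wpM2r D0 e1.
have eV : e * V <= 12 / 10 * (e * U) + 2 * (e * D).
  have := ler_wpM2l e0 hV; have := ler_wpM2l e0 h4; have := mulr_ge0 e0 U0; lra.
have eU0 : 0 <= e * U by exact: mulr_ge0.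
have eK0 : 0 <= e * K by exact: mulr_ge0.
have h5 := ler_wpM2r eU0 q2.
have eV0 : 0 <= 12 / 10 * (e * U) + 2 * (e * D) by have := mulr_ge0 e0 D0; lra.
have h6 : t ^+ 2 * (e * V) <= 1 / 16 * (12 / 10 * (e * U) + 2 * (e * D)).
  have := ler_wpM2l (sqr_ge0 t) eV; have := ler_wpM2r eV0 q2; lra.
have tP := ler_wpM2r P0 t0.
lra.
Qed.

(** The square of [1 - t (1 - t)] is about 0.66, so 71/100 leaves room for the perturbations and
    still lies below 13/16, a lower bound for the factor by which the target approaches [s]. *)
Lemma eg_drift_contract s u h n q N a b t k g :
  31 / 125 <= t -> t <= 1 / 4 -> 0 <= g -> g <= 1 / 100 ->
  dotp N (h - s) <= 0 -> dotp N (u - s) <= 0 ->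
  dotp (u - t *: (u - s) + t *: N - a - h) ((1 - t) *: u + t *: s - h) <= 0 ->
  dotp (u - t *: (h - s) + t *: N - b - n)
    (s - ((1 - t * (1 - t)) * k) *: q - n) <= 0 ->
  sq a <= (t * g) ^+ 2 * sq (u - s) -> sq b <= (t * g) ^+ 2 * sq (h - s) ->
  sq (n - s + ((1 - t * (1 - t)) * k) *: q) + 2 * t * dotp N (s - n) <=
  71 / 100 * (sq (u - s + k *: q) + 2 * t * dotp N (s - u))
  + 2 * t * ((1 - t * (1 - t)) * k) * dotp N q + 30 * g ^+ 2 * (k ^+ 2 * sq q).
Proof.
move=> t0 t1 g0 g1 Nh Nu pa pb sa sb.
have tp : 0 < t by lra.
have tl : t < 1 by lra.
pose Dv := (1 - t) *: u + t *: s - h.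
have h1 : sq Dv <= t * (1 - t) * dotp N (s - u) + dotp a Dv.
  exact: eg_drift_half tp tl Nh pa.
have h2 := eg_drift_next tp pb.
apply: (le_trans h2); rewrite -/Dv.
rewrite exprMn in sa sb.
apply: (@eg_drift_scalar _ (sq Dv) _ (sq a) (sq b) (sq (u - s)) (sq (h - s)));
  rewrite ?sq_ge0 ?sqr_ge0//.
- by rewrite expr2; nra.
- by rewrite -opprB dotpNr; lra.
- exact: (mulr_ge0 (sqr_ge0 _) (sq_ge0 _)).
- have y := dotp_young a Dv (ltr0Sn R 4).
  apply: (le_trans h1); rewrite -addrA lerD2l.
  by move: y; dot_gen; lra.
- have c1 : (0 : R) < 3 / 50 by lra.
  have c2 : (0 : R) < 1 / 10 by lra.
  rewrite -addrA; apply: (le_trans (sqD_young _ _ c1)); rewrite sqZ.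
  apply: lerD; first by dot_gen; lra.
  rewrite (_ : 1 + (3 / 50)^-1 = 53 / 3 :> R); last by lra.
  apply: ler_wpM2l; first by lra.
  by apply: (le_trans (sqD_young _ _ c2)); rewrite sqZ sqN; dot_gen; lra.
- have := sqD2 ((1 - t) *: (u - s)) (- Dv); rewrite sqZ sqN.
  rewrite (_ : _ - Dv = h - s)//.
  by apply/rowP => i; rewrite /Dv !mxE; ring.
- have := sqD2 (u - s + k *: q) (- (k *: q)); rewrite sqN sqZ addrK.
  by dot_gen; lra.
Qed.

End drift_vec.

Section drift_start.
Variables (R : realType) (d : nat).
Implicit Types (s u h n q N a b : 'rV[R]_d) (t k : R).

Lemma eg_start_scalar (A B ab alb S Sa Sb U K V X t e : R) :
  31 / 125 <= t -> t <= 1 / 4 -> 0 <= e -> e <= 1 / 100 / 100 ->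
  0 <= A -> 0 <= B -> 0 <= S -> 0 <= Sa -> 0 <= Sb -> 0 <= U -> 0 <= K -> 0 <= V ->
  B + ab <= (1 - t) * alb + t * (1 - t) * S ->
  X <= (1 + 1 / 10) * (A - 2 * (t * alb) + t ^+ 2 * B) + (1 + (1 / 10)^-1) * Sb ->
  - (2 * Sa + 2^-1 * B) <= 2 * ab ->
  U <= 2 * A + 2 * K -> V <= 2 * B + 2 * ((1 - t) ^+ 2 * K) ->
  Sa <= t ^+ 2 * e * U -> Sb <= t ^+ 2 * e * V ->
  X + 2 * t * (1 - t * (1 - t)) * S <=
  (1 - t * (1 - t)) * (4 * S + 2 * A + 300 * e * K).
Proof.
move=> t0 t1 e0 e1 A0 B0 S0 Sa0 Sb0 U0 K0 V0 h1 hX h2 hU hV hSa hSb.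
pose c := 2 * t / (1 - t).
have ct : c * (1 - t) = 2 * t by rewrite /c divfK//; lra.
have c0 : 3 / 5 <= c by rewrite ler_pdivlMr; lra.
have c1 : c <= 2 / 3 by rewrite ler_pdivrMr; lra.
have q2 : t ^+ 2 <= 1 / 16 by nra.
have q4 : (1 - t) ^+ 2 <= 1 by nra.
have cp : 0 <= c by lra.
have k1 := ler_wpM2l cp h1.
have k2 : c * ((1 - t) * alb + t * (1 - t) * S) = 2 * (t * alb) + 2 * t ^+ 2 * S.
  rewrite [LHS](_ : _ = (c * (1 - t)) * alb + (c * (1 - t)) * (t * S)); last by ring.
  by rewrite ct; ring.
have k3 : c * (B + ab) >= c * (3 / 4 * B - Sa) by apply: ler_wpM2l => //; lra.
have k4 := ler_wpM2r B0 c0; have k5 := ler_wpM2r Sa0 c1.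
have k6 := ler_wpM2r B0 q2; have k7 := ler_wpM2r S0 q2.
have k8 := ler_wpM2r K0 q4.
clear h1 h2 ct c0 c1 cp q4.
have m1 : A - 2 * (t * alb) + t ^+ 2 * B <= A - 1 / 3 * B + 2 / 3 * Sa + 1 / 8 * S.
  lra.
have eU : t ^+ 2 * e * U <= 1 / 16 * (e * (2 * A + 2 * K)).
  have := ler_wpM2l e0 hU; have := ler_wpM2r (mulr_ge0 e0 U0) q2; lra.
have eV : t ^+ 2 * e * V <= 1 / 16 * (e * (2 * B + 2 * K)).
  have := ler_wpM2l e0 hV; have := ler_wpM2r (mulr_ge0 e0 V0) q2.
  have := ler_wpM2l e0 k8; lra.
have eA := ler_wpM2r A0 e1; have eB := ler_wpM2r B0 e1.
have eK : 0 <= e * K by exact: mulr_ge0.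
clear k1 k2 k3 k4 k5 k6 k7 k8 hU hV.
have r1 : 13 / 16 <= 1 - t * (1 - t) by nra.
have r2 := ler_wpM2r S0 r1; have r3 := ler_wpM2r A0 r1; have r4 := ler_wpM2r eK r1.
have r5 : 2 * t * (1 - t * (1 - t)) * S <= 1 / 2 * ((1 - t * (1 - t)) * S).
  rewrite -mulrA; apply: ler_wpM2r; last by lra.
  by apply: mulr_ge0 => //; lra.
lra.
Qed.

(** The first step is separate because [<N, s - u>] at the starting point is not controlled by the
    final bound. Testing the half step at [s - (1 - t) q] brings in [<N, q>] instead. *)
Lemma eg_drift_start s u h n q N a b t g :
  31 / 125 <= t -> t <= 1 / 4 -> 0 <= g -> g <= 1 / 100 ->
  dotp N (h - s) <= 0 -> 0 <= dotp N q ->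
  dotp (u - t *: (u - s) + t *: N - a - h) (s - (1 - t) *: q - h) <= 0 ->
  dotp (u - t *: (u - s) + t *: N - a - h) ((1 - t) *: u + t *: s - h) <= 0 ->
  dotp (u - t *: (h - s) + t *: N - b - n)
    (s - ((1 - t * (1 - t)) * 1) *: q - n) <= 0 ->
  sq a <= (t * g) ^+ 2 * sq (u - s) -> sq b <= (t * g) ^+ 2 * sq (h - s) ->
  sq (n - s + (1 - t * (1 - t)) *: q) + 2 * t * dotp N (s - n) <=
  (1 - t * (1 - t)) * (4 * dotp N q + 2 * sq (u - s + q) + 300 * g ^+ 2 * sq q).
Proof.
move=> t0 t1 g0 g1 Nh Nq p1 _ pb sa sb.
have tp : 0 < t by lra.
have tl : t < 1 by lra.
have h1 := eg_drift_first tp tl Nh p1.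
have := eg_drift_next tp pb; rewrite mulr1 scale1r => h2.
apply: (le_trans h2); move: h1; set be := h - s + _; set al := u - s + q => h1.
have xE : (1 - t * (1 - t)) *: al + t *: ((1 - t) *: u + t *: s - h) - b =
    al - t *: be - b by apply/rowP => i; rewrite /al /be !mxE; ring.
rewrite xE; rewrite exprMn in sa sb.
have y1 := sqD_young (al - t *: be) (- b) (_ : 0 < 1 / 10 :> R).
have c1 : (0 : R) < 1 / 10 by lra.
move/(_ c1): y1; rewrite sqN [sq (al - _)]sqB sqZ dotpZr => y1.
have c2 : (0 : R) < 2 by lra.
have y2 := dotp_youngN a be c2.
have y3 : sq (u - s) <= 2 * sq al + 2 * sq q.
  by have := sqD2 al (- q); rewrite sqN addrK.
have y4 : sq (h - s) <= 2 * sq be + 2 * ((1 - t) ^+ 2 * sq q).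
  by have := sqD2 be (- ((1 - t) *: q)); rewrite sqN sqZ addrK.
have b0 := sq_ge0 be; have a0 := sq_ge0 al; have q0 := sq_ge0 q.
have sa0 := sq_ge0 a; have sb0 := sq_ge0 b.
have u0 := sq_ge0 (u - s); have hs0 := sq_ge0 (h - s).
move: h1 y1 y2 y3 y4 b0 a0 q0 sa sb sa0 sb0 Nq u0 hs0.
clear h2 xE pb p1 Nh; dot_gen.
by move=> *; apply: (@eg_start_scalar x4 x2 x x0 x1 x6 x5 x7 x8 x9); rewrite ?sqr_ge0//; nra.
Qed.

End drift_start.

Lemma chi_bounds (R : realType) (t : R) : 31 / 125 <= t -> t <= 1 / 4 ->
  13 / 16 <= 1 - t * (1 - t) <= 83 / 102 /\
  [/\ 0 <= 1 - t * (1 - t), 1 - t * (1 - t) <= 1, 0 <= t, t <= 1 &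
    0 <= 1 - t <= 1].
Proof. by move=> *; split; [apply/andP; split|split; rewrite ?subr_ge0; try lra]; nra. Qed.

(** The coefficients 4 and 300 solve [71/100 * 4 <= 13/16 * (4 - 1/2)] and
    [71/100 * 300 + 30 <= 13/16 * 300], so the bound reproduces itself with [c * k] in place of
    [k]. *)
Lemma drift_step (R : realType) (X S A K e c k t : R) :
  13 / 16 <= c -> 0 <= k -> k <= 1 -> 0 <= t -> t <= 1 / 4 -> 0 <= e ->
  0 <= S -> 0 <= A -> 0 <= K -> X <= k * (4 * S + 2 * A + 300 * e * K) ->
  71 / 100 * X + 2 * t * (c * k) * S + 30 * e * (k ^+ 2 * K) <=
  c * k * (4 * S + 2 * A + 300 * e * K).
Proof.
move=> c0 k0 k1 t0 t1 e0 S0 A0 K0 hX.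
have kS : 0 <= k * S by exact: mulr_ge0.
have kA : 0 <= k * A by exact: mulr_ge0.
have kK : 0 <= k * (e * K) by rewrite !mulr_ge0.
have c' : 0 <= c by lra.
have h1 := ler_wpM2r (mulr_ge0 c' kS) t1.
have h2 := ler_wpM2r kK k1.
have h3 := ler_wpM2r kS c0; have h4 := ler_wpM2r kA c0.
have h5 := ler_wpM2r kK c0.
lra.
Qed.

Section drift.
Variables (R : realType) (d : nat) (Z : set 'rV[R]_d).
Hypotheses (Z0 : Z !=set0) (Zcl : closed Z).
Hypothesis Zcv : convex_set (Z : set (convex_lmodType 'rV[R]_d)).
Variables (G : 'rV[R]_d -> 'rV[R]_d) (w b : 'rV[R]_d) (gamma L : R).
Hypotheses (g0 : 0 < gamma) (L0 : 0 < L) (gL : gamma * L <= 1 / 124).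
Hypothesis Glip : forall u v : 'rV[R]_d, Z u -> Z v ->
  sq (G u - G v) <= L ^+ 2 * sq (u - v).
Variable s : 'rV[R]_d.
Hypotheses (Zs : Z s)
  (hs : forall v : 'rV[R]_d, Z v -> dotp (- reg_op G w b gamma s) (v - s) <= 0).
Implicit Types u v y : 'rV[R]_d.
Let theta := (4 * (1 + gamma * L))^-1.
Let N := - reg_op G w b gamma s.
Let pert u := (theta * gamma) *: (G u - G s).
Let next := eg_next Z G w b gamma L.
Let half := eg_half Z G w b gamma L.

(** The lower bound is equivalent to [gamma L <= 1/124]. *)
Lemma theta_bounds : (31 / 125 <= theta) /\ (theta <= 1 / 4).
Proof.
have h : 0 < gamma * L by exact: mulr_gt0.
have e : theta * (4 * (1 + gamma * L)) = 1 by rewrite mulVf//; lra.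
have tp : 0 < theta by rewrite invr_gt0; lra.
by move: gL h e tp; generalize (gamma * L) theta => g t *; split; nra.
Qed.

Lemma reg_stepE u v : u - theta *: reg_op G w b gamma v =
  u - theta *: (v - s) + theta *: N - pert v.
Proof. by apply/rowP => i; rewrite /N /pert /reg_op !mxE; ring. Qed.

Lemma pert_sq u : Z u -> sq (pert u) <= (theta * (gamma * L)) ^+ 2 * sq (u - s).
Proof.
move=> Zu; have := ler_wpM2l (sqr_ge0 (theta * gamma)) (Glip Zu Zs).
rewrite sqZ => /le_trans; apply; generalize (sq (u - s)) => S.
by rewrite [leLHS](_ : _ = (theta * (gamma * L)) ^+ 2 * S)//; ring.
Qed.

(* Started near [y], the iterates stay close to the point (1 - k) s + k y of the segment
   from [y] to the solution [s]. *)
Lemma eg_drift (H : nat) u y : (0 < H)%N -> Z u -> Z y ->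
  let k := (1 - theta * (1 - theta)) ^+ H in
  sq (iter H next u - s + k *: (s - y)) <=
  k * (4 * dotp N (s - y) + 2 * sq (u - y) + 300 * (gamma * L) ^+ 2 * sq (s - y)).
Proof.
case: H => // H _ Zu Zy; cbv zeta; set q := s - y.
have [t0 t1] := theta_bounds.
have [/andP[c0 c2] [cp c1 tp t1' /andP[t2 t3]]] := chi_bounds t0 t1.
have gp : 0 <= gamma * L by rewrite mulr_ge0// ltW.
have gp' : gamma * L <= 1 / 100 by apply: (le_trans gL); lra.
pose c := 1 - theta * (1 - theta).
rewrite -/c in c0 c1 c2 cp *.
have Nq : 0 <= dotp N q by rewrite /q -opprB dotpNr oppr_ge0; exact: hs.
have Zit n : Z (iter n next u) by case: n => //= n; exact: eproj_in.
have Zh v : Z (half v) by exact: eproj_in.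
have Zseg t : 0 <= t -> t <= 1 -> Z (s - t *: q).
  move=> a0 a1; rewrite (_ : s - t *: q = t *: y + (1 - t) *: s).
    exact: convex_mem.
  by apply/rowP => i; rewrite !mxE; ring.
have pnext v x : Z x -> dotp (v - theta *: (half v - s) + theta *: N - pert (half v) - next v) (x - next v) <= 0.
  by move=> Zx; rewrite -reg_stepE; exact: eproj_dotp.
have phalf v x : Z x -> dotp (v - theta *: (v - s) + theta *: N - pert v - half v) (x - half v) <= 0.
  by move=> Zx; rewrite -reg_stepE; exact: eproj_dotp.
pose B := 4 * dotp N q + 2 * sq (u - y) + 300 * (gamma * L) ^+ 2 * sq q.
(* The nonnegative term with [N] belongs to the invariant: it pays for the constraint in the next
   step and is dropped only at the end. *)
have main n : sq (iter n.+1 next u - s + (c ^+ n.+1) *: q) +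
    2 * theta * dotp N (s - iter n.+1 next u) <= c ^+ n.+1 * B.
  elim: n => [|n IH].
    rewrite expr1 /B (_ : u - y = u - s + q); last by rewrite /q addrA subrK.
    apply: (@eg_drift_start _ _ _ _ (half u) _ _ _ (pert u) (pert (half u))) => //.
    - exact: hs.
    - by apply: phalf; apply: Zseg.
    - by apply: phalf; rewrite addrC [in X in _ + X](_ : theta = 1 - (1 - theta)) ?subKr//; apply: convex_mem.
    - by apply: pnext; apply: Zseg; rewrite mulr1.
    - exact: pert_sq.
    - exact: pert_sq.
  rewrite iterS [c ^+ n.+2]exprS; set v := iter n.+1 next u in IH *.
  set k := c ^+ n.+1 in IH *.
  have Zv : Z v := Zit n.+1.
  have k0 : 0 <= k by rewrite exprn_ge0.
  have k1 : k <= 1 by rewrite exprn_ile1.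
  have := @eg_drift_contract _ _ s v (half v) (next v) q N (pert v) (pert (half v)) theta k (gamma * L) t0 t1 gp gp' (hs (Zh v)) (hs Zv).
  rewrite -/c => /(_ _ _ (pert_sq Zv) (pert_sq (Zh v))) h.
  apply: le_trans (h _ _) _.
  - by apply: phalf; rewrite addrC [in X in _ + X](_ : theta = 1 - (1 - theta)) ?subKr//; apply: convex_mem.
  - by apply: pnext; apply: Zseg; [exact: mulr_ge0|exact: mulr_ile1].
  by apply: drift_step => //; rewrite ?sqr_ge0 ?sq_ge0.
have := main H; rewrite -/B => h; apply: le_trans h.
rewrite lerDl; apply: mulr_ge0; first by rewrite mulr_ge0.
by rewrite -opprB dotpNr oppr_ge0; exact: hs.
Qed.

End drift.

(** * One iteration when gamma mu is not too small *)

Lemma sq_le3 (R : realType) (d : nat) (z s c : 'rV[R]_d) :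
  sq (z - c) <= 3 / 2 * sq (s - c) + 3 * sq (s - z).
Proof.
have h0 : (0 : R) < 1 / 2 by lra.
have := sqD_young (s - c) (z - s) h0.
rewrite (_ : s - c + (z - s) = z - c); last by rewrite addrC addrA subrK.
by rewrite (sqBC z s); dot_gen; lra.
Qed.

(* [s] is the exact inner solution for the pair [(z, m)], [N] the corresponding
   normal vector at [s], [c] the solution of the variational inequality. *)
Lemma prox_energy (R : realType) (d : nat) (z m s c N Fs Fc D : 'rV[R]_d) (p gamma mu : R) :
  0 < gamma ->
  N = ((1 - p) *: z + p *: m) - s - gamma *: (Fs + D) ->
  dotp N (c - s) <= 0 ->
  mu * sq (s - c) <= dotp (Fs - Fc) (s - c) ->
  sq (s - c) + 2 * gamma * dotp D (s - c) + 2 * gamma * mu * sq (s - c)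
    + 2 * (gamma * dotp Fc (s - c)) <=
  (1 - p) * (sq (z - c) - sq (s - z)) + p * (sq (m - c) - sq (s - m)).
Proof.
move=> g0 NE hN hF; have h := ler_wpM2l (ltW g0) hF.
rewrite {}NE in hN; move: hN h; clear hF.
by rewrite !sqE !dotpE; comm7 z m s c Fs Fc D; dot_gen; lra.
Qed.

(** An exact expansion about [s] that isolates every error due to [u] differing from [s], each in a
    form suited to Young's inequality. *)
Lemma noisy_step_expand (R : realType) (d : nat) (m s c u D Du : 'rV[R]_d) (gamma dd : R) :
  sq (u - c) + 2 * gamma * dotp Du (u - c) + dd * sq (m - u) =
  sq (s - c) + 2 * gamma * dotp D (s - c)
  + (2 * dotp (s - c) (u - s) + sq (u - s)
     + 2 * dotp (gamma *: D) (u - s) + 2 * dotp (s - c) (gamma *: (Du - D))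
     + 2 * dotp (gamma *: (Du - D)) (u - s) + dd * sq ((m - s) - (u - s))).
Proof.
rewrite (_ : m - s - (u - s) = m - u); last by rewrite opprB addrA subrK.
by rewrite !sqE !dotpE; comm6 m s c u D Du; dot_gen; ring.
Qed.

(** [Z], [M], [U] are the squared distances of [z], [m], [s] to [c]; [A1], [A2], [E] those of [z],
    [m], [u] to [s]; [y = gamma mu]. The bias is [x1]: Young's inequality with weight [y / 4] leaves
    [4 E / y], and [k <= y / 10] makes this at most [4/10 A1]. *)
Lemma easy_scalar (R : realType) (Z M U A1 A2 E Dh De P T x1 x2 x3 x4 q p y k dd e0 : R) :
  0 < p -> p <= 1 / 4 -> 0 < y -> y <= p / 3 -> 0 <= k -> k <= y / 10 -> k <= 1 / 1000 ->
  0 <= dd -> dd <= p / 16 ->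
  0 <= U -> 0 <= A1 -> 0 <= A2 -> 0 <= E -> 0 <= P ->
  E <= k * A1 -> Dh <= dd * A2 -> De <= dd * E ->
  e0 + 2 * y * U + 2 * P <= (1 - p) * (Z - A1) + p * (M - A2) ->
  2 * x1 <= y / 4 * U + (y / 4)^-1 * E ->
  2 * x2 <= 1 * Dh + 1^-1 * E ->
  2 * x3 <= y / 8 * U + (y / 8)^-1 * De ->
  2 * x4 <= 1 * De + 1^-1 * E ->
  q <= 2 * A2 + 2 * E ->
  Z <= 3 / 2 * U + 3 * A1 -> M <= 3 / 2 * U + 3 * A2 ->
  T = e0 + (2 * x1 + E + 2 * x2 + 2 * x3 + 2 * x4 + dd * q) ->
  T <= (1 - p) * Z + p * M - y / 2 * (Z + M).
Proof.
move=> p0 p1 y0 y1 k0 ky k1 d0 d1 U0 A10 A20 E0 P0 hE hDh hDe he h1 h2 h3 h4 hq hZ hM ->.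
have y4 : 0 < y / 4 by clear -y0; lra.
have y8 : 0 < y / 8 by clear -y0; lra.
have a1 : (y / 4)^-1 * E <= 4 / 10 * A1.
  by rewrite ler_pdivrMl//; have := ler_wpM2r A10 ky; clear -hE; lra.
have a2 : E <= 1 / 1000 * A1 by have := ler_wpM2r A10 k1; clear -hE; lra.
have a3 : De <= 1 / 64 * E.
  by have := ler_wpM2r E0 d1; have := ler_wpM2r E0 p1; clear -hDe; lra.
have a4 : (y / 8)^-1 * De <= 1 / 20 * A1.
  by rewrite ler_pdivrMl//; have := ler_wpM2r A10 ky; clear -hE a3 E0; lra.
have a5 : Dh <= p / 16 * A2 by have := ler_wpM2r A20 d1; clear -hDh; lra.
have a6 : dd * q <= p / 16 * (2 * A2 + 2 * E).
  by apply: le_trans (ler_wpM2l d0 hq) _; apply: ler_wpM2r => //; clear -A20 E0; lra.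
have a7 := ler_wpM2r E0 p1.
have a8 := ler_wpM2l (ltW y0) hZ; have a9 := ler_wpM2l (ltW y0) hM.
have b1 := ler_wpM2r A10 y1; have b2 := ler_wpM2r A20 y1.
have b3 := ler_wpM2r A10 p1; have b4 := mulr_ge0 (ltW y0) U0.
have b5 := mulr_ge0 (ltW p0) A20.
rewrite invr1 in h2 h4.
clear hq hZ hM ky k1 d0 d1 hE hDh hDe; lra.
Qed.

Lemma easy_step (R : realType) (d : nat) (z m s c u N Fs Fc D Du : 'rV[R]_d)
    (p gamma mu k dd : R) :
  0 < p -> p <= 1 / 4 -> 0 < gamma -> 0 < mu -> gamma * mu <= p / 3 ->
  0 <= k -> k <= gamma * mu / 10 -> k <= 1 / 1000 -> 0 <= dd -> dd <= p / 16 ->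
  N = ((1 - p) *: z + p *: m) - s - gamma *: (Fs + D) ->
  dotp N (c - s) <= 0 -> 0 <= dotp Fc (s - c) ->
  mu * sq (s - c) <= dotp (Fs - Fc) (s - c) ->
  sq (u - s) <= k * sq (s - z) ->
  sq (gamma *: D) <= dd * sq (s - m) ->
  sq (gamma *: (Du - D)) <= dd * sq (u - s) ->
  sq (u - c) + 2 * gamma * dotp Du (u - c) + dd * sq (m - u) <=
  (1 - p) * sq (z - c) + p * sq (m - c)
    - gamma * mu / 2 * (sq (z - c) + sq (m - c)).
Proof.
move=> p0 p1 g0 mu0 y1 k0 ky k1 d0 d1 NE hN hFc hF hu hD hDe.
have y0 : 0 < gamma * mu by exact: mulr_gt0.
have en := prox_energy g0 NE hN hF.
have q0 : 0 <= gamma * dotp Fc (s - c) by rewrite mulr_ge0// ltW.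
apply: (@easy_scalar R _ _ (sq (s - c)) (sq (s - z)) (sq (s - m)) (sq (u - s))
  (sq (gamma *: D)) (sq (gamma *: (Du - D))) (gamma * dotp Fc (s - c)) _
  (dotp (s - c) (u - s)) (dotp (gamma *: D) (u - s))
  (dotp (s - c) (gamma *: (Du - D))) (dotp (gamma *: (Du - D)) (u - s))
  (sq ((m - s) - (u - s))) p (gamma * mu) k dd
  (sq (s - c) + 2 * gamma * dotp D (s - c))); rewrite ?sq_ge0//.
- by move: en; dot_gen; lra.
- by apply: dotp_young; lra.
- by apply: dotp_young; lra.
- by apply: dotp_young; lra.
- by apply: dotp_young; lra.
- by have := sqD2 (m - s) (- (u - s)); rewrite sqN (sqBC m s).
- exact: sq_le3.
- exact: sq_le3.
- exact: noisy_step_expand.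
Qed.

(** * One iteration when gamma mu is tiny *)

Section hard_vec.
Variables (R : realType) (d : nat).
Implicit Types (z m s c u y o N Fs Fc Fp D Ry Ro Rp E nb : 'rV[R]_d) (p k q om gamma : R).

(** The gap between the two sides is exactly [om |Rp - (1 - q) Ry - q Ro + E|^2 + om q (1 - q) |Ry -
    Ro|^2]. *)
Lemma resid_drift y o yp Ry Ro Rp E q om : 0 <= om -> 0 <= q -> q <= 1 ->
  yp = (1 - q) *: y + q *: o - om *: (Rp + E) ->
  om * sq Rp + 2 * (1 - q) * dotp (Rp - Ry) (yp - y) + 2 * q * dotp (Rp - Ro) (yp - o)
  <= om * ((1 - q) * sq Ry + q * sq Ro) + om * sq E
     + 2 * q * (1 - q) * dotp (Ry - Ro) (y - o).
Proof.
move=> om0 q0 q1 ->.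
have h1 := mulr_ge0 om0 (sq_ge0 (Rp - ((1 - q) *: Ry + q *: Ro) + E)).
have q1' : 0 <= 1 - q by lra.
have h2 := mulr_ge0 (mulr_ge0 om0 (mulr_ge0 q0 q1')) (sq_ge0 (Ry - Ro)).
move: h1 h2.
by rewrite !sqE !dotpE; comm6 y o Ry Ro Rp E; dot_gen; lra.
Qed.

Lemma sq_convex z y p : 0 <= p -> p <= 1 ->
  sq ((1 - p) *: z + p *: y) <= (1 - p) * sq z + p * sq y.
Proof.
move=> p0 p1; have p1' : 0 <= 1 - p by lra.
have := mulr_ge0 (mulr_ge0 p0 p1') (sq_ge0 (z - y)).
by rewrite !sqE !dotpE; comm2 z y; dot_gen; lra.
Qed.

Lemma sq_split3 z y u : sq (z + (y + u)) <= 11 / 10 * sq z + 22 * (sq y + sq u).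
Proof.
have h : (0 : R) < 1 / 10 by lra.
have := sqD_young z (y + u) h; have := sqD2 y u.
by dot_gen; lra.
Qed.

(** The normal inequality tested at [wt] is a proximal descent inequality: the VI potential drops
    from [wt] to [s] by half the squared displacement, up to the offset and the replacement of [Fs]
    by [Fc]. *)
Lemma potential_drift w s N Fs Fc D nb (wt : 'rV[R]_d) gamma :
  w = wt + nb -> N = w - s - gamma *: (Fs + D) -> dotp N (wt - s) <= 0 ->
  1 / 2 * sq (wt - s) - 1 / 2 * sq (nb - gamma *: D - gamma *: (Fs - Fc)) <=
  gamma * dotp Fc (wt - s).
Proof.
move=> -> ->.
have := sq_ge0 (wt - s + (nb - gamma *: D - gamma *: (Fs - Fc))).
by rewrite !sqE !dotpE; comm6 wt s Fs Fc D nb; dot_gen; lra.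
Qed.

Lemma sq_resid_le s Rp E (wt : 'rV[R]_d) : s = wt - Rp - E ->
  sq Rp <= 4 / 3 * sq (wt - s) + 4 * sq E.
Proof.
move=> ->; have h : (0 : R) < 1 / 3 by lra.
have := sqD_young (Rp + E) (- E) h; rewrite addrK sqN.
rewrite (_ : wt - (wt - Rp - E) = Rp + E); last by rewrite !opprB !addrA addrC addrA addKr addrC.
by dot_gen; lra.
Qed.

(** The coin makes [y] the anchor of the new [m] with probability [p] and keeps [o] otherwise. As
    [yp] is close to [(1 - p) y + p o], the mean squared gap is near [p^3 + (1 - p)^3] times the old
    one; Young's inequality with parameter [2 / p] still leaves a loss of [3/2 p]. *)
Lemma spread_drift y o s yp (wt : 'rV[R]_d) p k : 0 < p -> p <= 1 / 4 ->
  0 <= k -> k <= 1 / 1000 -> wt = (1 - p) *: y + p *: o ->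
  yp = (1 - k) *: s + k *: y ->
  p * sq (yp - y) + (1 - p) * sq (yp - o) <=
  (1 - 3 / 2 * p) * sq (y - o) + 2 / p * sq (wt - s).
Proof.
move=> p0 p1 k0 k1 wE yE.
pose e := (1 - k) *: (s - wt); pose l := y - o.
have e1 : yp - y = e - ((1 - k) * p) *: l.
  by apply/rowP => i; rewrite yE /e /l wE !mxE; ring.
have e2 : yp - o = e + (1 - (1 - k) * p) *: l.
  by apply/rowP => i; rewrite yE /e /l wE !mxE; ring.
have eS : sq e <= sq (wt - s).
  rewrite sqZ (sqBC s) ler_piMl ?sq_ge0// expr_le1//; lra.
rewrite -/l; clearbody e l; clear wE yE.
have h1 := sqD2 e (- (((1 - k) * p) *: l)); rewrite -e1 sqN sqZ in h1.
have hp : 0 < 2 / p by rewrite divr_gt0.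
have h2 := sqD_young e ((1 - (1 - k) * p) *: l) hp; rewrite -e2 sqZ invf_div in h2.
have l0 := sq_ge0 l.
have h3 := ler_wpM2l (ltW p0) h1.
have p1' : 0 <= 1 - p by lra.
have h4 := ler_wpM2l p1' h2.
have e0 := sq_ge0 e.
have k2 : ((1 - k) * p) ^+ 2 <= p ^+ 2.
  rewrite exprMn ler_piMl ?sqr_ge0// expr_le1//; lra.
have k3 : (1 - (1 - k) * p) ^+ 2 <= (1 - 99 / 100 * p) ^+ 2.
  rewrite ler_sqr ?nnegrE; [|nra|nra].
  by have := ler_wpM2r (ltW p0) k1; lra.
have c1 : p * (2 * p ^+ 2) + (1 - p) * ((1 + p / 2) * (1 - 99 / 100 * p) ^+ 2) <= 1 - 3 / 2 * p.
  by nra.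
have c2 : p * 2 + (1 - p) * (1 + 2 / p) <= 2 / p.
  have -> : (1 - p) * (1 + 2 / p) = 1 - p + 2 / p - 2 by field; rewrite gt_eqF.
  lra.
have m1 := ler_wpM2r l0 c1; have m2 := ler_wpM2r e0 c2.
have m3 : 2 / p * sq e <= 2 / p * sq (wt - s) by apply: ler_wpM2l => //; exact: ltW.
have m4 := ler_wpM2l (ltW p0) (ler_wpM2r l0 k2).
have pp : 0 <= (1 - p) * (1 + p / 2) by clear -p0 p1; apply: mulr_ge0; lra.
have m5 := ler_wpM2l pp (ler_wpM2r l0 k3).
move: h3 h4 m1 m2 m3 m4 m5; clear; dot_gen => *.
lra.
Qed.

End hard_vec.

(* [t] and [t'] are the weights of the auxiliary Lyapunov function before and after an
   iteration, [xc] is the relative loss of the main weights and [g2] is (gamma L)^2.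
   In the lemmas below, f, ry, s and n stand for the potential, squared residual,
   slack and squared offset of the node of z, and fo, ro, so, no for those of m;
   S = <N, s - y>, and D is the squared inner displacement. *)
Definition small_params (R : realType) (p k xc t t' g2 : R) : Prop :=
  [/\ 0 < p, p <= 1 / 4, 0 <= k, k <= 1 / 40 / 50 & 0 <= xc] /\
  [/\ xc * t' <= p / 20, 1 <= t, t <= t', t' <= t + p / 5 & 0 <= g2].

Lemma weight_bounds (R : realType) (p k xc t t' g2 : R) :
  small_params p k xc t t' g2 -> [/\ xc <= p / 20, xc <= 1 / 80, t' <= 21 / 20 * t,
  t ^+ 2 <= t' ^+ 2 & t' ^+ 2 <= 11025 / 100 / 100 * t ^+ 2] /\
  [/\ t' ^+ 2 - (1 - xc) * t ^+ 2 <= 46 / 100 * (p * t),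
  0 <= t' ^+ 2 - (1 - xc) * t ^+ 2, p * t <= p * t ^+ 2,
  t' - (1 - xc) * t <= p / 4 & 0 <= t' - (1 - xc) * t].
Proof.
move=> small; case: (small) => [[p0 p1 k0 k1 x0] [x1 t1 tt' t't g0]].
have xp : xc <= p / 20 by nra.
have a1 : xc * t <= p / 20 by nra.
have a2 : t' <= 21 / 20 * t by lra.
have a3 : t ^+ 2 <= t' ^+ 2 by nra.
have a4 : p * t <= p * t ^+ 2 by apply: ler_wpM2l; [exact: ltW|nra].
have a5 : t' ^+ 2 <= t ^+ 2 + 41 / 100 * (p * t) by nra.
have a6 : xc * t ^+ 2 <= p * t / 20 by nra.
have a7 : 0 <= xc * t ^+ 2 by apply: mulr_ge0 => //; exact: sqr_ge0.
have a8 : 0 <= xc * t by apply: mulr_ge0 => //; lra.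
clear -p0 p1 x0 xp a1 a2 a3 a4 a5 a6 a7 a8 t't tt' t1; split; split; try lra.
nra.
Qed.

(** [t^2] grows by a multiple of [p t] only. The resulting positive term with factor [46/100 (p t)]
    appears in [aux_pot] with the opposite sign, which is why the potential part carries the weight
    [p t]. *)
Lemma aux_quad (R : realType) (p k xc t t' g2 Q EQ ry ro l2 S s so n no en A1 A2 sE : R) :
  small_params p k xc t t' g2 ->
  0 <= ry + ro -> 0 <= l2 ->
  0 <= S -> 0 <= s -> 0 <= so -> 0 <= n -> 0 <= no -> 0 <= A1 -> 0 <= A2 ->
  EQ <= Q + sE - 137 / 100 * S + 17 / 8 * s + 4 * p ^+ 2 * so ->
  Q <= 2 * (ry + ro) + 2 * p ^+ 2 * l2 ->
  sE <= 111 / 100 * n + 11 / 10 * (p * no) + 100 * (g2 * (A1 + A2)) ->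
  en <= 8 * k * S + 1 / 100 * n + 20 * (g2 * (A1 + A2)) ->
  t' ^+ 2 * (EQ + 4 * (k * S) + 9 * p * (p * s + (1 - p) * so) + 14 * en
    + 14 * (p * n + (1 - p) * no))
  - (1 - xc) * (t ^+ 2 * (Q + 4 * s + 9 * p * so + 14 * n + 14 * no)) <=
  46 / 100 * (p * t) * (2 * (ry + ro) + 2 * p ^+ 2 * l2)
  - 13 / 10 * (t ^+ 2 * S) - 8 * (t ^+ 2 * n) - 6 * (p * (t ^+ 2 * no))
  + 420 * (t ^+ 2 * (g2 * (A1 + A2))).
Proof.
move=> small; case: (small) => [[p0 p1 k0 k1 x0] [x1 t1 tt' t't g0]].
move=> r0 l0 S0 s0 so0 n0 no0 A10 A20 hEQ hQ hsE hen.
have [[xp xq a2 a3 a4] [a5 a6 a7 _ _]] := weight_bounds small.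
move: (t ^+ 2) (t' ^+ 2) (sqr_ge0 t) a3 a4 a5 a6 a7 => T T' T0 a3 a4 a5 a6 a7.
have GA0 : 0 <= g2 * (A1 + A2) by apply: mulr_ge0 => //; exact: addr_ge0.
move: (g2 * (A1 + A2)) GA0 hsE hen => GA GA0 hsE hen.
have T'0 : 0 <= T' by exact: le_trans a3.
have a57 : T' - (1 - xc) * T <= 46 / 100 * (p * T) by clear -a5 a7; lra.
have q1 := ler_wpM2r S0 k1.
have q2 : p ^+ 2 * s <= 1 / 16 * s by apply: ler_wpM2r => //; clear -p0 p1; nra.
have q3 := ler_wpM2r n0 p1.
have tot : EQ + 4 * (k * S) + 9 * p * (p * s + (1 - p) * so) + 14 * en
    + 14 * (p * n + (1 - p) * no) <=
    Q - 131 / 100 * S + 43 / 16 * s + (9 * p - 5 * p ^+ 2) * so + 19 / 4 * n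
    + (14 - 129 / 10 * p) * no + 380 * GA.
  clear -hEQ hsE hen q1 q2 q3 S0; lra.
have h := ler_wpM2l T'0 tot.
apply: (le_trans (lerB h (lexx _))).
have RL0 : 0 <= 2 * (ry + ro) + 2 * p ^+ 2 * l2.
  by apply: addr_ge0; apply: mulr_ge0 => //; apply: mulr_ge0 => //; exact: sqr_ge0.
have m1 := ler_wpM2l a6 hQ.
have m2 := ler_wpM2r RL0 a5.
have n1 := ler_wpM2r S0 a3.
have n2 := ler_wpM2r s0 a4.
have n3 := ler_wpM2r n0 a4.
have n4 := ler_wpM2r GA0 a4.
have n5 : (T' - (1 - xc) * T) * (p * so) <= 46 / 100 * (p * T) * (p * so).
  exact: (ler_wpM2r (mulr_ge0 (ltW p0) so0) a57).
have n6 : (T' - (1 - xc) * T) * no <= 46 / 100 * (p * T) * no.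
  exact: (ler_wpM2r no0 a57).
have n7 := ler_wpM2r (mulr_ge0 (mulr_ge0 (ltW p0) (ltW p0)) so0) a3.
have n8 := ler_wpM2r (mulr_ge0 (ltW p0) no0) a3.
have o1 := ler_wpM2r (mulr_ge0 T0 s0) xq.
have o2 := ler_wpM2r (mulr_ge0 T0 n0) xq.
have o3 := mulr_ge0 T0 S0; have o4 := mulr_ge0 T0 s0; have o5 := mulr_ge0 T0 n0.
have o6 := mulr_ge0 T0 GA0.
have o7 := mulr_ge0 T0 (mulr_ge0 (mulr_ge0 (ltW p0) (ltW p0)) so0).
have o8 := mulr_ge0 T0 (mulr_ge0 (ltW p0) no0).
move: m1 m2 n1 n2 n3 n4 n5 n6 n7 n8 o1 o2 o3 o4 o5 o6 o7 o8; clear.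
lra.
Qed.

(** [w] is [ro / (10 p)]. Since the residual of [m] is replaced with probability [p], the mean of
    this term falls by [ro / 10] and gains [ry / 10], which the coefficient [1/5] of [ry]
    outweighs. *)
Lemma aux_pot (R : realType) (p k xc t t' g2 f fo fp F ry ro w rp l2 el n no
    A1 A2 U D sE sE2 : R) :
  small_params p k xc t t' g2 ->
  0 <= f -> 0 <= fo -> 0 <= F -> 0 <= ry -> 0 <= ro -> 0 <= l2 -> 0 <= n ->
  0 <= no -> 0 <= A1 -> 0 <= A2 -> 0 <= U -> 0 <= D -> 0 <= sE2 ->
  10 * (p * w) = ro -> 0 <= w ->
  fp = (1 - k) * F + k * f ->
  F <= (1 - p) * f + p * fo - 1 / 2 * D + 1 / 2 * sE2 ->
  rp <= 4 / 3 * D + 4 * sE ->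
  p * el <= p * ((1 - 3 / 2 * p) * l2) + 2 * D ->
  sE <= 111 / 100 * n + 11 / 10 * (p * no) + 100 * (g2 * (A1 + A2)) ->
  sE2 <= 11 / 10 * n + 11 / 10 * (p * no) + 88 * (g2 * A2) + 22 * (g2 * U) ->
  14 * p * (t' * (fp + (1 - k) * (p * f + (1 - p) * fo) + rp / 5
     + (ry / 10 + w - ro / 10) + 2 / 25 * (p * el)))
  + 8 * p ^+ 2 * fp + 4 * p * (p * f + (1 - p) * fo)
  - (1 - xc) * (14 * p * (t * (f + (1 - k) * fo + ry / 5 + w + 2 / 25 * (p * l2)))
       + 8 * p ^+ 2 * f + 4 * p * fo) <=
  - (46 / 100 * (p * t) * (2 * (ry + ro) + 2 * p ^+ 2 * l2))
  + 16 / 3 * (t ^+ 2 * n) + 16 / 3 * (p * (t ^+ 2 * no)) + 162 * (p * t * (g2 * U))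
  + 470 * (t ^+ 2 * (g2 * (A1 + A2))) + 1 / 2 * F.
Proof.
move=> small; case: (small) => [[p0 p1 k0 k1 x0] [x1 t1 tt' t't g0]].
move=> f0 fo0 F0 ry0 ro0 l0 n0 no0 A10 A20 U0 D0 E20 wE w0 fpE hF hrp hel hE hE2.
have [[xp xq a2 _ _] [_ _ a7 b1 b2]] := weight_bounds small.
have t0 : 0 <= t by exact: le_trans t1.
have pt0 : 0 <= p * t by apply: mulr_ge0 => //; exact: ltW.
have k1' : k <= 1 by clear -k1; lra.
have om0 : 0 <= 1 - k by rewrite subr_ge0.
have GA0 : 0 <= g2 * A1 by exact: mulr_ge0.
have GB0 : 0 <= g2 * A2 by exact: mulr_ge0.
have GU0 : 0 <= g2 * U by exact: mulr_ge0.
rewrite (mulrDr g2 A1 A2) in hE *.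
move: (g2 * A1) (g2 * A2) (g2 * U) GA0 GB0 GU0 hE hE2 => GA GB GU GA0 GB0 GU0 hE hE2.
pose W := 36 / 25 * n + 36 / 25 * (p * no) + 125 * (GA + GB) + 11 * GU.
have W0 : 0 <= W.
  have := mulr_ge0 (ltW p0) no0; clear -n0 GA0 GB0 GU0; rewrite /W; lra.
pose P := f + (1 - k) * fo + ry / 5 + w + 2 / 25 * (p * l2).
have EP : fp + (1 - k) * (p * f + (1 - p) * fo) + rp / 5
     + (ry / 10 + w - ro / 10) + 2 / 25 * (p * el) <=
    P - 1 / 10 * (ry + ro) - 3 / 25 * (p * (p * l2)) + W.
  have h1 := ler_wpM2l om0 hF.
  have h2 := ler_wpM2r D0 k1.
  have h3 : (1 - k) * sE2 <= sE2 by rewrite ler_piMl// gerBl.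
  have pn := mulr_ge0 (ltW p0) no0.
  clear -h1 h2 h3 fpE hrp hel hE hE2 D0 n0 pn GA0 GB0 GU0.
  by rewrite /P /W fpE; lra.
have P0 : 0 <= P.
  have := mulr_ge0 om0 fo0; have := mulr_ge0 (ltW p0) l0.
  by clear -f0 ry0 w0; rewrite /P; lra.
have Pub : P <= f + fo + ry / 5 + w + 2 / 25 * (p * l2).
  by have := mulr_ge0 k0 fo0; clear; rewrite /P; lra.
have t'0 : 0 <= t' by exact: le_trans tt'.
have e1 := ler_wpM2l (mulr_ge0 (ltW p0) t'0) EP.
have e2 := ler_wpM2r (mulr_ge0 (ltW p0) P0) b1.
have pp0 : 0 <= p * p by apply: mulr_ge0; exact: ltW.
have e3 := ler_wpM2l pp0 Pub.
have pl0 : 0 <= p * (ry + ro) by apply: mulr_ge0; [exact: ltW|exact: addr_ge0].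
have ppl0 : 0 <= p * (p * (p * l2)) by rewrite !mulr_ge0// ltW.
have e4 := ler_wpM2r pl0 tt'.
have e5 := ler_wpM2r ppl0 tt'.
have e6 := ler_wpM2r (mulr_ge0 (ltW p0) W0) a2.
have e7 := ler_wpM2l (mulr_ge0 (ltW p0) ry0) p1.
have e8 := ler_wpM2r (mulr_ge0 (ltW p0) ry0) t1.
have e9 := ler_wpM2r (mulr_ge0 (ltW p0) ro0) t1.
have e10 := ler_wpM2r ppl0 t1.
have pw : p * p * w = p * ro / 10 by rewrite -wE; clear; lra.
have T0 : 0 <= t ^+ 2 by exact: sqr_ge0.
have pt4 : p * t <= 1 / 4 * t ^+ 2.
  by have := ler_wpM2r T0 p1; clear -a7; lra.
have w1 := ler_wpM2r n0 pt4.
have w2 := ler_wpM2r (mulr_ge0 (ltW p0) no0) pt4.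
have w3 := ler_wpM2r GA0 pt4.
have w4 := ler_wpM2r GB0 pt4.
have f1 := ler_wpM2r (mulr_ge0 pp0 f0) k1.
have f2 := ler_wpM2r (mulr_ge0 pp0 f0) xq.
have f3 := ler_wpM2r (mulr_ge0 (ltW p0) fo0) xp.
have p16 : p ^+ 2 <= 1 / 16 by clear -p0 p1; nra.
have f4 := ler_wpM2r F0 p16.
have f5 := mulr_ge0 (mulr_ge0 pp0 k0) F0.
have f6 := mulr_ge0 pp0 f0; have f7 := mulr_ge0 pp0 fo0.
have n1 := mulr_ge0 T0 n0; have n2 := mulr_ge0 T0 (mulr_ge0 (ltW p0) no0).
have n3 := mulr_ge0 T0 GA0; have n4 := mulr_ge0 T0 GB0.
have g1 := mulr_ge0 (ltW p0) ry0; have g2' := mulr_ge0 (ltW p0) ro0.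
have n5 := mulr_ge0 pt0 GU0.
rewrite -/P.
move: e1 e2 e3 e4 e5 e6 e7 e8 e9 e10 pw w1 w2 w3 w4 f1 f2 f3 f4 f5 f6 f7 n1 n2 n3 n4 n5.
clear -fpE g1 g2' pl0 ppl0; rewrite fpE /W; clearbody P.
move=> e1 e2 e3 e4 e5 e6 e7 e8 e9 e10 pw w1 w2 w3 w4 f1 f2 f3 f4 f5 f6 f7 n1 n2 n3 n4 n5.
have r1 : 14 * (p * t' * P) - (1 - xc) * (14 * p * (t * P)) <=
   7 / 2 * (p * p * (f + fo + ry / 5 + w + 2 / 25 * (p * l2))).
  by move: e2 e3; clear; lra.
have r2 : 14 * (t' * (p * (36 / 25 * n + 36 / 25 * (p * no) + 125 * (GA + GB) + 11 * GU))) <=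
  16 / 3 * (t ^+ 2 * n) + 16 / 3 * (p * (t ^+ 2 * no)) +
  162 * (p * t * GU) + 470 * (t ^+ 2 * (GA + GB)).
  by move: e6 w1 w2 w3 w4 n1 n2 n3 n4 n5; clear; lra.
have r3 : 8 * p ^+ 2 * ((1 - k) * F + k * f) + 4 * p * (p * f + (1 - p) * fo)
  - (1 - xc) * (8 * p ^+ 2 * f + 4 * p * fo) + 7 / 2 * (p * p * (f + fo)) <= 1 / 2 * F.
  by move: f1 f2 f3 f4 f5 f6 f7; clear; lra.
have r4 : 7 / 2 * (p * p * (ry / 5 + w + 2 / 25 * (p * l2)))
  - 14 * (p * t' * (1 / 10 * (ry + ro) + 3 / 25 * (p * (p * l2)))) <=
  - (46 / 100 * (p * t) * (2 * (ry + ro) + 2 * p ^+ 2 * l2)).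
  by move: e4 e5 e7 e8 e9 e10 pw g1 g2' ppl0; clear; lra.
move: e1 r1 r2 r3 r4; clear; lra.
Qed.

Lemma aux_drift (R : realType) (p k xc t t' g2 Q EQ f fo fp F ry ro w rp l2 el
    S s so n no en A1 A2 U D sE sE2 : R) :
  small_params p k xc t t' g2 ->
  0 <= f -> 0 <= fo -> 0 <= F -> 0 <= ry -> 0 <= ro -> 0 <= l2 ->
  0 <= S -> 0 <= s -> 0 <= so -> 0 <= n ->
  0 <= no -> 0 <= A1 -> 0 <= A2 -> 0 <= U -> 0 <= D -> 0 <= sE2 ->
  10 * (p * w) = ro -> 0 <= w ->
  EQ <= Q + sE - 137 / 100 * S + 17 / 8 * s + 4 * p ^+ 2 * so ->
  Q <= 2 * (ry + ro) + 2 * p ^+ 2 * l2 ->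
  en <= 8 * k * S + 1 / 100 * n + 20 * (g2 * (A1 + A2)) ->
  fp = (1 - k) * F + k * f ->
  F <= (1 - p) * f + p * fo - 1 / 2 * D + 1 / 2 * sE2 ->
  rp <= 4 / 3 * D + 4 * sE ->
  p * el <= p * ((1 - 3 / 2 * p) * l2) + 2 * D ->
  sE <= 111 / 100 * n + 11 / 10 * (p * no) + 100 * (g2 * (A1 + A2)) ->
  sE2 <= 11 / 10 * n + 11 / 10 * (p * no) + 88 * (g2 * A2) + 22 * (g2 * U) ->
  t' ^+ 2 * (EQ + 4 * (k * S) + 9 * p * (p * s + (1 - p) * so) + 14 * en
    + 14 * (p * n + (1 - p) * no))
  + 14 * p * (t' * (fp + (1 - k) * (p * f + (1 - p) * fo) + rp / 5
     + (ry / 10 + w - ro / 10) + 2 / 25 * (p * el)))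
  + 8 * p ^+ 2 * fp + 4 * p * (p * f + (1 - p) * fo) <=
  (1 - xc) * (t ^+ 2 * (Q + 4 * s + 9 * p * so + 14 * n + 14 * no)
    + 14 * p * (t * (f + (1 - k) * fo + ry / 5 + w + 2 / 25 * (p * l2)))
       + 8 * p ^+ 2 * f + 4 * p * fo)
  - 13 / 10 * (t ^+ 2 * S) - 2 * (t ^+ 2 * n) + 162 * (p * t * (g2 * U))
  + 890 * (t ^+ 2 * (g2 * (A1 + A2))) + 1 / 2 * F.
Proof.
move=> small f0 fo0 F0 ry0 ro0 l0 S0 s0 so0 n0 no0 A10 A20 U0 D0 E20 wE w0.
move=> hEQ hQ hen fpE hF hrp hel hE hE2.
have p0 : 0 <= p by case: small => [[/ltW]].
have h1 := aux_quad small (addr_ge0 ry0 ro0) l0 S0 s0 so0 n0 no0 A10 A20 hEQ hQ hE hen.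
have h2 := aux_pot small f0 fo0 F0 ry0 ro0 l0 n0 no0 A10 A20 U0 D0 E20 wE w0 fpE hF hrp hel hE hE2.
have T0 : 0 <= t ^+ 2 by exact: sqr_ge0.
have n1 := mulr_ge0 T0 n0; have n2 := mulr_ge0 p0 (mulr_ge0 T0 no0).
by move: h1 h2 n1 n2; clear; lra.
Qed.

(** Notation of [easy_scalar]. The bias [x1] is split into [k (Z - U - A1) / 2], which only changes
    weights, and the second-order remainder [xa], which stays in the conclusion. *)
Lemma hard_scalar (R : realType) (Z M U A1 A2 E Dh De P T x0 x1 x2 x3 x4 xa q p y k dd e0 : R) :
  0 < p -> p <= 1 / 4 -> 0 < y -> y <= 1 / 1000 -> 0 <= k -> k <= 1 / 1000 ->
  0 <= dd -> dd <= p / 1000 -> k ^+ 2 * dd <= p * y ^+ 2 / 1000 ->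
  0 <= U -> 0 <= A1 -> 0 <= A2 -> 0 <= E -> 0 <= P ->
  E <= A1 / 1000 -> Dh <= dd * A2 -> De <= dd * E -> De <= y ^+ 2 / 1000 * A1 ->
  e0 + 2 * y * U + 2 * P <= (1 - p) * (Z - A1) + p * (M - A2) ->
  e0 = U + 2 * x0 ->
  2 * (k * x0) <= y / 64 * U + (y / 64)^-1 * (k ^+ 2 * Dh) ->
  2 * x1 = k * (Z - U - A1) + 2 * xa ->
  2 * x2 <= 1 * Dh + 1^-1 * E ->
  2 * x3 <= y / 64 * U + (y / 64)^-1 * De ->
  2 * x4 <= 1 * De + 1^-1 * E ->
  q <= 2 * A2 + 2 * E ->
  Z <= 3 / 2 * U + 3 * A1 -> M <= 3 / 2 * U + 3 * A2 ->
  T = e0 + (2 * x1 + E + 2 * x2 + 2 * x3 + 2 * x4 + dd * q) ->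
  T <= (1 - 11 / 10 * y) * ((1 - (1 - k) * p) * Z + (1 - k) * p * M)
    - 73 / 100 * A1 - 96 / 100 * (p * A2) - 3 / 10 * (y * U) - 19 / 10 * P + 2 * xa.
Proof.
move=> p0 p1 y0 y1 k0 k1 d0 d1 kd U0 A10 A20 E0 P0 hE hDh hDe hDe' he e0E h0 h1 h2 h3 h4 hq hZ hM ->.
have k1' : 0 <= 1 - k by clear -k1; lra.
have a0 := ler_wpM2l k1' he.
have d' : dd <= 1 / 1000 by clear -d1 p1; lra.
have y64 : 0 < y / 64 by clear -y0; lra.
have a3 : De <= 1 / 1000 * E by have := ler_wpM2r E0 d'; clear -hDe; lra.
have a4 : (y / 64)^-1 * De <= 1 / 10 * (y * A1).
  rewrite ler_pdivrMl//.
  by have := mulr_ge0 (sqr_ge0 y) A10; clear -hDe'; lra.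
have a5 : (y / 64)^-1 * (k ^+ 2 * Dh) <= 1 / 10 * (p * (y * A2)).
  rewrite ler_pdivrMl//.
  have b1 := ler_wpM2l (sqr_ge0 k) hDh; have b2 := ler_wpM2r A20 kd.
  have b3 := mulr_ge0 (mulr_ge0 (ltW p0) (sqr_ge0 y)) A20.
  by clear -b1 b2 b3; lra.
have a6 : Dh <= p / 1000 * A2 by have := ler_wpM2r A20 d1; clear -hDh; lra.
have a7 : dd * q <= p / 1000 * (2 * A2) + 1 / 1000 * (2 * E).
  apply: le_trans (ler_wpM2l d0 hq) _.
  by have := ler_wpM2r A20 d1; have := ler_wpM2r E0 d'; clear; lra.
pose q' := (1 - k) * p.
have q0 : 0 <= q' by apply: mulr_ge0 => //; exact: ltW.
have q1 : q' <= p by rewrite ler_piMl ?(ltW p0)//; clear -k0; lra.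
have q2 : 0 <= 1 - q' by clear -q1 p1; lra.
have a8 := ler_wpM2l q2 hZ; have a9 := ler_wpM2l q0 hM.
have a10 := ler_wpM2r A10 (_ : 1 - q' <= 1); have a11 := ler_wpM2r A20 q1.
have V : (1 - q') * Z + q' * M <= 3 / 2 * U + 3 * A1 + 3 * (p * A2).
  have := a10 _; have l1 : 1 - q' <= 1 by clear -q0; lra.
  by move/(_ l1); move: a8 a9 a11; clear; lra.
have V' := ler_wpM2l (ltW y0) V; move: V'.
have b1 := ler_wpM2r A10 y1; have b2 := ler_wpM2r (mulr_ge0 (ltW p0) A20) y1.
have b3 := ler_wpM2r A10 p1; have b4 := mulr_ge0 (ltW y0) U0.
have b5 := mulr_ge0 (ltW p0) A20.
have b6 := ler_wpM2r b4 k1; have b7 := ler_wpM2r b5 k1; have b8 := ler_wpM2r P0 k1.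
have b9 := mulr_ge0 k0 (mulr_ge0 (ltW p0) A10).
rewrite invr1 in h2 h4.
clear V a8 a9 a10 a11 q0 q1 q2 hq hZ hM kd d0 d1 hDh hDe hDe' he d' k1' k0 p0 y1 k1 A10 A20.
rewrite /q' => V'; clear q'.
subst e0.
lra.
Qed.

(* [1 - k] times the energy inequality plus [k] times the trivial identity for
   [dotp (s - c) (z - s)] turns the weight [p] into [(1 - k) * p]. *)
Lemma hard_step (R : realType) (d : nat) (z m s c u N Fs Fc D Du : 'rV[R]_d)
    (p gamma mu k dd : R) :
  0 < p -> p <= 1 / 4 -> 0 < gamma -> 0 < mu -> gamma * mu <= 1 / 1000 ->
  0 <= k -> k <= 1 / 1000 -> 0 <= dd -> dd <= p / 1000 ->
  k ^+ 2 * dd <= p * (gamma * mu) ^+ 2 / 1000 ->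
  N = ((1 - p) *: z + p *: m) - s - gamma *: (Fs + D) ->
  dotp N (c - s) <= 0 -> 0 <= dotp Fc (s - c) ->
  mu * sq (s - c) <= dotp (Fs - Fc) (s - c) ->
  sq (u - s) <= sq (s - z) / 1000 ->
  sq (gamma *: D) <= dd * sq (s - m) ->
  sq (gamma *: (Du - D)) <= dd * sq (u - s) ->
  dd * sq (u - s) <= (gamma * mu) ^+ 2 / 1000 * sq (s - z) ->
  sq (u - c) + 2 * gamma * dotp Du (u - c) + dd * sq (m - u) <=
  (1 - 11 / 10 * (gamma * mu)) *
    ((1 - (1 - k) * p) * sq (z - c) + (1 - k) * p * sq (m - c))
  - 73 / 100 * sq (s - z) - 96 / 100 * (p * sq (s - m))
  - 3 / 10 * (gamma * mu * sq (s - c)) - 19 / 10 * (gamma * dotp Fc (s - c))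
  + 2 * dotp (s - c) (u - ((1 - k) *: s + k *: z)).
Proof.
move=> p0 p1 g0 mu0 y1 k0 k1 d0 d1 kd NE hN hFc hF hu hD hDe hDe'.
have y0 : 0 < gamma * mu by exact: mulr_gt0.
have en := prox_energy g0 NE hN hF.
have q0 : 0 <= gamma * dotp Fc (s - c) by rewrite mulr_ge0// ltW.
have y64 : 0 < gamma * mu / 64 by clear -y0; lra.
apply: (@hard_scalar R _ _ (sq (s - c)) (sq (s - z)) (sq (s - m)) (sq (u - s))
  (sq (gamma *: D)) (sq (gamma *: (Du - D))) (gamma * dotp Fc (s - c)) _
  (gamma * dotp D (s - c))
  (dotp (s - c) (u - s)) (dotp (gamma *: D) (u - s))
  (dotp (s - c) (gamma *: (Du - D))) (dotp (gamma *: (Du - D)) (u - s)) _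
  (sq ((m - s) - (u - s))) p (gamma * mu) k dd
  (sq (s - c) + 2 * gamma * dotp D (s - c))); rewrite ?sq_ge0//.
- exact: le_trans hDe'.
- by move: en; clear; dot_gen; lra.
- by rewrite mulrA.
- have := dotp_young (s - c) (k *: (gamma *: D)) y64.
  rewrite [sq (k *: _)]sqZ !dotpZr (dotpC _ D).
  by clear; dot_gen => *; lra.
- by clear; rewrite !sqE !dotpE; comm4 u s c z; dot_gen; lra.
- by apply: dotp_young; rewrite ?ltr01.
- by apply: dotp_young; rewrite ?ltr01.
- by apply: dotp_young; rewrite ?ltr01.
- by have := sqD2 (m - s) (- (u - s)); rewrite sqN (sqBC m s).
- exact: sq_le3.
- exact: sq_le3.
- exact: noisy_step_expand.
Qed.

(** The remainder [xa] is paid from three sources: the fall of the ramp from [xi] to [xi'] covers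
    [r U] up to a share of [y U], the auxiliary function covers the [t^2] terms, and the energy
    inequality covers the rest. *)
Lemma hard_value (R : realType) (a b a' b' S' xi xi' Z M A1 A2 U P T xa r A EA
    V V' s n p y t g2 xc : R) :
  0 < p -> p <= 1 / 4 -> 0 <= y -> 0 <= b -> 9 / 10 * b <= a ->
  0 <= xi' -> xi' <= xi -> xi' <= 1 / 2 ->
  0 <= Z -> 0 <= M -> 0 <= A1 -> 0 <= A2 -> 0 <= U -> 0 <= P ->
  0 <= s -> 0 <= n -> 0 <= A ->
  74 / 100 * a <= a' -> 0 <= b' ->
  a' * Z + b' * M = a * ((1 - xc) * V) + b * V' ->
  (1 - xc) * (a + b) <= S' ->
  T <= (1 - xc) * V - 73 / 100 * A1 - 96 / 100 * (p * A2) - 3 / 10 * (y * U)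
    - 19 / 10 * P + 2 * xa ->
  EA <= (1 - xc) * A - 13 / 10 * (t ^+ 2 * s) - 2 * (t ^+ 2 * n)
    + 162 * (p * t * (g2 * U)) + 890 * (t ^+ 2 * (g2 * (A1 + A2))) + 1 / 2 * P ->
  2 * xa <= r * U + 1 / 5 * A1 + t ^+ 2 * (8 / 1000 * s + 6 / 1000 * n) ->
  (1 + xi') * (r * U) <= (xi - xi') * (74 / 100 * Z) + (1 + xi') * (1 / 5 * (y * U))
    + 1 / 100 * A1 ->
  p * t * g2 <= y / 40 -> t ^+ 2 * g2 <= p / 100 ->
  (1 + xi') * (a * T + b * V') + (a + b) / 100 * EA <=
  (1 + xi) * (a' * Z + b' * M) + S' / 100 * A.
Proof.
move=> p0 p1 y0 b0 ab x0 xx x1 Z0 M0 A10 A20 U0 P0 s0 n0 A0 aa' b'0 dec S'E hT hEA hxa hr h1 h2.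
have a0 : 0 <= a by clear -b0 ab; lra.
have ab0 : 0 <= (a + b) / 100 by clear -a0 b0; lra.
have ab1 : (a + b) / 100 <= 19 / 900 * a by clear -ab; lra.
have ab2 : a / 100 <= (a + b) / 100 by clear -b0; lra.
have x1' : 0 <= 1 + xi' by clear -x0; lra.
pose t2 := t ^+ 2; rewrite -/t2 in hEA hxa h2; have t20 : 0 <= t2 by exact: sqr_ge0.
have ts0 := mulr_ge0 t20 s0; have tn0 := mulr_ge0 t20 n0.
have yU0 := mulr_ge0 y0 U0; have pA0 := mulr_ge0 (ltW p0) A20.
have k1 := ler_wpM2l x1' (ler_wpM2l a0 hT).
have k2 := ler_wpM2l ab0 hEA.
have k3 := ler_wpM2l (mulr_ge0 x1' a0) hxa.
have k4 := ler_wpM2l a0 hr.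
have xx0 : 0 <= xi - xi' by rewrite subr_ge0.
have k5 := ler_wpM2l xx0 (ler_wpM2r Z0 aa').
have k6 := mulr_ge0 xx0 (mulr_ge0 b'0 M0).
have k7 := ler_wpM2r A0 S'E.
have g2a : t2 * (g2 * (A1 + A2)) <= 1 / 400 * A1 + 1 / 100 * (p * A2).
  have e1 := ler_wpM2r A10 h2; have e2 := ler_wpM2r A20 h2; have e3 := ler_wpM2r A10 p1.
  by move: e1 e2 e3; clear; lra.
have g2b : p * t * (g2 * U) <= y * U / 40.
  by have := ler_wpM2r U0 h1; clear; lra.
have rest : - 13 / 10 * (t2 * s) - 2 * (t2 * n)
    + 162 * (p * t * (g2 * U)) + 890 * (t2 * (g2 * (A1 + A2))) + 1 / 2 * P <=
  - 13 / 10 * (t2 * s) - 2 * (t2 * n) + 41 / 10 * (y * U) + 223 / 100 * A1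
    + 89 / 10 * (p * A2) + 1 / 2 * P by move: g2a g2b yU0 A10; clear; lra.
have k8 := ler_wpM2l ab0 rest.
have m1 := ler_wpM2r ts0 ab2; have m2 := ler_wpM2r tn0 ab2.
have m3 := ler_wpM2r yU0 ab1; have m4 := ler_wpM2r A10 ab1.
have m5 := ler_wpM2r pA0 ab1; have m6 := ler_wpM2r P0 ab1.
have n1 := mulr_ge0 a0 ts0; have n2 := mulr_ge0 a0 tn0; have n3 := mulr_ge0 a0 yU0.
have n4 := mulr_ge0 a0 A10; have n5 := mulr_ge0 a0 pA0; have n6 := mulr_ge0 a0 P0.
have o1 := ler_wpM2r n1 x1; have o2 := ler_wpM2r n2 x1.
have o3 := mulr_ge0 x0 n3; have o4 := mulr_ge0 x0 n4.
have o5 := mulr_ge0 x0 n5; have o6 := mulr_ge0 x0 n6.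
have dec' := congr1 (fun q => xi' * q) dec; move: dec' => /= dec'.
move: dec dec' k1 k2 k3 k4 k5 k6 k7 k8 m1 m2 m3 m4 m5 m6 n1 n2 n3 n4 n5 n6 o1 o2 o3 o4 o5 o6.
clearbody t2; clear.
lra.
Qed.

(* T / (2 (t + T)) with T = 18 / x: as the auxiliary weight [t] grows by p / 5 per
   iteration, the decrease of [ramp] absorbs the bias of the inner loop. *)
Definition ramp (R : realType) (x t : R) : R := 9 / (x * t + 18).

(* Coefficients of the squared error in two bounds on this bias: the first uses the
   geometric convergence of the inner loop alone, the second is paid for by the
   auxiliary Lyapunov function with weight [t]. *)
Definition drift_gain (R : realType) (x t r : R) : Prop :=
  r = 20 * x ^+ 6 \/ r = 550 * x ^+ 3 / t ^+ 2.

(** * Growth of the auxiliary weight *)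

Section schedule.
Variable R : realType.

Lemma ramp_ge0 (x t : R) : 0 < x -> 0 <= t -> 0 <= ramp x t.
Proof. by move=> x0 t0; rewrite divr_ge0// addr_ge0// mulr_ge0// ltW. Qed.

Lemma ramp_le (x t : R) : 0 < x -> 0 <= t -> ramp x t <= 1 / 2.
Proof.
move=> x0 t0; have := mulr_ge0 (ltW x0) t0.
by move=> h; rewrite /ramp ler_pdivrMr; lra.
Qed.

Lemma ramp_anti (x t t' : R) : 0 < x -> 0 <= t -> t <= t' -> ramp x t' <= ramp x t.
Proof.
move=> x0 t0 tt; have := mulr_ge0 (ltW x0) t0; have := ler_wpM2l (ltW x0) tt => h1 h2.
by rewrite ler_wpM2l// lef_pV2 ?posrE; lra.
Qed.

Lemma x4_le (x p : R) : 0 < p -> p <= 1 / 4 -> x ^+ 2 <= p / 40 -> x ^+ 4 <= p ^+ 2 / 40 / 40.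
Proof.
move=> p0 p1 xp; have p4 : 0 <= p / 40 by lra.
rewrite (_ : x ^+ 4 = x ^+ 2 * x ^+ 2); last by ring.
by apply: (le_trans (ler_pM (sqr_ge0 x) (sqr_ge0 x) xp xp)); lra.
Qed.

(** With [i], [j] the reciprocals in the two ramps, the ramp falls by [9 i j x p / 5], whereas
    [(1 + ramp) r <= 3300 x^5 i^2] in both regimes. As [x^4 <= p^2 / 1600], the fall wins. The
    regimes meet at [x t = 18], the offset in the ramp. *)
Lemma gain_uncapped (x p t r U Z A1 : R) : 0 < x -> x <= 2 / 25 -> 0 < p -> p <= 1 / 4 ->
  x ^+ 2 <= p / 40 -> 1 <= t -> 0 <= U -> 0 <= Z -> 0 <= A1 -> U <= 2 * Z + 2 * A1 ->
  (x * t <= 18 /\ r = 20 * x ^+ 6) \/ (18 <= x * t /\ r = 550 * x ^+ 3 / t ^+ 2) ->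
  (1 + ramp x (t + p / 5)) * (r * U) <=
    (ramp x t - ramp x (t + p / 5)) * (74 / 100 * Z) + 1 / 100 * A1.
Proof.
move=> x0 x1 p0 p1 xp t1 U0 Z0 A0 hU hr.
have t0 : 0 < t by lra.
have xt0 : 0 < x * t by exact: mulr_gt0.
have xp0 : 0 < x * p by exact: mulr_gt0.
have xp1 : x * p <= 1 / 50 by clear -x0 x1 p0 p1; nra.
rewrite /ramp; pose i := (x * t + 18)^-1; pose j := (x * (t + p / 5) + 18)^-1.
rewrite -/i -/j.
have iE : (x * t + 18) * i = 1 by rewrite /i divff// gt_eqF//; lra.
have jE : (x * (t + p / 5) + 18) * j = 1 by rewrite /j divff// gt_eqF//; lra.
have i0 : 0 < i by rewrite invr_gt0; lra.
have j0 : 0 < j by rewrite invr_gt0; lra.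
have i18 : i <= 1 / 18 by have := mulr_ge0 (ltW xt0) (ltW i0); clear -iE; lra.
have j18 : 9 * j <= 1 / 2.
  by have := mulr_ge0 (ltW xt0) (ltW j0); have := mulr_ge0 (ltW xp0) (ltW j0); clear -jE; lra.
have x5 : 0 <= x ^+ 5 by apply: exprn_ge0; exact: ltW.
have ij : i - j = i * j * (x * p / 5).
  have e : i * ((x * (t + p / 5) + 18) * j) - j * ((x * t + 18) * i) = i * j * (x * p / 5) by ring.
  by rewrite -e iE jE; ring.
have rb : (1 + 9 * j) * r <= 3300 * x ^+ 5 * i ^+ 2.
  have r0 : 0 <= r.
    case: hr => [[_ ->]|[_ ->]].
      by apply: mulr_ge0; [exact: ler0n|apply: exprn_ge0; exact: ltW].
    apply: divr_ge0; last by apply: exprn_ge0; exact: ltW.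
    by apply: mulr_ge0; [exact: ler0n|apply: exprn_ge0; exact: ltW].
  apply: (@le_trans _ _ (3 / 2 * r)).
    by apply: ler_wpM2r => //; clear -j18; lra.
  case: hr => [[xt ->]|[xt ->]].
    have i36 : 1 / 36 <= i by have := ler_wpM2r (ltW i0) xt; clear -iE; lra.
    have i2 : 1 / 36 * (1 / 36) <= i ^+ 2 by clear -i36; nra.
    have h := ler_wpM2l x5 i2.
    have h2 := ler_wpM2l x5 x1.
    have -> : x ^+ 6 = x ^+ 5 * x by ring.
    by move: h h2 x5; clear; lra.
  have ti : 1 <= (2 * (x * t) * i) ^+ 2.
    have : 1 <= 2 * (x * t) * i by have := ler_wpM2r (ltW i0) xt; clear -iE; lra.
    by clear; move: (2 * _ * i) => w; nra.
  have x3 : 0 <= x ^+ 3 / t ^+ 2 by rewrite divr_ge0// exprn_ge0// ltW.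
  have h := ler_wpM2l x3 ti.
  have e : x ^+ 3 / t ^+ 2 * (2 * (x * t) * i) ^+ 2 = 4 * x ^+ 5 * i ^+ 2.
    by field; rewrite gt_eqF.
  rewrite e in h; rewrite -(mulrA 550); move: h; clear; lra.
have ji : i <= 41 / 40 * j.
  have h1 := mulr_ge0 (mulr_ge0 (ltW i0) (ltW j0)) (ltW xp0).
  have h2 := ler_wpM2r (ltW j0) i18.
  have h3 := ler_wpM2l (mulr_ge0 (ltW i0) (ltW j0)) xp1.
  by clear -ij h1 h2 h3 i0 j0; lra.
have x4 := x4_le p0 p1 xp.
have main : 6600 * (x ^+ 5 * i ^+ 2) <= 74 / 100 * (9 * (i - j)).
  have xi2 : 0 <= x * i by apply: mulr_ge0; exact: ltW.
  have h1 : x ^+ 4 <= p / 40 / 160.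
    have p4 := ler_wpM2l (ltW p0) p1; move: x4 p4; clear; lra.
  have h2 := ler_wpM2l (mulr_ge0 xi2 (ltW i0)) h1.
  have h3 := ler_wpM2l (mulr_ge0 xi2 (ltW p0)) ji.
  have e : x ^+ 5 = x * x ^+ 4 by ring.
  have h4 := mulr_ge0 (mulr_ge0 xi2 (ltW p0)) (ltW j0).
  by rewrite ij e; move: h2 h3 h4; clear; lra.
have small : 6600 * (x ^+ 5 * i ^+ 2) <= 1 / 100.
  have h1 : i ^+ 2 <= 1 / 324 by clear -i0 i18; nra.
  have h2 := ler_wpM2l x5 h1.
  have x2 : x ^+ 2 <= 1 / 100 by clear -x0 x1; nra.
  have x3 : x ^+ 4 <= 1 / 100 / 100.
    rewrite (_ : x ^+ 4 = x ^+ 2 * x ^+ 2); last by ring.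
    by apply: (le_trans (ler_pM (sqr_ge0 x) (sqr_ge0 x) x2 x2)); clear; lra.
  have h3 := ler_wpM2l (ltW x0) x3.
  have e : x ^+ 5 = x * x ^+ 4 by ring.
  by move: h2 h3 x1; rewrite e; clear; lra.
have q1 := ler_wpM2r U0 rb.
have xi0 : 0 <= 3300 * x ^+ 5 * i ^+ 2 by exact: (mulr_ge0 (mulr_ge0 (ler0n R 3300) x5) (sqr_ge0 i)).
have q2 := ler_wpM2l xi0 hU.
have q3 := ler_wpM2r Z0 main; have q4 := ler_wpM2r A0 small.
move: q1 q2 q3 q4; clear; lra.
Qed.

(** [t] grows by [p / 5] until it reaches the cap [B]. The cap keeps [gamma mu t] and [t gamma L]
    small: [(y B)^2 = 6400 x^3 y <= (80 x^4)^2]. *)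
Lemma schedule_ex (x p y B t g2 : R) : 0 < x -> x <= 2 / 25 -> 0 < p -> p <= 1 / 4 ->
  x ^+ 2 <= p / 40 -> 0 < y -> y <= x ^+ 5 -> 0 <= B -> y * B ^+ 2 = 6400 * x ^+ 3 ->
  1600 * x ^+ 4 * g2 = p ^+ 2 * y ^+ 2 -> 0 <= g2 -> 1 <= t -> t <= B ->
  [/\ p * t * g2 <= y / 40, t ^+ 2 * g2 <= p / 100 & exists t' r,
   [/\ t <= t', t' <= t + p / 5, t' <= B, 11 / 10 * y * t' <= p / 20 &
   drift_gain x t r /\ forall U Z A1 : R, 0 <= U -> 0 <= Z -> 0 <= A1 -> U <= 2 * Z + 2 * A1 ->
  (1 + ramp x t') * (r * U) <= (ramp x t - ramp x t') * (74 / 100 * Z)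
     + (1 + ramp x t') * (1 / 5 * (y * U)) + 1 / 100 * A1]].
Proof.
move=> x0 x1 p0 p1 xp y0 yx B0 yB gE g0 t1 tB.
have x4 := x4_le p0 p1 xp.
have X4 : 0 < x ^+ 4 by exact: exprn_gt0.
have t0 : 0 <= t by clear -t1; lra.
have yB0 := mulr_ge0 (ltW y0) B0.
have x80 := mulr_ge0 (ler0n R 80) (ltW X4).
have yB80 : y * B <= 80 * x ^+ 4.
  rewrite -ler_sqr ?nnegrE//.
  have e : (y * B) ^+ 2 = y * (y * B ^+ 2) by ring.
  have x3 : 0 <= 6400 * x ^+ 3 := mulr_ge0 (ler0n R 6400) (exprn_ge0 3 (ltW x0)).
  rewrite e yB.
  apply: (le_trans (ler_wpM2r x3 yx)).
  by rewrite le_eqVlt (_ : _ == _)//; apply/eqP; ring.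
have pp : p ^+ 2 <= p / 4 by have := ler_wpM2l (ltW p0) p1; clear; lra.
have yB1 : y * B <= p / 80 by move: yB80 x4 pp; clear; lra.
have pgB : p * B * g2 <= y / 40.
  have x16 : 0 < 1600 * x ^+ 4 := mulr_gt0 (ltr0Sn R 1599) X4.
  rewrite -(ler_pM2l x16).
  have p2 : 0 <= p * p ^+ 2 * y := mulr_ge0 (mulr_ge0 (ltW p0) (sqr_ge0 p)) (ltW y0).
  have e : 1600 * x ^+ 4 * (p * B * g2) = p * B * (1600 * x ^+ 4 * g2) by rewrite mulrCA.
  rewrite e gE; have e2 : p * B * (p ^+ 2 * y ^+ 2) = p * p ^+ 2 * y * (y * B) by ring.
  rewrite e2; apply: (le_trans (ler_wpM2l p2 yB80)).
  have pq : p * p ^+ 2 <= 1 / 4.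
    by have := ler_wpM2l (ltW p0) pp; move: pp p1 p0; clear; nra.
  have yX := mulr_ge0 (ltW y0) (ltW X4).
  by have := ler_wpM2r yX pq; clear -yX; lra.
split.
- apply: le_trans pgB; apply: (ler_wpM2r g0); apply: ler_wpM2l => //; exact: ltW.
- have tt : t ^+ 2 <= B ^+ 2 by rewrite ler_sqr ?nnegrE.
  apply: (le_trans (ler_wpM2r g0 tt)).
  have e : (y * B) ^+ 2 * p ^+ 2 = 1600 * x ^+ 4 * (B ^+ 2 * g2).
    by rewrite [RHS]mulrCA gE; ring.
  have h1 : (y * B) ^+ 2 <= (80 * x ^+ 4) ^+ 2.
    by rewrite ler_sqr ?nnegrE.
  have h2 := ler_wpM2r (sqr_ge0 p) h1; rewrite e in h2.
  have h3 : B ^+ 2 * g2 <= 4 * x ^+ 4 * p ^+ 2.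
    rewrite -(ler_pM2l X4); move: h2; clear; lra.
  apply: (le_trans h3).
  have x4' : 4 * x ^+ 4 <= 1 / 25 by move: x4 pp p1; clear; lra.
  by have := ler_wpM2r (sqr_ge0 p) x4'; clear -pp; lra.
have [h|h] := leP (t + p / 5) B.
- exists (t + p / 5); have [xt|/ltW xt] := leP (x * t) 18.
  + exists (20 * x ^+ 6); split=> //; first by clear -p0; lra.
      by have := ler_wpM2l (ltW y0) h; clear -yB1 p0; lra.
    split; first by left.
    move=> U Z A1 U0 Z0 A0 hU.
    apply: (le_trans (gain_uncapped x0 x1 p0 p1 xp t1 U0 Z0 A0 hU _)).
      by left.
    rewrite lerD2r lerDl mulr_ge0 ?mulr_ge0 ?(ltW y0)//.
    by rewrite addr_ge0// ramp_ge0// addr_ge0// divr_ge0// ltW.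
  + exists (550 * x ^+ 3 / t ^+ 2); split=> //; first by clear -p0; lra.
      by have := ler_wpM2l (ltW y0) h; clear -yB1 p0; lra.
    split; first by right.
    move=> U Z A1 U0 Z0 A0 hU.
    apply: (le_trans (gain_uncapped x0 x1 p0 p1 xp t1 U0 Z0 A0 hU _)).
      by right.
    rewrite lerD2r lerDl mulr_ge0 ?mulr_ge0 ?(ltW y0)//.
    by rewrite addr_ge0// ramp_ge0// addr_ge0// divr_ge0// ltW.
(* Within [p / 5] of the cap, [t >= 9/10 B], so [y t^2 >= 5184 x^3] and [r <= y / 5]: the
   contraction itself absorbs the bias and no fall of the ramp is needed. *)
exists B, (550 * x ^+ 3 / t ^+ 2); split=> //; first exact: ltW.
  by move: yB1 p0; clear; lra.
split; first by right.
move=> U Z A1 U0 Z0 A0 hU.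
have tp : 0 < t ^+ 2 := exprn_gt0 2 (lt_le_trans ltr01 t1).
have t9 : 9 / 10 * B <= t by move: h t1 p1; clear; lra.
have ty : 550 * x ^+ 3 <= 1 / 5 * (y * t ^+ 2).
  have h1 : (9 / 10 * B) ^+ 2 <= t ^+ 2 by rewrite ler_sqr ?nnegrE ?mulr_ge0.
  have h2 := ler_wpM2l (ltW y0) h1.
  have x3 : 0 <= x ^+ 3 := exprn_ge0 3 (ltW x0).
  have e : y * (9 / 10 * B) ^+ 2 = 81 / 100 * (y * B ^+ 2) by field.
  rewrite e yB in h2; move: h2 x3; clear; lra.
have hr : 550 * x ^+ 3 / t ^+ 2 * U <= 1 / 5 * (y * U).
  rewrite [leRHS]mulrA; apply: ler_wpM2r => //.
  by rewrite (ler_pdivrMr _ _ tp) -(mulrA (1 / 5)).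
have rB : 0 <= 1 + ramp x B by rewrite addr_ge0// ramp_ge0.
have h1 := ler_wpM2l rB hr.
have h2 : 0 <= (ramp x t - ramp x B) * (74 / 100 * Z).
  by rewrite mulr_ge0 ?subr_ge0 ?ramp_anti// mulr_ge0.
by move: h1 h2 A0; clear; lra.
Qed.

End schedule.

(** * Weights and bias of the inner loop *)

(* Weights of the squared errors of z and m when [j] iterations remain: the coin
   replaces m by z with probability p, and the energy inequality moves a fraction
   (1 - k) p of the weight from z to m. *)
Section weights.
Variables (R : realType) (p k xc : R).

Fixpoint wts (j : nat) : R * R :=
  if j is i.+1 then
    let: (a, b) := wts i in
    ((1 - xc) * (1 - (1 - k) * p) * a + p * b, (1 - xc) * ((1 - k) * p) * a + (1 - p) * b)
  else (1, 0).

Hypotheses (p0 : 0 < p) (p1 : p <= 1 / 4) (k0 : 0 <= k) (k1 : k <= 1 / 1000).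
Hypotheses (xc0 : 0 <= xc) (xc1 : xc <= 1 / 1000) (xcp : xc <= p / 20).

Let q0 : 0 <= (1 - k) * p. Proof. by rewrite mulr_ge0 ?(ltW p0)//; have := k1; lra. Qed.
Let q1 : (1 - k) * p <= p. Proof. by rewrite ler_piMl ?(ltW p0)//; have := k0; lra. Qed.
Let xc' : 0 <= 1 - xc. Proof. by have := xc1; lra. Qed.
Let c1 : 74 / 100 <= (1 - xc) * (1 - (1 - k) * p).
Proof. by have := ler_wpM2l xc0 q0; have := q1; have := p1; have := xc1; have := xc0; have := q0; lra. Qed.
Let c2 : (1 - xc) * ((1 - k) * p) <= p.
Proof. by apply: le_trans q1; rewrite ler_piMl//; have := xc0; lra. Qed.

Lemma wts_ge0 j : 0 <= (wts j).1 /\ 0 <= (wts j).2.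
Proof.
elim: j => [|j]; first by rewrite /= ler01.
rewrite /=; case: (wts j) => a b /= [a0 b0].
have h1 : 0 <= (1 - xc) * (1 - (1 - k) * p) by have := c1; lra.
have p' : 0 <= 1 - p by have := p1; lra.
by split; apply: addr_ge0; apply: mulr_ge0 => //; [exact: ltW|exact: mulr_ge0].
Qed.

(** The auxiliary function enters with weight [(a + b) / 100], but its cost is paid by dissipation
    weighted by [a] alone. *)
Lemma wts_ratio j : 9 / 10 * (wts j).2 <= (wts j).1.
Proof.
elim: j => [|j]; first by rewrite /= mulr0.
have := wts_ge0 j; rewrite /=; case: (wts j) => a b /= [a0 b0] ab.
have c9 : 0 <= 9 / 10 - 19 / 10 * p by have := p1; lra.
have h1 := ler_wpM2l c9 ab; have h2 := ler_wpM2r a0 c2.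
have h3 := ler_wpM2r a0 xcp; have h4 := mulr_ge0 (mulr_ge0 xc0 q0) a0.
have h5 := ler_wpM2r a0 q1; have h6 := mulr_ge0 (ltW p0) a0.
by move: h1 h2 h3 h4 h5 h6; lra.
Qed.

Lemma wts_step j : 74 / 100 * (wts j).1 <= (wts j.+1).1.
Proof.
have := wts_ge0 j; rewrite /=; case: (wts j) => a b /= [a0 b0].
have h1 := ler_wpM2r a0 c1; have h2 := mulr_ge0 (ltW p0) b0.
by apply: (le_trans h1); rewrite lerDl.
Qed.

Lemma wts_sum j : (1 - xc) * ((wts j).1 + (wts j).2) <= (wts j.+1).1 + (wts j.+1).2.
Proof.
have := wts_ge0 j; rewrite /=; case: (wts j) => a b /= [a0 b0].
by have := mulr_ge0 xc0 b0; lra.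
Qed.

Lemma wts_expand j (Z M : R) : (wts j.+1).1 * Z + (wts j.+1).2 * M =
  (wts j).1 * ((1 - xc) * ((1 - (1 - k) * p) * Z + (1 - k) * p * M))
  + (wts j).2 * (p * Z + (1 - p) * M).
Proof. by rewrite /=; case: (wts j) => a b /=; ring. Qed.

(** The coin only redistributes the weight of [m], so [a + b] need not contract at once;
    [a + (1 + 3 y / (5 p)) b] does, by [1 - y / 2] per iteration. *)
Lemma wts_decay (y : R) j : xc = 11 / 10 * y -> 0 <= y -> y <= p / 3 ->
  (wts j).1 + (wts j).2 <= (1 - y / 2) ^+ j.
Proof.
move=> xE y0 y3; pose t := 1 + 3 / 5 * (y / p).
have yp : y / p <= 1 / 3 by rewrite ler_pdivrMr//; move: y3; lra.
have yp0 : 0 <= y / p by rewrite divr_ge0// ltW.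
have pyp : p * (y / p) = y by rewrite mulrC divfK// gt_eqF.
have t1 : 1 <= t by rewrite /t; lra.
have y12 : y <= 1 / 12 by have := p1; lra.
suff : (wts j).1 + t * (wts j).2 <= (1 - y / 2) ^+ j.
  apply: le_trans; rewrite lerD2l ler_peMl//.
  by case: (wts_ge0 j).
elim: j => [|j]; first by rewrite /= mulr0 addr0 expr0.
have := wts_ge0 j; rewrite exprS /=; case: (wts j) => a b /= [a0 b0] ih.
have l0 : 0 <= 1 - y / 2 by lra.
apply: (le_trans _ (ler_wpM2l l0 ih)).
have h1 : (1 - xc) * (1 - (1 - k) * p) + t * ((1 - xc) * ((1 - k) * p)) <= 1 - y / 2.
  have e : (1 - xc) * (1 - (1 - k) * p) + t * ((1 - xc) * ((1 - k) * p)) =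
    (1 - xc) * (1 + 3 / 5 * ((1 - k) * (p * (y / p)))) by rewrite /t; ring.
  rewrite e pyp.
  have e2 : (1 - k) * y <= y by rewrite ler_piMl//; have := k0; lra.
  have e3 : (1 - xc) * (1 + 3 / 5 * ((1 - k) * y)) <= (1 - xc) * (1 + 3 / 5 * y).
    by apply: ler_wpM2l => //; lra.
  apply: (le_trans e3); rewrite xE; have := sqr_ge0 y; lra.
have h2 : p + t * (1 - p) <= (1 - y / 2) * t.
  have -> : p + t * (1 - p) = t - 3 / 5 * (p * (y / p)) by rewrite /t; ring.
  have t12 : t <= 6 / 5 by rewrite /t; lra.
  by rewrite pyp; have := ler_wpM2l y0 t12; lra.
have m1 := ler_wpM2r a0 h1; have m2 := ler_wpM2r b0 h2.
by move: m1 m2; lra.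
Qed.

End weights.

Section gain.
Variables (R : realType) (d : nat).
Implicit Types (e v : 'rV[R]_d).

Lemma gain_direct e v (x A : R) : 0 < x -> sq v <= 4 * x ^+ 6 * A ->
  2 * dotp e v <= 20 * x ^+ 6 * sq e + 1 / 5 * A.
Proof.
move=> x0 hv; have t0 : 0 < 20 * x ^+ 6 := mulr_gt0 (ltr0Sn R 19) (exprn_gt0 6 x0).
apply: (le_trans (dotp_young e v t0)); rewrite lerD2l ler_pdivrMl//.
by apply: (le_trans hv); lra.
Qed.

(** Young's inequality with weight [550 x^3 / t^2]: the factor [k <= x^3] in the drift bound cancels
    [x^3] and leaves [t^2] times quantities that the auxiliary function dissipates. The constant 550
    is [(44/10) / (8/1000)]. *)
Lemma gain_drift e v q (x t k S n A g2 : R) : 0 < x -> 0 < t -> 0 <= k -> k <= x ^+ 3 ->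
  k <= 1 / 1000 -> 0 <= S -> 0 <= n -> 0 <= A -> 0 <= g2 -> g2 <= 1 / 1000 ->
  t ^+ 2 * g2 <= 1 / 20 -> sq q = n ->
  sq (v - k *: q) <= k * (4 * S + 2 * n + 300 * g2 * (2 * A + 2 * n)) ->
  2 * dotp e v <= 550 * x ^+ 3 / t ^+ 2 * sq e + 1 / 5 * A
    + t ^+ 2 * (8 / 1000 * S + 6 / 1000 * n).
Proof.
move=> x0 t0 k0 kx k1 S0 n0 A0 g0 g1 tg qn hv.
have x3 : 0 < x ^+ 3 by exact: exprn_gt0.
have t2 : 0 < t ^+ 2 by exact: exprn_gt0.
have r0 : 0 < 550 * x ^+ 3 / t ^+ 2 := divr_gt0 (mulr_gt0 (ltr0Sn R 549) x3) t2.
apply: (le_trans (dotp_young e v r0)); rewrite -addrA lerD2l.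
have y0 : (0 : R) < 1 / 10 by lra.
have h := sqD_young (v - k *: q) (k *: q) y0; rewrite subrK in h.
rewrite [sq (k *: q)]sqZ qn in h.
have B0 : 0 <= 44 / 10 * S + 3 * n + 660 * (g2 * A).
  have := mulr_ge0 g0 A0; lra.
have hb : sq v <= k * (44 / 10 * S + 3 * n + 660 * (g2 * A)).
  have e1 := ler_wpM2r (mulr_ge0 k0 n0) g1; have e2 := ler_wpM2r (mulr_ge0 k0 n0) k1.
  have e3 := mulr_ge0 k0 n0.
  by move: h hv e1 e2 e3; clear; dot_gen; lra.
have hx := le_trans hb (ler_wpM2r B0 kx).
have e550 : x ^+ 3 * (t ^+ 2 / (550 * x ^+ 3)) = t ^+ 2 / 550.
  by field; rewrite gt_eqF.
rewrite invf_div; set w := t ^+ 2 / _ in e550 *.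
have w0 : 0 <= w := divr_ge0 (ltW t2) (mulr_ge0 (ler0n R 550) (ltW x3)).
have h1 := ler_wpM2l w0 hx.
rewrite [X in _ <= X](_ : _ = t ^+ 2 / 550 * (44 / 10 * S + 3 * n + 660 * (g2 * A))) in h1;
  last by rewrite -e550 mulrCA mulrA.
apply: (le_trans h1).
have tA := ler_wpM2r A0 tg; have tn := mulr_ge0 (ltW t2) n0; have tS := mulr_ge0 (ltW t2) S0.
by move: tA tn tS A0; clear; lra.
Qed.

End gain.

(** The relation for [g] and [y <= x^5] give [g <= p x^3 / 40]; the rest follows from this and
    [x^2 <= 1/160]. *)
Lemma hard_param_bounds (R : realType) (x p y g k : R) : 0 < x -> x <= 2 / 25 ->
  0 < p -> p <= 1 / 4 -> x ^+ 2 <= p / 40 -> 0 < y -> y <= x ^+ 5 -> 0 <= g ->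
  40 * x ^+ 2 * g = p * y -> 0 <= k -> k <= x ^+ 3 ->
  [/\ y <= 1 / 40 / 50, k <= 1 / 40 / 50, g <= 1 / 124, 4 * g ^+ 2 <= p / 1000 & 11 / 10 * y <= p / 20]
  /\ [/\ k ^+ 2 * (4 * g ^+ 2) <= p * y ^+ 2 / 1000, 4 * g ^+ 2 * x ^+ 6 <= y ^+ 2 / 1000,
    1600 * x ^+ 4 * g ^+ 2 = p ^+ 2 * y ^+ 2, x ^+ 6 <= 1 / 1000 & g ^+ 2 <= 1 / 1000].
Proof.
move=> x0 x1 p0 p1 xp y0 yx g0 gE k0 kx.
have x2 : x ^+ 2 <= 1 / 160 by move: xp p1; clear; lra.
have x20 := sqr_ge0 x.
have x3e : x ^+ 3 = x * x ^+ 2 by ring.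
have x3 : x ^+ 3 <= 1 / 40 / 50.
  by rewrite x3e; apply: (le_trans (ler_pM (ltW x0) x20 x1 x2)); clear; lra.
have x30 : 0 <= x ^+ 3 := exprn_ge0 3 (ltW x0).
have x5e : x ^+ 5 = x ^+ 3 * x ^+ 2 by ring.
have x6e : x ^+ 6 = x ^+ 3 * x ^+ 3 by ring.
have x5 : x ^+ 5 <= 1 / 40 / 50 * x ^+ 2 by rewrite x5e; apply: ler_wpM2r.
have y1 : y <= 1 / 40 / 50 by move: yx x5 x2; clear; lra.
have x2p : 0 < x ^+ 2 := exprn_gt0 2 x0.
have gx : g <= p * x ^+ 3 / 40.
  rewrite -(ler_pM2l x2p).
  by have := ler_wpM2l (ltW p0) yx; rewrite x5e; move: gE; clear; lra.
have g4 : 1600 * x ^+ 4 * g ^+ 2 = p ^+ 2 * y ^+ 2.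
  have -> : 1600 * x ^+ 4 * g ^+ 2 = (40 * x ^+ 2 * g) ^+ 2 by ring.
  by rewrite gE exprMn.
have pg : g <= p / 1000 / 10.
  by have := ler_wpM2l (ltW p0) x3; move: gx p0; clear; lra.
have g1 : g <= 1 / 1000 by move: pg p1; clear; lra.
have gg : g ^+ 2 <= p / 1000 / 10.
  rewrite expr2; apply: le_trans pg; rewrite ler_piMl//.
  by move: g1; clear; lra.
have gx6 : 4 * g ^+ 2 * x ^+ 6 = p ^+ 2 * y ^+ 2 * x ^+ 2 / 400 by rewrite -g4; field.
have py0 := mulr_ge0 (ltW p0) (sqr_ge0 y).
have pyx : p ^+ 2 * y ^+ 2 * x ^+ 2 / 400 <= p * y ^+ 2 / 1000.
  have h1 := ler_wpM2r py0 p1; have h2 := ler_wpM2l (mulr_ge0 (ltW p0) py0) x2.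
  by move: h1 h2 py0; clear; lra.
split; split=> //.
- exact: le_trans x3.
- by move: g1; clear; lra.
- by move: gg p0; clear; lra.
- by move: yx x5 xp p0; clear; lra.
- apply: le_trans pyx; rewrite -gx6 x6e mulrC; apply: ler_wpM2l.
    exact: (mulr_ge0 (ler0n R 4) (sqr_ge0 g)).
  by rewrite expr2; apply: ler_pM.
- rewrite gx6; apply: (le_trans pyx); have := ler_wpM2r (sqr_ge0 y) p1.
  by have := sqr_ge0 y; clear; lra.
- rewrite x6e; apply: (le_trans (ler_wpM2r x30 x3)).
  by move: x3; clear; lra.
- by move: gg p1; clear; lra.
Qed.

Lemma le_2000_weaken (R : realType) (v : R) : v <= 1 / 40 / 50 ->
  v <= 1 / 1000 /\ 11 / 10 * v <= 1 / 1000.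
Proof. by move=> h; split; lra. Qed.

(** * Nodes and the auxiliary Lyapunov function *)

(* A point together with the ideal point [anchor] that it perturbs; [resid] is
   a [slack]-approximate normal vector at the anchor after removing the operator. *)
Record node (R : realType) (d : nat) :=
  Node { pt : 'rV[R]_d; anchor : 'rV[R]_d; resid : 'rV[R]_d; slack : R }.

(** Index [a] refers to the node of [z], [b] to that of [m]. The factor [1 / p] at [rb] compensates
    for the rare renewal of [m]. *)
Definition aux_val (R : realType) (p k t Q sa sb na nb fa fb ra rb l : R) : R :=
  t ^+ 2 * (Q + 4 * sa + 9 * p * sb + 14 * na + 14 * nb)
  + 14 * p * (t * (fa + (1 - k) * fb + ra / 5 + rb / (10 * p) + 2 / 25 * (p * l)))
  + 8 * p ^+ 2 * fa + 4 * p * fb.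

Lemma aux_val_avg (R : realType) (p k t Qa Qb sa s so na n no fp f fo rp ry ro la lb : R) :
  p != 0 ->
  p * aux_val p k t Qa sa s na n fp f rp ry la
  + (1 - p) * aux_val p k t Qb sa so na no fp fo rp ro lb =
  t ^+ 2 * (p * Qa + (1 - p) * Qb + 4 * sa + 9 * p * (p * s + (1 - p) * so) + 14 * na
    + 14 * (p * n + (1 - p) * no))
  + 14 * p * (t * (fp + (1 - k) * (p * f + (1 - p) * fo) + rp / 5
     + (ry / 10 + ro / (10 * p) - ro / 10) + 2 / 25 * (p * (p * la + (1 - p) * lb))))
  + 8 * p ^+ 2 * fp + 4 * p * (p * f + (1 - p) * fo).
Proof. by move=> p0; rewrite /aux_val; field. Qed.

Lemma aux_val_ge0 (R : realType) (p k t Q sa sb na nb fa fb ra rb l : R) :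
  0 < p -> k <= 1 -> 0 <= t -> 0 <= Q + 4 * sa + 9 * p * sb -> 0 <= na -> 0 <= nb ->
  0 <= fa -> 0 <= fb -> 0 <= ra -> 0 <= rb -> 0 <= l ->
  0 <= aux_val p k t Q sa sb na nb fa fb ra rb l.
Proof.
move=> p0 k1 t0 Q0 na0 nb0 fa0 fb0 ra0 rb0 l0; have p0' := ltW p0.
have w0 : 0 <= rb / (10 * p) by rewrite divr_ge0// mulr_ge0.
have om0 : 0 <= 1 - k by rewrite subr_ge0.
by rewrite /aux_val; repeat first [done | apply: addr_ge0 | apply: mulr_ge0
  | apply: divr_ge0 | apply: exprn_ge0].
Qed.

(** [a], [b], [g] are the inner products of residual and anchor differences. After averaging over
    the coin, [a] is left with coefficient [2 - 2 q - 2 q p >= 11/8], and [a >= (1 - k) S - s]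
    yields the dissipation of [S]. *)
Lemma resid_scalar (R : realType) (p k q sr ry ro a b g e S s so : R) :
  0 < p -> p <= 1 / 4 -> 0 <= k -> k <= 1 / 40 / 50 -> q = (1 - k) * p -> q <= p ->
  0 <= q -> 0 <= S -> 0 <= e -> 0 <= s -> 0 <= so ->
  (1 - k) * sr + 2 * (1 - q) * a + 2 * q * b <=
    (1 - k) * ((1 - q) * ry + q * ro) + (1 - k) * e + 2 * q * (1 - q) * g ->
  (1 - k) * S - s <= a -> - (k * S) - so <= b -> - (s + so) <= g ->
  p * ((1 - k) * sr + (1 - k) ^+ 2 * ry + 2 * q * a)
  + (1 - p) * ((1 - k) * sr + (1 - k) ^+ 2 * ro + 2 * q * b) <=
  (1 - k) * ry + (1 - k) ^+ 2 * ro + 2 * q * g + e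
  - 137 / 100 * S + 17 / 8 * s + 4 * p ^+ 2 * so.
Proof.
move=> p0 p1 k0 k1 qE qp q0 S0 e0 s0 so0 main hA hB hG.
have qq : q * q <= p * p by exact: ler_pM.
have qpp : q * p <= p * p by apply: ler_wpM2r => //; exact: ltW.
have pp4 : p * p <= 1 / 16 by clear -p0 p1; nra.
have qp0 := mulr_ge0 q0 (ltW p0).
have ca : 11 / 8 <= 2 - 2 * q - 2 * (q * p) by clear -qpp pp4 qp p1; lra.
have ca' : 2 - 2 * q - 2 * (q * p) <= 2 by clear -qp0 q0; lra.
have ca0 : 0 <= 2 - 2 * q - 2 * (q * p) by clear -ca; lra.
have h1 := ler_wpM2l ca0 hA; have h2 := ler_wpM2l qp0 hB.
have h3 := ler_wpM2l (mulr_ge0 q0 q0) hG.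
have kS := mulr_ge0 k0 S0; have h4 := ler_wpM2r S0 k1.
have h5 := ler_wpM2r S0 ca; have h6 := ler_wpM2r s0 ca'.
have h7 := ler_wpM2r so0 qpp; have h8 := ler_wpM2r so0 qq.
have h9 := ler_wpM2r kS ca'; have h10 := ler_wpM2r s0 qq.
have h11 := ler_wpM2r s0 pp4; have h12 := ler_wpM2r kS pp4; have h13 := ler_wpM2r kS qpp.
have h14 := mulr_ge0 k0 e0.
have eqn : p * ((1 - k) * sr + (1 - k) ^+ 2 * ry + 2 * q * a)
  + (1 - p) * ((1 - k) * sr + (1 - k) ^+ 2 * ro + 2 * q * b) -
  ((1 - k) * ry + (1 - k) ^+ 2 * ro + 2 * q * g) =
  (1 - k) * sr + 2 * (1 - q) * a + 2 * q * b
  - ((1 - k) * ((1 - q) * ry + q * ro) + 2 * q * (1 - q) * g)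
  - (2 - 2 * q - 2 * (q * p)) * a - 2 * (q * p * b) - 2 * (q * q * g).
  by rewrite qE; ring.
move: main h1 h2 h3 h4 h5 h6 h7 h8 h9 h10 h11 h12 h13 h14 eqn; clear -S0; lra.
Qed.

Section node_step.
Variables (R : realType) (d : nat) (Z : set 'rV[R]_d).
Variables (F G : 'rV[R]_d -> 'rV[R]_d) (c : 'rV[R]_d) (p k gamma L : R).
Hypothesis Zcv : convex_set (Z : set (convex_lmodType 'rV[R]_d)).
Hypotheses (p0 : 0 < p) (p1 : p <= 1 / 4) (k0 : 0 <= k) (k1 : k <= 1 / 40 / 50).
Hypotheses (g0 : 0 < gamma) (L0 : 0 < L) (gL : gamma * L <= 1 / 124).
Hypothesis Fmono : forall u v : 'rV[R]_d, Z u -> Z v -> 0 <= dotp (F u - F v) (u - v).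
Hypothesis Flip : forall u v : 'rV[R]_d, Z u -> Z v -> sq (F u - F v) <= L ^+ 2 * sq (u - v).
Hypothesis Glip : forall u v : 'rV[R]_d, Z u -> Z v ->
  sq (G u - G v) <= 4 * L ^+ 2 * sq (u - v).
Hypothesis cZ : Z c.
Hypothesis Fc : forall v : 'rV[R]_d, Z v -> 0 <= dotp (F c) (v - c).

Let kle1 : k <= 1. Proof. by have := k1; lra. Qed.
Let om0 : 0 <= 1 - k. Proof. by rewrite subr_ge0. Qed.

Definition valid (a : node R d) : Prop :=
  [/\ Z (pt a), Z (anchor a), 0 <= slack a & forall v : 'rV[R]_d, Z v ->
    dotp (resid a - gamma *: F (anchor a)) (v - anchor a) <= slack a].

Definition pot (a : node R d) : R := gamma * dotp (F c) (anchor a - c).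
Definition off (a : node R d) : R := sq (pt a - anchor a).
Definition quad (a b : node R d) : R :=
  (1 - k) * sq (resid a) + (1 - k) ^+ 2 * sq (resid b)
  + 2 * ((1 - k) * p) * dotp (resid a - resid b) (anchor a - anchor b).
Definition aux (t : R) (a b : node R d) : R :=
  aux_val p k t (quad a b) (slack a) (slack b) (off a) (off b) (pot a) (pot b)
    (sq (resid a)) (sq (resid b)) (sq (anchor a - anchor b)).

Lemma pot_ge0 a : valid a -> 0 <= pot a.
Proof. by case=> _ Za _ _; rewrite mulr_ge0 ?(ltW g0)// Fc. Qed.

(** Each approximate normal is tested at the other anchor; monotonicity of [F] leaves only the
    slacks. *)
Lemma quad_lower a b : valid a -> valid b ->
  - (2 * ((1 - k) * p) * (slack a + slack b)) <= quad a b.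
Proof.
case: a b => [z y r s] [m o ro so] [/= _ Zy s0 ha] [/= _ Zo so0 hb]; rewrite /quad/=.
have h1 := ha _ Zo; have h2 := hb _ Zy; have h3 := mulr_ge0 (ltW g0) (Fmono Zy Zo).
have h : - (s + so) <= dotp (r - ro) (y - o).
  by move: h1 h2 h3; rewrite !dotpE; comm6 r ro y o (F y) (F o); dot_gen; lra.
have q0 : 0 <= 2 * ((1 - k) * p) by rewrite !mulr_ge0// ltW.
have := ler_wpM2l q0 h.
have := mulr_ge0 om0 (sq_ge0 r); have := mulr_ge0 (sqr_ge0 (1 - k)) (sq_ge0 ro).
by move: (2 * ((1 - k) * p)) => q; lra.
Qed.

Lemma quad_upper a b : quad a b <=
  2 * (sq (resid a) + sq (resid b)) + 2 * p ^+ 2 * sq (anchor a - anchor b).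
Proof.
rewrite /quad; set r := resid a; set ro := resid b; set l := anchor a - anchor b.
have h := sq_ge0 (r - ro - (2 * ((1 - k) * p)) *: l).
have h2 := sq_ge0 (r + ro).
have q2 : ((1 - k) * p) ^+ 2 <= p ^+ 2.
  by rewrite exprMn ler_piMl ?sqr_ge0// expr_le1//; have := k0; lra.
have h3 := ler_wpM2r (sq_ge0 l) q2.
have h4 : (1 - k) * sq r <= sq r by rewrite ler_piMl ?sq_ge0// gerBl.
have h5 : (1 - k) ^+ 2 * sq ro <= sq ro.
  by rewrite ler_piMl ?sq_ge0// expr_le1// gerBl.
move: h h2 h3 h4 h5; clearbody r ro l.
rewrite !sqE !dotpE; comm3 r ro l; dot_gen; lra.
Qed.

Lemma aux_ge0 t a b : 0 <= t -> valid a -> valid b -> 0 <= aux t a b.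
Proof.
move=> t0 va vb; have h := quad_lower va vb.
have [[_ _ sa0 _] [_ _ sb0 _]] := (va, vb).
apply: aux_val_ge0; rewrite ?sq_ge0 ?pot_ge0//.
have pk : (1 - k) * p <= p by rewrite ler_piMl ?(ltW p0)// gerBl.
have h1 := ler_wpM2r sa0 pk; have h2 := ler_wpM2r sb0 pk.
have h3 := ler_wpM2r sa0 p1; have h4 := mulr_ge0 (ltW p0) sb0.
by move: h h1 h2 h3 h4; lra.
Qed.

Variables (a b : node R d) (s N u : 'rV[R]_d).
Hypotheses (va : valid a) (vb : valid b) (Zs : Z s) (Zu : Z u).
Let z := pt a.
Let m := pt b.
Let y := anchor a.
Let o := anchor b.
Hypothesis NE : N = ((1 - p) *: z + p *: m) - s - gamma *: (F s + (G s - G m)).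
Hypothesis hN : forall v : 'rV[R]_d, Z v -> dotp N (v - s) <= 0.
Hypothesis hu : sq (u - s) <= sq (s - z) / 1000.
Hypothesis hdrift : sq (u - s + k *: (s - y)) <=
  k * (4 * dotp N (s - y) + 2 * sq (z - y) + 300 * (gamma * L) ^+ 2 * sq (s - y)).

Definition next_anchor : 'rV[R]_d := (1 - k) *: s + k *: y.
(** Removing [gamma F] from this residual leaves [N], and [<N, v - y+> = <N, v - s> + k <N, s - y>]
    explains the slack. *)
Definition next_node (zn : 'rV[R]_d) : node R d :=
  Node zn next_anchor (gamma *: F next_anchor + N) (k * dotp N (s - y)).

Let Zy : Z y. Proof. by case: va. Qed.
Let Zo : Z o. Proof. by case: vb. Qed.
Let Zz : Z z. Proof. by case: va. Qed.
Let Zm : Z m. Proof. by case: vb. Qed.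
Let yp := next_anchor.
Let Rp := gamma *: F yp + N.
Let S := dotp N (s - y).
Let g2 := (gamma * L) ^+ 2.
Let A1 := sq (s - z).
Let A2 := sq (s - m).

Lemma next_anchor_in : Z yp.
Proof.
rewrite /yp /next_anchor addrC -[X in _ + X *: s]/(1 - k).
exact: convex_mem.
Qed.

Lemma normal_gap_ge0 v : Z v -> 0 <= dotp N (s - v).
Proof. by move=> Zv; rewrite -opprB dotpNr oppr_ge0 hN. Qed.

Lemma next_valid zn : Z zn -> valid (next_node zn).
Proof.
move=> Zzn; split=> //=; first exact: next_anchor_in.
  by rewrite mulr_ge0// normal_gap_ge0.
move=> v Zv; have h := hN Zv; move: h.
by rewrite /next_anchor addrAC subrr add0r !dotpE; comm4 N s v y; dot_gen; lra.
Qed.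

Let nb := (1 - p) *: (z - y) + p *: (m - o).
Let wt := (1 - p) *: y + p *: o.
Let D := gamma *: (G s - G m).
Let E := gamma *: (F s - F yp) + D - nb.

Let sD : sq D <= 4 * g2 * A2.
Proof.
have := ler_wpM2l (sqr_ge0 gamma) (Glip Zs Zm).
by rewrite /D /A2 sqZ /g2; dot_gen => h; apply: (le_trans h); rewrite le_eqVlt (_ : _ == _)//; apply/eqP; ring.
Qed.

Let snb : sq nb <= (1 - p) * off a + p * off b.
Proof. by apply: sq_convex; [exact: ltW|have := p1; lra]. Qed.

Lemma next_resid_drift :
  p * quad (next_node z) a + (1 - p) * quad (next_node z) b <=
  quad a b + sq E - 137 / 100 * S + 17 / 8 * slack a + 4 * p ^+ 2 * slack b.
Proof.
have [[_ _ sa0 ha] [_ _ sb0 hb]] := (va, vb).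
have Zyp := next_anchor_in.
pose q := (1 - k) * p.
have q0 : 0 <= q by rewrite mulr_ge0// ltW.
have qp : q <= p by rewrite ler_piMl ?(ltW p0)// gerBl.
have q1 : q <= 1 by have := p1; lra.
have ypE : yp = (1 - q) *: y + q *: o - (1 - k) *: (Rp + E).
  by rewrite /E /Rp NE /D /nb /yp /q; apply/rowP => i; rewrite !mxE; ring.
have main := resid_drift (resid a) (resid b) om0 q0 q1 ypE.
rewrite /quad/= -/Rp -/yp -/y -/o -/q.
have hA : (1 - k) * S - slack a <= dotp (Rp - resid a) (yp - y).
  have h1 := ha _ Zyp; have h2 := mulr_ge0 (ltW g0) (Fmono Zyp Zy).
  have e : dotp N (yp - y) = (1 - k) * S.
    rewrite /S /yp /next_anchor; rewrite !dotpE; lra.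
  move: h1 h2 e; rewrite /Rp -/y; move: (resid a) (slack a) => r sl.
  rewrite !dotpE; comm6 N yp y r (F yp) (F y); dot_gen; lra.
have hB : - (k * S) - slack b <= dotp (Rp - resid b) (yp - o).
  have h1 := hb _ Zyp; have h2 := mulr_ge0 (ltW g0) (Fmono Zyp Zo).
  have h3 := normal_gap_ge0 Zo.
  have e : dotp N (yp - o) = dotp N (s - o) - k * S.
    rewrite /S /yp /next_anchor; rewrite !dotpE; lra.
  move: h1 h2 h3 e; rewrite /Rp -/o; move: (resid b) (slack b) => r sl.
  rewrite !dotpE; comm6 N yp o r (F yp) (F o); dot_gen; lra.
have hG : - (slack a + slack b) <= dotp (resid a - resid b) (y - o).
  have h1 := ha _ Zo; have h2 := hb _ Zy; have h3 := mulr_ge0 (ltW g0) (Fmono Zy Zo).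
  move: h1 h2 h3; rewrite -/y -/o; move: (resid a) (resid b) (slack a) (slack b) => r ro sl slo.
  rewrite !dotpE; comm6 r ro y o (F y) (F o); dot_gen; lra.
have S0 : 0 <= S by exact: normal_gap_ge0.
have sE0 := sq_ge0 E.
by apply: (resid_scalar p0 p1 k0 k1 erefl qp q0 S0 sE0 sa0 sb0 main hA hB hG).
Qed.

Let n := off a.
Let no := off b.
Let n0 : 0 <= n. Proof. exact: sq_ge0. Qed.
Let no0 : 0 <= no. Proof. exact: sq_ge0. Qed.
Let g20 : 0 <= g2. Proof. exact: sqr_ge0. Qed.

Let g2_le : g2 <= 1 / 124.
Proof.
have h0 := mulr_ge0 (ltW g0) (ltW L0); have h := ler_wpM2l h0 gL.
by rewrite /g2 expr2; have := gL; lra.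
Qed.

Let g2_le1 : g2 <= 1. Proof. by have := g2_le; lra. Qed.

Let snb' : sq nb <= n + p * no.
Proof. by apply: (le_trans snb); have := mulr_ge0 (ltW p0) n0; rewrite -/n -/no; lra. Qed.

Lemma anchor_gap_le : sq (s - y) <= 2 * A1 + 2 * n.
Proof.
rewrite (_ : s - y = (s - z) + (z - y)); last by rewrite addrA subrK.
exact: sqD2.
Qed.

Let sF v w : Z v -> Z w -> sq (gamma *: (F v - F w)) <= g2 * sq (v - w).
Proof.
move=> Zv Zw; have := ler_wpM2l (sqr_ge0 gamma) (Flip Zv Zw).
by rewrite sqZ /g2 exprMn mulrA.
Qed.

Lemma step_error_le : sq E <= 111 / 100 * n + 11 / 10 * (p * no) + 100 * (g2 * (A1 + A2)).
Proof.
have h := sq_split3 (- nb) (gamma *: (F s - F yp)) D.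
have e : - nb + (gamma *: (F s - F yp) + D) = E by rewrite /E addrC.
rewrite e sqN in h.
have h1 := sF Zs next_anchor_in.
have e2 : s - yp = k *: (s - y).
  by rewrite /yp /next_anchor; apply/rowP => i; rewrite !mxE; ring.
rewrite e2 [X in _ <= g2 * X]sqZ in h1.
have k2 : k ^+ 2 <= 1 / 100 / 100 by have := k0; have := k1; nra.
have h2 := ler_wpM2l (sqr_ge0 k) anchor_gap_le.
have A10 : 0 <= 2 * A1 + 2 * n by rewrite addr_ge0// mulr_ge0// sq_ge0.
have h3 := ler_wpM2l g20 (le_trans h2 (ler_wpM2r A10 k2)).
have gA1 := mulr_ge0 g20 (sq_ge0 (s - z)); have gA2 := mulr_ge0 g20 (sq_ge0 (s - m)).
have g2n : g2 * n <= n.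
  by rewrite ler_piMl// g2_le1.
rewrite -/A1 in gA1; rewrite -/A2 in gA2.
have := snb'; have := sD.
move: h h1 h3 gA1 gA2 g2n; have := n0.
lra.
Qed.

Lemma step_error_vi_le : sq (nb - D - gamma *: (F s - F c)) <=
  11 / 10 * n + 11 / 10 * (p * no) + 88 * (g2 * A2) + 22 * (g2 * sq (s - c)).
Proof.
have h := sq_split3 nb (- D) (- (gamma *: (F s - F c))).
rewrite !sqN addrA in h.
have := sF Zs cZ; have := snb'; have := sD.
by move: h; lra.
Qed.

Lemma pot_drift : gamma * dotp (F c) (s - c) <=
  (1 - p) * pot a + p * pot b - 1 / 2 * sq (wt - s)
  + 1 / 2 * sq (nb - D - gamma *: (F s - F c)).
Proof.
have Zwt : Z wt.
  rewrite /wt addrC -[X in _ + X *: y]/(1 - p).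
  by apply: convex_mem => //; [exact: ltW|have := p1; lra].
have wE : (1 - p) *: z + p *: m = wt + nb.
  by rewrite /wt /nb; apply/rowP => i; rewrite !mxE; ring.
have NE' : N = (1 - p) *: z + p *: m - s - gamma *: (F s + (G s - G m)) by [].
have := potential_drift (F c) wE NE' (hN Zwt).
have -> : gamma * dotp (F c) (wt - s) =
    (1 - p) * pot a + p * pot b - gamma * dotp (F c) (s - c).
  rewrite /pot /wt -/y -/o !dotpE; lra.
by rewrite -/D; lra.
Qed.

Lemma next_pot zn : pot (next_node zn) = (1 - k) * (gamma * dotp (F c) (s - c)) + k * pot a.
Proof. by rewrite /pot/= /next_anchor -/y !dotpE; lra. Qed.

Lemma next_resid_le : sq Rp <= 4 / 3 * sq (wt - s) + 4 * sq E.
Proof.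
apply: sq_resid_le; rewrite /E /Rp NE /D /wt /nb.
by apply/rowP => i; rewrite !mxE; ring.
Qed.

Lemma next_gap : p * (p * sq (yp - y) + (1 - p) * sq (yp - o)) <=
  p * ((1 - 3 / 2 * p) * sq (y - o)) + 2 * sq (wt - s).
Proof.
have k1' : k <= 1 / 1000 by have := k1; lra.
have h := spread_drift p0 p1 k0 k1' (erefl wt) (erefl yp).
have := ler_wpM2l (ltW p0) h.
rewrite [leRHS](_ : _ = p * ((1 - 3 / 2 * p) * sq (y - o)) + 2 * sq (wt - s)) //.
by field; rewrite gt_eqF.
Qed.

Lemma next_off_le (V : R) :
  V <= 2 * sq (u - yp) + 8 * (g2 * sq (m - u)) ->
  V <= 8 * k * S + 1 / 100 * n + 20 * (g2 * (A1 + A2)).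
Proof.
move=> /le_trans; apply.
have e : u - yp = u - s + k *: (s - y).
  by rewrite /yp /next_anchor; apply/rowP => i; rewrite !mxE; ring.
have h1 := hdrift; rewrite -e in h1.
have kg := mulr_ge0 k0 g20.
have h2 := ler_wpM2l kg anchor_gap_le.
have h3 : sq (m - u) <= 2 * A2 + 2 * (A1 / 1000).
  have := sqD2 (m - s) (s - u); rewrite addrA subrK (sqBC m s) (sqBC s u) -/A2 => h.
  by have := hu; rewrite -/A1; move: h; lra.
have h4 := ler_wpM2l g20 h3.
have gA1 : 0 <= g2 * A1 := mulr_ge0 g20 (sq_ge0 (s - z)).
have gA2 : 0 <= g2 * A2 := mulr_ge0 g20 (sq_ge0 (s - m)).
have kn := ler_wpM2r n0 k1; have kg1 := ler_wpM2r gA1 k1.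
have gn := ler_wpM2r (mulr_ge0 k0 n0) g2_le.
move: h1 h2 h4 gA1 gA2 kn kg1 gn n0; rewrite -/S -[sq (z - y)]/n -/g2.
lra.
Qed.

(** [V] stands for the squared offset of the new point. The dependence on it is affine, so averaging
    over the draws means inserting its mean. *)
Definition next_aux (t V : R) (e : node R d) : R :=
  aux_val p k t (quad (next_node z) e) (k * S) (slack e) V (off e)
    (pot (next_node z)) (pot e) (sq Rp) (sq (resid e)) (sq (yp - anchor e)).

Lemma aux_nextE t zn e : aux t (next_node zn) e =
  next_aux t 0 e + 14 * t ^+ 2 * sq (zn - yp).
Proof. by rewrite /next_aux /aux /aux_val /quad /pot /off /Rp /S /yp /=; ring. Qed.

Lemma next_aux_shift t V e : next_aux t V e = next_aux t 0 e + 14 * t ^+ 2 * V.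
Proof. by rewrite /next_aux /aux_val /=; ring. Qed.

Lemma aux_step (xc t t' : R) (V : R) :
  0 <= xc -> xc * t' <= p / 20 -> 1 <= t -> t <= t' -> t' <= t + p / 5 ->
  V <= 2 * sq (u - yp) + 8 * (g2 * sq (m - u)) ->
  p * next_aux t' V a + (1 - p) * next_aux t' V b <=
  (1 - xc) * aux t a b - 13 / 10 * (t ^+ 2 * S) - 2 * (t ^+ 2 * n)
  + 162 * (p * t * (g2 * sq (s - c))) + 890 * (t ^+ 2 * (g2 * (A1 + A2)))
  + 1 / 2 * (gamma * dotp (F c) (s - c)).
Proof.
move=> xc0 xct t1 tt tt' hV; rewrite /aux /next_aux aux_val_avg ?gt_eqF//.
have sp : small_params p k xc t t' g2 by [].
have w0 : 0 <= sq (resid b) / (10 * p) by rewrite divr_ge0 ?sq_ge0// mulr_ge0// ltW.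
have wE : 10 * (p * (sq (resid b) / (10 * p))) = sq (resid b) by field; rewrite gt_eqF.
have S0 : 0 <= S by exact: normal_gap_ge0.
have [[_ _ sa0 _] [_ _ sb0 _]] := (va, vb).
have F0 : 0 <= gamma * dotp (F c) (s - c) by rewrite mulr_ge0 ?(ltW g0)// Fc.
exact: (aux_drift sp (pot_ge0 va) (pot_ge0 vb) F0 (sq_ge0 _) (sq_ge0 _) (sq_ge0 _)
  S0 sa0 sb0 n0 no0 (sq_ge0 _) (sq_ge0 _) (sq_ge0 _) (sq_ge0 _) (sq_ge0 _) wE w0
  next_resid_drift (quad_upper _ _) (next_off_le hV) (next_pot _) pot_drift
  next_resid_le next_gap step_error_le step_error_vi_le).
Qed.

Variables (mu x B : R).
Hypotheses (mu0 : 0 < mu) (x0 : 0 < x) (x1 : x <= 2 / 25) (xp : x ^+ 2 <= p / 40).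
Hypothesis Fsmono : forall v w : 'rV[R]_d, Z v -> Z w ->
  mu * sq (v - w) <= dotp (F v - F w) (v - w).
Hypotheses (kx : k <= x ^+ 3) (hux : sq (u - s) <= x ^+ 6 * sq (s - z)).
Hypotheses (yx : gamma * mu <= x ^+ 5) (xE : 40 * x ^+ 2 * (gamma * L) = p * (gamma * mu)).
Hypotheses (B0 : 0 <= B) (yB : gamma * mu * B ^+ 2 = 6400 * x ^+ 3).
Variables (T : finType) (A : {set T}) (zn : T -> 'rV[R]_d).
Hypothesis A0 : A != finset.set0.
Hypothesis hzn : forall v : 'rV[R]_d, Z v -> avg A (fun i => sq (zn i - v)) <=
  sq (u - v) + 2 * gamma * dotp (G u - G m) (u - v) + 4 * g2 * sq (m - u).

Let xc := 11 / 10 * (gamma * mu).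

Definition bound (j : nat) (t : R) (a b : node R d) : R :=
  let: (al, be) := wts p k xc j in
  (1 + ramp x t) * (al * sq (pt a - c) + be * sq (pt b - c))
  + (al + be) / 100 * aux t a b.

Lemma bound_nextE j t i :
  p * bound j t (next_node (zn i)) a + (1 - p) * bound j t (next_node (zn i)) b =
  ((1 + ramp x t) * ((wts p k xc j).2 * (p * sq (z - c) + (1 - p) * sq (m - c)))
   + ((wts p k xc j).1 + (wts p k xc j).2) / 100 *
     (p * next_aux t 0 a + (1 - p) * next_aux t 0 b))
  + ((1 + ramp x t) * (wts p k xc j).1) * sq (zn i - c)
  + (((wts p k xc j).1 + (wts p k xc j).2) / 100 * (14 * t ^+ 2)) * sq (zn i - yp).
Proof.
rewrite /bound; case: (wts p k xc j) => al be /=.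
by rewrite !aux_nextE /z /m; ring.
Qed.

Lemma bound_avgE j t :
  avg A (fun i => p * bound j t (next_node (zn i)) a + (1 - p) * bound j t (next_node (zn i)) b) =
  (1 + ramp x t) * ((wts p k xc j).1 * avg A (fun i => sq (zn i - c))
    + (wts p k xc j).2 * (p * sq (z - c) + (1 - p) * sq (m - c)))
  + ((wts p k xc j).1 + (wts p k xc j).2) / 100 *
    (p * next_aux t (avg A (fun i => sq (zn i - yp))) a
     + (1 - p) * next_aux t (avg A (fun i => sq (zn i - yp))) b).
Proof.
rewrite (_ : (fun i => _) = (fun i =>
  ((1 + ramp x t) * ((wts p k xc j).2 * (p * sq (z - c) + (1 - p) * sq (m - c)))
   + ((wts p k xc j).1 + (wts p k xc j).2) / 100 *
     (p * next_aux t 0 a + (1 - p) * next_aux t 0 b))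
  + ((1 + ramp x t) * (wts p k xc j).1) * sq (zn i - c)
  + (((wts p k xc j).1 + (wts p k xc j).2) / 100 * (14 * t ^+ 2)) * sq (zn i - yp))).
  rewrite avg_affine// [in RHS](next_aux_shift t (avg _ _)) [in RHS](next_aux_shift t (avg _ _)).
  by ring.
by apply/funext => i; exact: bound_nextE.
Qed.

Lemma next_avg_off : avg A (fun i => sq (zn i - yp)) <=
  2 * sq (u - yp) + 8 * (g2 * sq (m - u)).
Proof.
apply: (le_trans (hzn next_anchor_in)).
have h := dotp_young (u - yp) (gamma *: (G u - G m)) (ltr01 : 0 < 1 :> R).
have := ler_wpM2l (sqr_ge0 gamma) (Glip Zu Zm).
rewrite dotpZr (dotpC (u - yp)) invr1 sqZ in h.
have -> : gamma ^+ 2 * (4 * L ^+ 2 * sq (u - m)) = 4 * (g2 * sq (m - u)).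
  by rewrite (sqBC u m) /g2; ring.
by move: h; lra.
Qed.

Lemma boundE j t e f : bound j t e f =
  (1 + ramp x t) * ((wts p k xc j).1 * sq (pt e - c) + (wts p k xc j).2 * sq (pt f - c))
  + ((wts p k xc j).1 + (wts p k xc j).2) / 100 * aux t e f.
Proof. by rewrite /bound; case: (wts p k xc j). Qed.

(** The weight [t'] is the same for all draws and coins, so the induction can use it under the
    average. *)
Lemma hard_node_step j t : 1 <= t -> t <= B -> exists t', [/\ 1 <= t', t' <= B &
  avg A (fun i => p * bound j t' (next_node (zn i)) a
    + (1 - p) * bound j t' (next_node (zn i)) b) <= bound j.+1 t a b].
Proof.
move=> t1 tB; have t0 : 0 <= t := le_trans ler01 t1.
have p100 : p / 100 <= 1 / 20 by have := p1; lra.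
have y0 : 0 < gamma * mu := mulr_gt0 g0 mu0.
have gl0 : 0 <= gamma * L := mulr_ge0 (ltW g0) (ltW L0).
have [[y1 k1' gl d1 ycp] [kd gx gE x6 gg]] := hard_param_bounds x0 x1 p0 p1 xp y0 yx gl0 xE k0 kx.
have [hpt htg [t' [r [tt tt' tB' xct [dg hr]]]]] :=
  schedule_ex x0 x1 p0 p1 xp y0 yx B0 yB gE (sqr_ge0 _) t1 tB.
have t'1 : 1 <= t' := le_trans t1 tt.
have t'0 : 0 <= t' := le_trans t0 tt.
exists t'; split=> //; rewrite bound_avgE boundE.
have xc0 : 0 <= xc by apply: mulr_ge0; [rewrite divr_ge0|exact: ltW].
have [y1000 kwts] := le_2000_weaken y1; have [k1000 _] := le_2000_weaken k1'.
rewrite -/xc in kwts.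
have U0 := sq_ge0 (s - c).
have S0 : 0 <= S by exact: normal_gap_ge0.
have P0 : 0 <= gamma * dotp (F c) (s - c) by rewrite mulr_ge0 ?(ltW g0)// Fc.
have [al0 be0] := wts_ge0 p0 p1 k0 k1000 xc0 kwts j.
have [_ be'0] := wts_ge0 p0 p1 k0 k1000 xc0 kwts j.+1.
have xcp : xc <= p / 20 by [].
have ratio := wts_ratio p0 p1 k0 k1000 xc0 kwts xcp j.
have hx0 := ramp_ge0 x0 t'0.
have hxx := ramp_anti x0 t0 tt.
have hx1 := ramp_le x0 t'0.
have hstep := aux_step xc0 xct t1 tt tt' next_avg_off.
have hgain : 2 * dotp (s - c) (u - ((1 - k) *: s + k *: z)) <=
    r * sq (s - c) + 1 / 5 * A1 + t ^+ 2 * (8 / 1000 * S + 6 / 1000 * n).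
  have tSn : 0 <= t ^+ 2 * (8 / 1000 * S + 6 / 1000 * n).
    exact: (mulr_ge0 (sqr_ge0 t) (addr_ge0
      (mulr_ge0 (divr_ge0 (ler0n R 8) (ler0n R 1000)) S0)
      (mulr_ge0 (divr_ge0 (ler0n R 6) (ler0n R 1000)) n0))).
  (* First gain: geometric convergence alone. Second gain: the drift bound about the anchor, shifted
     by [k *: (y - z)]. *)
  case: dg => ->.
    apply: (le_trans (gain_direct _ x0 (A := A1) _)); last by rewrite lerDl.
    rewrite (_ : u - _ = (u - s) + k *: (s - z)); last first.
      by apply/rowP => i; rewrite !mxE; ring.
    apply: (le_trans (sqD2 _ _)); rewrite sqZ.
    have k2 : k ^+ 2 <= x ^+ 6.
      have -> : x ^+ 6 = x ^+ 3 * x ^+ 3 by ring.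
      by rewrite expr2; apply: ler_pM.
    have h1 := ler_wpM2r (sq_ge0 (s - z)) k2.
    rewrite (_ : 4 * x ^+ 6 * A1 = 2 * (x ^+ 6 * A1) + 2 * (x ^+ 6 * A1)); last by ring.
    by apply: lerD; apply: (ler_wpM2l (ler0n R 2)).
  apply: (@gain_drift _ _ _ _ (y - z) x t k S n A1 g2) => //.
  - exact: lt_le_trans t1.
  - exact: sq_ge0.
  - exact: (le_trans htg p100).
  - exact: sqBC.
  - rewrite (_ : _ - k *: _ = u - s + k *: (s - y)); last first.
      by apply/rowP => i; rewrite !mxE; ring.
    apply: (le_trans hdrift); apply: ler_wpM2l => //; rewrite lerD2l.
    rewrite -[(gamma * L) ^+ 2]/g2; apply: ler_wpM2l; last exact: anchor_gap_le.
    exact: (mulr_ge0 (ler0n R 300) g20).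
have hU : sq (s - c) <= 2 * sq (z - c) + 2 * A1.
  have := sqD2 (z - c) (s - z); rewrite (_ : z - c + (s - z) = s - c); last first.
    by rewrite addrC addrA subrK.
  by [].
have hr' := hr _ _ _ U0 (sq_ge0 (z - c)) (sq_ge0 (s - z)) hU.
have hT : avg A (fun i => sq (zn i - c)) <=
    (1 - xc) * ((1 - (1 - k) * p) * sq (z - c) + (1 - k) * p * sq (m - c))
  - 73 / 100 * A1 - 96 / 100 * (p * A2)
  - 3 / 10 * (gamma * mu * sq (s - c)) - 19 / 10 * (gamma * dotp (F c) (s - c))
  + 2 * dotp (s - c) (u - ((1 - k) *: s + k *: z)).
  apply: (le_trans (hzn cZ)).
  have Du : gamma *: (G u - G m - (G s - G m)) = gamma *: (G u - G s).
    by congr (_ *: _); rewrite opprB addrA subrK.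
  have d0 : 0 <= 4 * g2 := mulr_ge0 (ler0n R 4) g20.
  have hus : sq (gamma *: (G u - G m - (G s - G m))) <= 4 * g2 * sq (u - s).
    rewrite Du sqZ; apply: (le_trans (ler_wpM2l (sqr_ge0 gamma) (Glip Zu Zs))).
    by rewrite le_eqVlt (_ : _ == _)//; apply/eqP; rewrite /g2; ring.
  have hde : 4 * g2 * sq (u - s) <= (gamma * mu) ^+ 2 / 1000 * sq (s - z).
    apply: (le_trans (ler_wpM2l d0 hux)); rewrite mulrA.
    by apply: (ler_wpM2r (sq_ge0 _)).
  exact: (hard_step p0 p1 g0 mu0 y1000 k0 k1000 d0 d1 kd NE (hN cZ) (Fc Zs)
    (Fsmono Zs cZ) hu sD hus hde).
exact: (hard_value p0 p1 (ltW y0) be0 ratio hx0 hxx hx1 (sq_ge0 _) (sq_ge0 _)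
  (sq_ge0 _) (sq_ge0 _) U0 P0 S0 n0 (aux_ge0 t0 va vb)
  (wts_step p0 p1 k0 k1000 xc0 kwts j) be'0 (wts_expand p k xc j _ _)
  (wts_sum p0 p1 k0 k1000 xc0 kwts j) hT hstep hgain hr' hpt htg).
Qed.

End node_step.

(** * Backward induction *)

Lemma start_scalar (R : realType) (U n f r D X Z0 y g2 : R) : 0 <= U -> 0 <= n -> 0 <= f -> 0 <= y ->
  0 <= g2 -> g2 <= 1 / 1000 -> D <= 4 * g2 * n ->
  U + X + 2 * y * U + 2 * f <= Z0 - n -> - (1 * D + 1^-1 * U) <= X ->
  r <= (1 + 1 / 10) * n + (1 + (1 / 10)^-1) * D ->
  [/\ n <= 21 / 20 * Z0, f <= 1 / 2 * Z0 & r <= 5 / 4 * Z0].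
Proof.
move=> U0 n0 f0 y0' g20 g21 hD h hX hr; rewrite invr1 in hX.
have := mulr_ge0 y0' U0; have := ler_wpM2r n0 g21.
by move: hD h hX hr; clear -U0 n0 f0; split; lra.
Qed.

Lemma start_aux (R : realType) (p k Q n f r Z0 : R) : 0 < p -> p <= 1 / 4 ->
  0 <= k -> 0 <= n -> 0 <= f -> 0 <= r -> Q <= 4 * r ->
  n <= 21 / 20 * Z0 -> f <= 1 / 2 * Z0 -> r <= 5 / 4 * Z0 ->
  aux_val p k 1 Q 0 0 n n f f r r 0 <= 50 * Z0.
Proof.
move=> p0 p1 k0 n0 f0 r0 hQ hn hf hr.
rewrite (_ : aux_val _ _ _ _ _ _ _ _ _ _ _ _ _ =
  Q + 28 * n + 14 * p * (2 * f) - 14 * (p * (k * f)) + 14 / 5 * (p * r) + 14 / 10 * r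
  + 8 * (p * (p * f)) + 4 * (p * f)); last by rewrite /aux_val; field; rewrite gt_eqF.
have h1 := mulr_ge0 (ltW p0) (mulr_ge0 k0 f0).
have h2 := ler_wpM2r f0 p1; have h3 := ler_wpM2r r0 p1.
have h4 := ler_wpM2r (mulr_ge0 (ltW p0) f0) p1.
by move: hQ hn hf hr h1 h2 h3 h4; clear -n0 f0 r0; lra.
Qed.

Section chain.
Variables (R : realType) (d : nat) (S : finType) (A : {set S}) (p : R).
Variables (step : S -> 'rV[R]_d -> 'rV[R]_d -> 'rV[R]_d) (c : 'rV[R]_d).

(* Conditional expectation of the final squared error, [j] iterations before
   the end, given the current pair [(z, m)]. *)
Fixpoint value (j : nat) (z m : 'rV[R]_d) : R :=
  if j is i.+1 then
    avg A (fun s => p * value i (step s z m) z + (1 - p) * value i (step s z m) m)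
  else sq (z - c).

Variables (Z : set 'rV[R]_d) (F G : 'rV[R]_d -> 'rV[R]_d) (gamma dd : R).

(* [s] is the exact solution of the inner problem, [N] its residual and [u] the
   output of the inner loop. *)
Definition round (z m s u N : 'rV[R]_d) : Prop :=
  [/\ Z s, Z u, N = ((1 - p) *: z + p *: m) - s - gamma *: (F s + (G s - G m)),
      forall v, Z v -> dotp N (v - s) <= 0 &
      forall v, Z v -> avg A (fun i => sq (step i z m - v)) <=
        sq (u - v) + 2 * gamma * dotp (G u - G m) (u - v) + dd * sq (m - u)].

Hypotheses (A0 : A != finset.set0) (cZ : Z c) (p0 : 0 < p) (p1 : p <= 1 / 4).
Hypothesis stepZ : forall i z m, Z (step i z m).
Hypothesis Fc : forall v : 'rV[R]_d, Z v -> 0 <= dotp (F c) (v - c).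

Let p' : 0 <= 1 - p. Proof. by have := p1; lra. Qed.

Lemma value_le (f : 'rV[R]_d -> 'rV[R]_d -> R) j z m : Z z -> Z m ->
  (forall z m, Z z -> Z m -> value j z m <= f z m) ->
  value j.+1 z m <= avg A (fun s => p * f (step s z m) z + (1 - p) * f (step s z m) m).
Proof.
move=> Zz Zm h; apply: avg_le => i _.
by apply: lerD; apply: ler_wpM2l; rewrite ?(ltW p0)//; apply: h.
Qed.

(** The Lyapunov function is the plain sum of both squared errors; with equal starting points it is
    twice the initial error. *)
Lemma easy_chain (mu k : R) : 0 < gamma -> 0 < mu -> gamma * mu <= p / 3 ->
  0 <= k -> k <= gamma * mu / 10 -> k <= 1 / 1000 -> 0 <= dd -> dd <= p / 16 ->
  (forall v w : 'rV[R]_d, Z v -> Z w -> mu * sq (v - w) <= dotp (F v - F w) (v - w)) ->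
  (forall v w : 'rV[R]_d, Z v -> Z w -> sq (gamma *: (G v - G w)) <= dd * sq (v - w)) ->
  (forall z m, Z z -> Z m -> exists s u N, round z m s u N /\ sq (u - s) <= k * sq (s - z)) ->
  forall j z m, Z z -> Z m ->
  value j z m <= (1 - gamma * mu / 2) ^+ j * (sq (z - c) + sq (m - c)).
Proof.
move=> g0 mu0 y1 k0 ky k1 d0 d1 Fsm Gl hr; elim=> [|j ih] z m Zz Zm.
  by rewrite expr0 mul1r lerDl sq_ge0.
apply: (le_trans (value_le Zz Zm ih)).
have [s [u [N [[Zs Zu NE hN hA] hu]]]] := hr _ _ Zz Zm.
have Du : G u - G m - (G s - G m) = G u - G s by rewrite opprB addrA subrK.
have hDe : sq (gamma *: (G u - G m - (G s - G m))) <= dd * sq (u - s) by rewrite Du; exact: Gl.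
have es := easy_step p0 p1 g0 mu0 y1 k0 ky k1 d0 d1 NE (hN _ cZ) (Fc Zs) (Fsm _ _ Zs cZ)
  hu (Gl _ _ Zs Zm) hDe.
have l0 : 0 <= 1 - gamma * mu / 2 by move: y1 p1 p0; lra.
set l := 1 - gamma * mu / 2 in l0 *; have lj := exprn_ge0 j l0.
rewrite (_ : (fun i => _) = (fun i => l ^+ j * (p * sq (z - c) + (1 - p) * sq (m - c))
  + l ^+ j * sq (step i z m - c) + 0 * 0)); last first.
  by apply/funext => i; ring.
rewrite avg_affine// mul0r addr0 -mulrDr exprSr -mulrA; apply: ler_wpM2l => //.
have := hA _ cZ; rewrite /l; move: es; lra.
Qed.

Section hard.
Variables (mu L k x B : R).
Hypothesis Zcv : convex_set (Z : set (convex_lmodType 'rV[R]_d)).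
Hypotheses (g0 : 0 < gamma) (L0 : 0 < L) (mu0 : 0 < mu) (k0 : 0 <= k).
Hypotheses (x0 : 0 < x) (x1 : x <= 2 / 25) (xp : x ^+ 2 <= p / 40) (kx : k <= x ^+ 3).
Hypotheses (yx : gamma * mu <= x ^+ 5) (xE : 40 * x ^+ 2 * (gamma * L) = p * (gamma * mu)).
Hypotheses (B0 : 0 <= B) (yB : gamma * mu * B ^+ 2 = 6400 * x ^+ 3).
Hypothesis ddE : dd = 4 * (gamma * L) ^+ 2.
Hypothesis Fsmono : forall v w : 'rV[R]_d, Z v -> Z w ->
  mu * sq (v - w) <= dotp (F v - F w) (v - w).
Hypothesis Flip : forall u v : 'rV[R]_d, Z u -> Z v -> sq (F u - F v) <= L ^+ 2 * sq (u - v).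
Hypothesis Glip : forall u v : 'rV[R]_d, Z u -> Z v ->
  sq (G u - G v) <= 4 * L ^+ 2 * sq (u - v).
Hypothesis hround : forall z m, Z z -> Z m -> exists s u N, [/\ round z m s u N,
  sq (u - s) <= x ^+ 6 * sq (s - z) &
  forall y, Z y -> sq (u - s + k *: (s - y)) <=
    k * (4 * dotp N (s - y) + 2 * sq (z - y) + 300 * (gamma * L) ^+ 2 * sq (s - y))].

Let y0 : 0 < gamma * mu. Proof. exact: mulr_gt0. Qed.
Let gl0 : 0 <= gamma * L. Proof. by apply: mulr_ge0; exact: ltW. Qed.
Let params := hard_param_bounds x0 x1 p0 p1 xp y0 yx gl0 xE k0 kx.

Let Fmono (u v : 'rV[R]_d) : Z u -> Z v -> 0 <= dotp (F u - F v) (u - v).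
Proof. by move=> Zu Zv; apply: le_trans (Fsmono Zu Zv); rewrite mulr_ge0 ?sq_ge0// ltW. Qed.

Let k1 : k <= 1 / 40 / 50. Proof. by case: params => [[]]. Qed.
Let gL : gamma * L <= 1 / 124. Proof. by case: params => [[]]. Qed.
Let k1000 : k <= 1 / 1000. Proof. by have := k1; lra. Qed.
Let xc := 11 / 10 * (gamma * mu).
Let xc0 : 0 <= xc. Proof. by rewrite /xc; have := y0; lra. Qed.
Let xc1 : xc <= 1 / 1000.
Proof. by rewrite /xc; case: params => [[y1 _ _ _ _] _]; move: y1; lra. Qed.

Lemma hard_chain j a b t : valid Z F gamma a -> valid Z F gamma b ->
  1 <= t -> t <= B -> value j (pt a) (pt b) <= bound F c p k gamma mu x j t a b.
Proof.
elim: j a b t => [|j ih] a b t va vb t1 tB; have t0 := le_trans ler01 t1.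
  rewrite boundE /= mul1r mul0r !addr0.
  have h1 := ramp_ge0 x0 t0; have h2 := aux_ge0 p0 p1 k0 k1 g0 Fmono Fc t0 va vb.
  apply: ler_wpDr; first by rewrite mulr_ge0// divr_ge0.
  by rewrite mulrDl mul1r lerDl mulr_ge0 ?sq_ge0.
have [[Zz Zy _ _] [Zm _ _ _]] := (va, vb).
have [s [u [N [[Zs Zu NE hN hA] hux hdr]]]] := hround Zz Zm.
have hu : sq (u - s) <= sq (s - pt a) / 1000.
  apply: (le_trans hux); rewrite [leRHS]mulrC; apply: ler_wpM2r; first exact: sq_ge0.
  by case: params => _ [_ _ _ h _]; rewrite -[leRHS]mul1r.
have hA' (v : 'rV[R]_d) : Z v -> avg A (fun i => sq (step i (pt a) (pt b) - v)) <=
    sq (u - v) + 2 * gamma * dotp (G u - G (pt b)) (u - v)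
    + 4 * (gamma * L) ^+ 2 * sq (pt b - u).
  by move=> Zv; rewrite -ddE; exact: hA.
have [t' [t'1 t'B hst]] := hard_node_step Zcv p0 p1 k0 k1 g0 L0 gL Fmono Flip Glip cZ Fc
  va vb Zs Zu NE hN hu (hdr _ Zy) mu0 x0 x1 xp Fsmono kx hux yx xE B0 yB A0 hA' j t1 tB.
apply: le_trans hst; apply: avg_le => i _.
have vn := next_valid Zcv k0 k1 va Zs hN (stepZ i (pt a) (pt b)).
apply: lerD; apply: ler_wpM2l; rewrite ?(ltW p0)//.
  exact: (ih (next_node F k gamma a s N (step i (pt a) (pt b))) a).
exact: (ih (next_node F k gamma a s N (step i (pt a) (pt b))) b).
Qed.

(** The constant 2 is [3/2 + 50/100]: the largest ramp factor plus the initial auxiliary function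
    with its weight [1/100]. *)
Lemma hard_bound K z : Z z -> 1 <= B ->
  value K z z <= (1 - gamma * mu / 2) ^+ K * (2 * sq (z - c)).
Proof.
move=> Zz B1; have [s [u [N [[Zs Zu NE hN hA] _ _]]]] := hround Zz Zz.
(* Both points start at [z]. The first inner solution is an anchor with an exact normal, so the
   slack is 0. *)
pose a := Node z s (gamma *: F s + N) 0.
have va : valid Z F gamma a.
  by split=> //= v Zv; rewrite addrAC subrr add0r; exact: hN.
apply: (le_trans (hard_chain K va va (lexx 1) B1)); rewrite boundE /=.
have NE' := NE; have en := prox_energy g0 NE' (hN _ cZ) (Fsmono Zs cZ).
have P0 : 0 <= gamma * dotp (F c) (s - c) by rewrite mulr_ge0 ?(ltW g0)// Fc.
have sD : sq (gamma *: (G s - G z)) <= 4 * (gamma * L) ^+ 2 * sq (s - z).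
  rewrite sqZ; apply: (le_trans (ler_wpM2l (sqr_ge0 gamma) (Glip Zs Zz))).
  by rewrite le_eqVlt (_ : _ == _)//; apply/eqP; ring.
have hX := dotp_youngN (gamma *: (G s - G z)) (s - c) (ltr01 : 0 < 1 :> R).
have t10 : (0 : R) < 1 / 10 by lra.
have hr := sqD_young (z - s) (- (gamma *: (G s - G z))) t10.
rewrite (_ : z - s + _ = gamma *: F s + N) ?sqN ?(sqBC z s) in hr; last first.
  by rewrite NE; apply/rowP => i; rewrite !mxE; ring.
have en' : sq (s - c) + 2 * dotp (gamma *: (G s - G z)) (s - c)
    + 2 * (gamma * mu) * sq (s - c) + 2 * (gamma * dotp (F c) (s - c)) <=
    sq (z - c) - sq (s - z).
  by rewrite dotpZl; move: en; lra.
have g21 : (gamma * L) ^+ 2 <= 1 / 1000 by case: params => _ [].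
have [hn hf hr'] := start_scalar (sq_ge0 (s - c)) (sq_ge0 (s - z)) P0 (ltW y0)
  (sqr_ge0 _) g21 sD en' hX hr.
have hQ := quad_upper p k0 k1 a a; rewrite /= subrr sq0 mulr0 addr0 in hQ.
rewrite -(mulr_natl _ 2) in hQ.
have ha : aux F c p k gamma 1 a a <= 50 * sq (z - c).
  rewrite /aux /= subrr sq0 /off /= (sqBC z s).
  apply: (start_aux p0 p1 k0 (sq_ge0 _) P0 (sq_ge0 _) _ hn hf hr').
  by move: hQ; lra.
have rp : ramp x 1 <= 1 / 2 := ramp_le x0 ler01.
have Z0 := sq_ge0 (z - c).
have [al0 be0] := wts_ge0 p0 p1 k0 k1000 xc0 xc1 K.
have dec := wts_decay p0 p1 k0 k1000 xc0 xc1 K (erefl xc) (ltW y0).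
have y3 : gamma * mu <= p / 3.
  by case: params => [[_ _ _ _ h] _]; have := p0; move: h; lra.
move: {dec}(dec y3) al0 be0; rewrite -/xc.
case: (wts p k xc K) => al be /= dec al0 be0.
have ab0 : 0 <= al + be by exact: addr_ge0.
rewrite -mulrDl; apply: (@le_trans _ _ ((al + be) * (2 * sq (z - c)))).
  have h1 := ler_wpM2l (mulr_ge0 ab0 Z0) rp; have h2 := ler_wpM2l ab0 ha.
  by move: h1 h2; lra.
by apply: ler_wpM2r => //; rewrite mulr_ge0.
Qed.

End hard.
End chain.

(** * Convergence rates of the inner loop *)

Lemma pow_rate (R : realType) (r q x : R) (H n : nat) : 0 <= r -> 0 < x ->
  r <= expR (- q) -> n%:R * - ln x <= q * H%:R -> r ^+ H <= x ^+ n.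
Proof.
move=> r0 x0 hr hq.
apply: (@le_trans _ _ (expR (- q) ^+ H)).
  by case: H {hq} => // H; rewrite ler_pXn2r ?nnegrE// expR_ge0.
rewrite -expRM_natl -[x in x ^+ n]lnK// -expRM_natl ler_expR.
by move: hq; rewrite mulrN; lra.
Qed.

(** From [1 + v <= exp v] at [v = -3/128] by repeated squaring. The exponents [6/16] and [3/16]
    match the powers [x^6] and [x^3] under [H >= 16 ln (1 / x)]. *)
Lemma expR_num (R : realType) : 678 / 1000 <= expR (- (3 / 8) : R) /\
  824 / 1000 <= expR (- (3 / 16) : R).
Proof.
have sqle (a b : R) : 0 <= a -> a <= b -> a * a <= b * b.
  by move=> a0 ab; apply: ler_pM.
have dbl (a : R) : expR (a + a) = expR a * expR a by rewrite expRD.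
have h : 125 / 128 <= expR (- (3 / 128) : R).
  by apply: le_trans (expR_ge1Dx _); lra.
have e64 : (- (3 / 64) : R) = - (3 / 128) - 3 / 128 by lra.
have h64 : 953 / 1000 <= expR (- (3 / 64) : R).
  rewrite e64 dbl; apply: le_trans (sqle _ _ _ h); lra.
have e32 : (- (3 / 32) : R) = - (3 / 64) - 3 / 64 by lra.
have h32 : 908 / 1000 <= expR (- (3 / 32) : R).
  rewrite e32 dbl; apply: le_trans (sqle _ _ _ h64); lra.
have e16 : (- (3 / 16) : R) = - (3 / 32) - 3 / 32 by lra.
have h16 : 824 / 1000 <= expR (- (3 / 16) : R).
  rewrite e16 dbl; apply: le_trans (sqle _ _ _ h32); clear; lra.
have e8 : (- (3 / 8) : R) = - (3 / 16) - 3 / 16 by lra.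
split=> //; rewrite e8 dbl; apply: le_trans (sqle _ _ _ h16); clear; lra.
Qed.

(* With x^2 = mu p / (40 L), the hypothesis on H reads 16 ln (1 / x) <= H. *)
Section rates.
Variables (R : realType) (L mu delta p gamma : R) (H : nat).
Hypotheses (L0 : 0 < L) (mu0 : 0 < mu) (delta0 : 0 < delta) (muL : mu <= L).
Hypotheses (p0 : 0 < p) (p1 : p <= 1 / 4).
Hypothesis gammaE : gamma = Num.min (Num.min (p / (3 * mu)) (Num.sqrt p / (4 * delta)))
            (L^-1 * (H%:R / (4 * ln (40 * L / (mu * p))) - 1)).
Hypothesis hH : 8 * ln (40 * L / (mu * p)) <= H%:R.

Let x : R := Num.sqrt (mu * p / (40 * L)).
Let g : R := gamma * L.
Let y : R := gamma * mu.

Let x2E : x ^+ 2 = mu * p / (40 * L).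
Proof. by rewrite sqr_sqrtr// divr_ge0// ?mulr_ge0// ?ltW. Qed.

Lemma rate_gt0 : 0 < x.
Proof. by rewrite sqrtr_gt0 divr_gt0// mulr_gt0. Qed.

Lemma rate_sq_le : x ^+ 2 <= p / 40.
Proof.
rewrite x2E ler_pdivrMr ?mulr_gt0//.
have h := ler_wpM2r (ltW p0) muL; rewrite mulrA divfK//; by rewrite (mulrC p).
Qed.

Lemma rate_le : x <= 2 / 25.
Proof.
rewrite -ler_sqr ?nnegrE ?(ltW rate_gt0)//.
by apply: (le_trans rate_sq_le); have := p1; lra.
Qed.

Let lnx : ln (40 * L / (mu * p)) = 2 * - ln x.
Proof.
have -> : 40 * L / (mu * p) = (x ^+ 2)^-1 by rewrite x2E invf_div.
by rewrite lnV ?posrE ?exprn_gt0 ?rate_gt0// lnXn ?rate_gt0//; rewrite mulrN mulr_natl.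
Qed.

Let l0 : 0 < - ln x.
Proof.
rewrite oppr_gt0 ln_lt0// rate_gt0/=; apply: (le_lt_trans rate_le).
by lra.
Qed.

Lemma H_ge16 : 16 * - ln x <= H%:R.
Proof. by move: hH; rewrite lnx; lra. Qed.

Let pos3 : 0 < p / (3 * mu). Proof. by rewrite divr_gt0// mulr_gt0. Qed.
Let pos4 : 0 < Num.sqrt p / (4 * delta). Proof. by rewrite divr_gt0 ?sqrtr_gt0// mulr_gt0. Qed.

Lemma gamma_gt0 : 0 < gamma.
Proof.
rewrite gammaE !lt_min pos3 pos4 /= mulr_gt0 ?invr_gt0// subr_gt0.
rewrite lnx ltr_pdivlMr; last by have := l0; lra.
by have := H_ge16; have := l0; lra.
Qed.

Lemma gamma_mu_le : y <= p / 3.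
Proof.
have h : gamma <= p / (3 * mu) by rewrite gammaE !ge_min lexx.
have := ler_wpM2r (ltW mu0) h; rewrite -/y.
by rewrite (_ : p / (3 * mu) * mu = p / 3)//; field; rewrite gt_eqF.
Qed.

Lemma gamma_delta_le : (gamma * delta) ^+ 2 <= p / 16.
Proof.
have h : gamma <= Num.sqrt p / (4 * delta) by rewrite gammaE !ge_min lexx orbT.
have := ler_wpM2r (ltW delta0) h.
rewrite (_ : Num.sqrt p / (4 * delta) * delta = Num.sqrt p / 4); last first.
  by field; rewrite gt_eqF.
move=> h2; have g0 : 0 <= gamma * delta by rewrite mulr_ge0 ?(ltW gamma_gt0)// ltW.
have := ler_pM g0 g0 h2 h2; rewrite -!expr2 => /le_trans; apply.
by rewrite exprMn sqr_sqrtr ?(ltW p0)//; lra.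
Qed.

Lemma H_ge_gL : 8 * (1 + g) * - ln x <= H%:R.
Proof.
have h : gamma <= L^-1 * (H%:R / (4 * (2 * - ln x)) - 1).
  by rewrite -lnx gammaE !ge_min lexx orbT.
have l8 : 0 < 4 * (2 * - ln x) by have := l0; lra.
have := ler_wpM2l (ltW L0) h; rewrite mulVKf ?gt_eqF// lerBrDr.
by rewrite (mulrC L) -/g ler_pdivlMr//; lra.
Qed.

Lemma gL_relation : 40 * x ^+ 2 * g = p * y.
Proof. by rewrite x2E /g /y; field; rewrite gt_eqF. Qed.

Let g0 : 0 < g. Proof. by rewrite mulr_gt0// gamma_gt0. Qed.
Let c := (2 * (1 + g) + 16 / 15)^-1.
Let c0 : 0 < c. Proof. by rewrite invr_gt0; have := g0; lra. Qed.
Let cE : c * (2 * (1 + g) + 16 / 15) = 1.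
Proof. by rewrite mulVf// gt_eqF//; have := g0; lra. Qed.
Let c1 : 0 <= 1 - c.
Proof. by have := cE; have := mulr_gt0 c0 g0; have := c0; lra. Qed.

Lemma rate_contract : (1 - c) ^+ H <= x ^+ 3.
Proof.
apply: (pow_rate (q := c)) => //; first exact: rate_gt0.
  by have := expR_ge1Dx (- c).
have hD : 3 * - ln x * (2 * (1 + g) + 16 / 15) <= H%:R.
  (* For [g <= 1], [3 (4 + 16/15) <= 16]; for [g >= 1], [6 (1 + g) + 16/5 <= 8 (1 + g)], and the
     last term in the minimum defining [gamma] applies. *)
  have [h|/ltW h] := leP g 1; have := ler_wpM2r (ltW l0) h.
    by have := H_ge16; have := l0; lra.
  by have := H_ge_gL; have := l0; lra.
have := ler_wpM2l (ltW c0) hD.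
by rewrite mulrCA cE mulr1.
Qed.

Lemma rate_contract_small : g <= 1 / 124 -> (1 - c) ^+ H <= x ^+ 6.
Proof.
move=> g1; apply: (pow_rate (q := 3 / 8)) => //; first exact: rate_gt0.
  apply: le_trans (expR_num R).1.
  have := ler_wpM2l (ltW c0) g1; have := cE; lra.
by have := H_ge16; lra.
Qed.

Lemma rate_drift : g <= 1 / 124 ->
  let t := (4 * (1 + g))^-1 in (1 - t * (1 - t)) ^+ H <= x ^+ 3 /\ 0 <= (1 - t * (1 - t)) ^+ H.
Proof.
move=> g1; cbv zeta; set t := _^-1.
have t0 : 0 < t by rewrite invr_gt0; have := g0; lra.
have tE : t * (4 * (1 + g)) = 1 by rewrite mulVf// gt_eqF//; have := g0; lra.
have t1 : t <= 1 / 4 by have := mulr_gt0 t0 g0; move: tE; lra.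
have t2 : 31 / 125 <= t by have := ler_wpM2l (ltW t0) g1; move: tE; lra.
have tt : 31 / 125 * (3 / 4) <= t * (1 - t) by apply: ler_pM => //; move: t1; lra.
have tt1 : t * (1 - t) <= 1 / 4 by have := mulr_ge0 (ltW t0) (ltW t0); move: t1; lra.
have r0 : 0 <= 1 - t * (1 - t) by move: tt1; lra.
split; last exact: exprn_ge0.
apply: (pow_rate (q := 3 / 16)) => //; first exact: rate_gt0.
  by apply: le_trans (expR_num R).2; move: tt; lra.
by have := H_ge16; lra.
Qed.

(** For small [g], [x^6 = x x^5] with [x <= 2/25] suffices. Otherwise [40 x^2 g = p y] bounds [x^2]
    by a multiple of [y], and [x^3] already suffices. *)
Lemma easy_rate : x ^+ 5 <= y -> (1 - c) ^+ H <= y / 10 /\ (1 - c) ^+ H <= 1 / 1000.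
Proof.
move=> xy; have x0 := rate_gt0; have xl := rate_le; have x2 := rate_sq_le.
have x2' : x ^+ 2 <= 1 / 160 by have := p1; move: x2; lra.
have x20 := sqr_ge0 x.
have x3e : x ^+ 3 = x * x ^+ 2 by ring.
have x3 : x ^+ 3 <= 1 / 1000.
  rewrite x3e; apply: le_trans (ler_pM (ltW x0) x20 xl x2') _; lra.
split; last exact: le_trans rate_contract x3.
have [g1|g1] := leP g (1 / 124).
  apply: (le_trans (rate_contract_small g1)).
  have x5 : 0 <= x ^+ 5 := exprn_ge0 5 (ltW x0).
  have -> : x ^+ 6 = x ^+ 5 * x by ring.
  by have := ler_wpM2l x5 xl; move: xy x5; lra.
apply: (le_trans rate_contract); rewrite x3e.
have := gL_relation; have := ler_wpM2l x20 (ltW g1).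
have y0 : 0 <= y by rewrite ltW// mulr_gt0// gamma_gt0.
have := ler_wpM2r y0 p1; have := ler_wpM2r x20 xl.
by lra.
Qed.

End rates.

(** * Iterations of the Three Pillars Algorithm *)

Lemma sq_mean_le (R : realType) (d n : nat) (X : 'I_n -> 'rV[R]_d) : (0 < n)%N ->
  sq (n%:R^-1 *: \sum_i X i) <= n%:R^-1 * \sum_i sq (X i).
Proof.
move=> n0; set m := _ *: _.
have nR : 0 < n%:R :> R by rewrite ltr0n.
have mE : \sum_i X i = n%:R *: m by rewrite /m scalerA divff ?gt_eqF// scale1r.
have e : \sum_i dotp (X i) m = n%:R * sq m.
  by rewrite -dotp_suml mE dotpZl.
have h : 0 <= \sum_i (sq (X i) - 2 * dotp (X i) m + sq m).
  by apply: sumr_ge0 => i _; rewrite -sqB sq_ge0.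
rewrite big_split sumrB -mulr_sumr sumr_const card_ord -[_ *+ _]mulr_natl /= e in h.
rewrite -(ler_pM2l nR) mulrA divff ?gt_eqF// mul1r; lra.
Qed.

Lemma mean_le (R : realType) (n : nat) (f : 'I_n -> R) (x : R) : (0 < n)%N ->
  (forall i, f i <= x) -> n%:R^-1 * \sum_i f i <= x.
Proof.
move=> n0 h; rewrite ler_pdivrMl ?ltr0n//.
apply: (@le_trans _ _ (\sum_(i < n) x)); first exact: ler_sum.
by rewrite sumr_const card_ord -[leLHS]mulr_natl.
Qed.

Section rounds.
Variables (R : realType) (d n : nat) (Z : set 'rV[R]_d).
Variables (F : 'I_n -> 'rV[R]_d -> 'rV[R]_d) (i1 : 'I_n).
Variables (C : compressors R d n) (L mu delta gamma eta p : R) (H : nat) (c : 'rV[R]_d).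
Hypotheses (Z0 : Z !=set0) (Zcl : closed Z).
Hypothesis Zcv : convex_set (Z : set (convex_lmodType 'rV[R]_d)).
Hypotheses (L0 : 0 < L) (g0 : 0 < gamma).
Hypothesis Flip : forall i (u v : 'rV[R]_d), Z u -> Z v ->
  sq (F i u - F i v) <= L ^+ 2 * sq (u - v).
Hypothesis Fmono : forall i (u v : 'rV[R]_d), Z u -> Z v -> 0 <= dotp (F i u - F i v) (u - v).
Hypothesis Fsim : forall (u v : 'rV[R]_d), Z u -> Z v ->
  n%:R^-1 * \sum_(i < n) sq (F i u - F i1 u - F i v + F i1 v) <= delta ^+ 2 * sq (u - v).
Hypothesis unb : unbiased C.
Hypothesis etaE : eta = (4 * (L + gamma^-1))^-1.

Let n0 : (0 < n)%N. Proof. exact: leq_ltn_trans (leq0n i1) (ltn_ord i1). Qed.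
Let nR : n%:R != 0 :> R. Proof. by rewrite pnatr_eq0 -lt0n. Qed.

Definition mean_op : 'rV[R]_d -> 'rV[R]_d := favg F.
Definition gap_op (v : 'rV[R]_d) : 'rV[R]_d := F i1 v - favg F v.

Lemma mean_noise (m u : 'rV[R]_d) :
  n%:R^-1 *: \sum_(i < n) (F i m - F i1 m - F i u + F i1 u) = gap_op u - gap_op m.
Proof.
rewrite big_split sumrB big_split /= !sumrN !sumr_const card_ord /gap_op /favg.
rewrite !scalerDr !scalerN -[F i1 m *+ n]scaler_nat -[F i1 u *+ n]scaler_nat !scalerA mulVf// !scale1r.
by apply/rowP => i; rewrite !mxE; ring.
Qed.

Lemma mean_op_lip (u v : 'rV[R]_d) : Z u -> Z v ->
  sq (mean_op u - mean_op v) <= L ^+ 2 * sq (u - v).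
Proof.
move=> Zu Zv; rewrite /mean_op /favg -scalerBr -sumrB.
apply: (le_trans (sq_mean_le _ n0)).
by apply: mean_le => // i; exact: Flip.
Qed.

Lemma gap_op_lip (u v : 'rV[R]_d) : Z u -> Z v ->
  sq (gap_op u - gap_op v) <= 4 * L ^+ 2 * sq (u - v).
Proof.
move=> Zu Zv; have := sqD2 (F i1 u - F i1 v) (- (mean_op u - mean_op v)).
rewrite sqN (_ : _ - _ = gap_op u - gap_op v); last first.
  by rewrite /gap_op /mean_op; apply/rowP => i; rewrite !mxE; ring.
by have := mean_op_lip Zu Zv; have := Flip i1 Zu Zv; lra.
Qed.

Lemma gap_op_sim (u v : 'rV[R]_d) : Z u -> Z v ->
  sq (gamma *: (gap_op u - gap_op v)) <= (gamma * delta) ^+ 2 * sq (u - v).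
Proof.
move=> Zu Zv; rewrite sqZ exprMn -[leRHS]mulrA; apply: ler_wpM2l; first exact: sqr_ge0.
rewrite -mean_noise; apply: (le_trans (sq_mean_le _ n0)).
by apply: (le_trans (Fsim Zv Zu)); rewrite sqBC.
Qed.

(** Replaces similarity when [gamma L] is tiny. *)
Lemma noise_lip (m u : 'rV[R]_d) : Z m -> Z u ->
  n%:R^-1 * \sum_(i < n) sq (F i m - F i1 m - F i u + F i1 u) <= 4 * L ^+ 2 * sq (m - u).
Proof.
move=> Zm Zu; apply: mean_le => // i.
have := sqD2 (F i m - F i u) (- (F i1 m - F i1 u)).
rewrite sqN (_ : _ - _ = F i m - F i1 m - F i u + F i1 u); last first.
  by apply/rowP => j; rewrite !mxE; ring.
by have := Flip i1 Zm Zu; have := Flip i Zm Zu; lra.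
Qed.

Let step (s : draw C) (z m : 'rV[R]_d) := outer_step Z F i1 gamma eta p H s z m.

Lemma outer_step_in s z m : Z (step s z m). Proof. exact: eproj_in. Qed.

Let w (z m : 'rV[R]_d) := (1 - p) *: z + p *: m.
Let b (m : 'rV[R]_d) := favg F m - F i1 m.
Let theta := (4 * (1 + gamma * L))^-1.

(** [eta = theta gamma], and [z + p (m - z)] is the centre [w]. *)
Lemma inner_stepE z m u :
  inner_step Z F i1 gamma eta p z m u = eg_next Z (F i1) (w z m) (b m) gamma L u.
Proof.
have e v : eta *: inner_op F i1 gamma p z m v =
    theta *: reg_op (F i1) (w z m) (b m) gamma v.
  have -> : reg_op (F i1) (w z m) (b m) gamma v = gamma *: inner_op F i1 gamma p z m v.
    rewrite /reg_op /inner_op [in RHS]scalerDr scalerA divff ?gt_eqF// scale1r.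
    by rewrite /w /b; apply/rowP => i; rewrite !mxE; ring.
  rewrite scalerA; congr (_ *: _); rewrite etaE /theta; field.
  have h := mulr_gt0 g0 L0.
  by rewrite gt_eqF//= ?gt_eqF//; lra.
by rewrite /inner_step /eg_next /eg_half !e.
Qed.

(** Projection does not increase the distance to a point of [Z]; after expanding the square, the
    mean of the noise is exactly [gap_op u - gap_op m]. *)
Lemma outer_avg (dd : R) z m v : Z z -> Z m -> Z v ->
  (forall m u : 'rV[R]_d, Z m -> Z u ->
   gamma ^+ 2 * (n%:R^-1 * \sum_(i < n) sq (F i m - F i1 m - F i u + F i1 u)) <= dd * sq (m - u)) ->
  Z (inner_loop Z F i1 gamma eta p H z m) ->
  avg (arrangements C) (fun s => sq (step s z m - v)) <=
  sq (inner_loop Z F i1 gamma eta p H z m - v)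
  + 2 * gamma * dotp (gap_op (inner_loop Z F i1 gamma eta p H z m) - gap_op m)
      (inner_loop Z F i1 gamma eta p H z m - v)
  + dd * sq (m - inner_loop Z F i1 gamma eta p H z m).
Proof.
move=> Zz Zm Zv hdd Zu; rewrite /step /outer_step; set u := inner_loop _ _ _ _ _ _ _ _ _ in Zu *.
case: unb => A0 hM hV.
pose D i := F i m - F i1 m - F i u + F i1 u.
apply: (@le_trans _ _ (avg (arrangements C)
    (fun s => sq (u - v) + 2 * gamma * dotp (aggregate D s) (u - v) + gamma ^+ 2 * sq (aggregate D s)))).
  apply: avg_le => s _; apply: (le_trans (eproj_dist Z0 Zcl Zcv _ Zv)).
  rewrite -/(aggregate D s).
  rewrite (_ : u + _ - v = (u - v) + gamma *: aggregate D s); last by rewrite addrAC.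
  rewrite [leLHS]sqD sqZ dotpZr (dotpC _ (u - v)).
  by rewrite le_eqVlt; apply/orP; left; apply/eqP; ring.
rewrite avg_affine// hM mean_noise lerD2l.
apply: le_trans (hdd _ _ Zm Zu); apply: ler_wpM2l; [exact: sqr_ge0|exact: hV].
Qed.

Hypothesis H0 : (0 < H)%N.

Let k := (1 - theta * (1 - theta)) ^+ H.
Let ke := (1 - (2 * (1 + gamma * L) + 16 / 15)^-1) ^+ H.

Lemma round_ex (dd : R) z m : Z z -> Z m ->
  (forall m u : 'rV[R]_d, Z m -> Z u ->
   gamma ^+ 2 * (n%:R^-1 * \sum_(i < n) sq (F i m - F i1 m - F i u + F i1 u)) <= dd * sq (m - u)) ->
  0 <= 1 - (2 * (1 + gamma * L) + 16 / 15)^-1 ->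
  exists s u N, [/\ round (arrangements C) p step Z mean_op gap_op gamma dd z m s u N,
    sq (u - s) <= ke * sq (s - z) &
    gamma * L <= 1 / 124 -> forall y, Z y -> sq (u - s + k *: (s - y)) <=
    k * (4 * dotp N (s - y) + 2 * sq (z - y) + 300 * (gamma * L) ^+ 2 * sq (s - y))].
Proof.
move=> Zz Zm hdd c0; pose ww := w z m; pose bb := b m.
have [s Zs hs] := reg_sol_ex Z0 Zcl Zcv ww bb g0 L0 (Fmono i1) (Flip i1).
exists s, (inner_loop Z F i1 gamma eta p H z m), (- reg_op (F i1) ww bb gamma s).
have loopE j : iter j (inner_step Z F i1 gamma eta p z m) z =
    iter j (eg_next Z (F i1) ww bb gamma L) z.
  elim: j => [|j ih].
    exact: (erefl z).
  rewrite [LHS]iterS ih.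
  rewrite [RHS]iterS.
  exact: inner_stepE.
have itZ j : Z (iter j (eg_next Z (F i1) ww bb gamma L) z).
  by case: j => [|j]; [exact: Zz|rewrite iterS; exact: eproj_in].
have Zu : Z (inner_loop Z F i1 gamma eta p H z m) by rewrite /inner_loop loopE.
split.
- split=> //.
    rewrite /reg_op /ww /w /bb /b /mean_op /gap_op.
    by apply/rowP => i; rewrite !mxE; ring.
  by move=> v Zv; exact: outer_avg.
- rewrite /inner_loop loopE (sqBC s z) /ke.
  elim: H => [|j ih]; first by rewrite expr0 mul1r.
  have := eg_contract Z0 Zcl Zcv g0 L0 (Fmono i1) (Flip i1) Zs hs (itZ j).
  rewrite iterS => /le_trans; apply; rewrite exprS -[leRHS]mulrA.
  exact: ler_wpM2l.
- move=> gL y Zy; rewrite /inner_loop loopE.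
  exact: (eg_drift Z0 Zcl Zcv g0 L0 gL (Flip i1) Zs hs H0 Zz Zy).
Qed.

End rounds.

Section value_bound.
Variables (R : realType) (d n : nat) (Z : set 'rV[R]_d).
Variables (F : 'I_n -> 'rV[R]_d -> 'rV[R]_d) (i1 : 'I_n).
Variables (C : compressors R d n) (L mu delta gamma eta p : R) (H : nat) (c : 'rV[R]_d).
Hypotheses (Z0 : Z !=set0) (Zcl : closed Z).
Hypothesis Zcv : convex_set (Z : set (convex_lmodType 'rV[R]_d)).
Hypotheses (L0 : 0 < L) (mu0 : 0 < mu) (delta0 : 0 < delta) (p0 : 0 < p) (p1 : p <= 1 / 4).
Hypothesis Flip : forall i (u v : 'rV[R]_d), Z u -> Z v ->
  sq (F i u - F i v) <= L ^+ 2 * sq (u - v).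
Hypothesis Fmono : forall i (u v : 'rV[R]_d), Z u -> Z v -> 0 <= dotp (F i u - F i v) (u - v).
Hypothesis Fsmono : forall v w : 'rV[R]_d, Z v -> Z w ->
  mu * sq (v - w) <= dotp (favg F v - favg F w) (v - w).
Hypothesis Fsim : forall (u v : 'rV[R]_d), Z u -> Z v ->
  n%:R^-1 * \sum_(i < n) sq (F i u - F i1 u - F i v + F i1 v) <= delta ^+ 2 * sq (u - v).
Hypothesis unb : unbiased C.
Hypothesis etaE : eta = (4 * (L + gamma^-1))^-1.
Hypotheses (cZ : Z c) (Fc : forall v : 'rV[R]_d, Z v -> 0 <= dotp (favg F c) (v - c)).
Hypothesis gammaE : gamma = Num.min (Num.min (p / (3 * mu)) (Num.sqrt p / (4 * delta)))
            (L^-1 * (H%:R / (4 * ln (40 * L / (mu * p))) - 1)).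
Hypotheses (H0 : (0 < H)%N) (hH : 8 * ln (40 * L / (mu * p)) <= H%:R).

Let step (s : draw C) (z m : 'rV[R]_d) := outer_step Z F i1 gamma eta p H s z m.
Let val := value (arrangements C) p step c.
Let stepZ s z m : Z (step s z m) := outer_step_in F i1 gamma eta p H Z0 Zcl Zcv s z m.

(* [L < mu] forces [Z] to be a single point. *)
Lemma value_bound_degenerate K z m : L < mu -> Z z -> Z m -> val K z m = 0.
Proof.
move=> Lmu; have one u : Z u -> sq (u - c) = 0.
  move=> Zu; have h := Fsmono Zu cZ; have h2 := mean_op_lip i1 Flip Zu cZ.
  have h3 := dotp_CS (favg F u - favg F c) (u - c).
  have S0 := sq_ge0 (u - c).
  apply/eqP; rewrite -sqrf_eq0; apply/eqP/le_anti; rewrite sqr_ge0 andbT.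
  have q1 : mu ^+ 2 * sq (u - c) ^+ 2 <= L ^+ 2 * sq (u - c) ^+ 2.
    rewrite -exprMn; apply: (@le_trans _ _ (dotp (favg F u - favg F c) (u - c) ^+ 2)).
      by rewrite ler_sqr ?nnegrE// ?mulr_ge0 ?(ltW mu0)//; apply: le_trans h; rewrite mulr_ge0// ltW.
    by apply: (le_trans h3); rewrite expr2 mulrA; apply: ler_wpM2r.
  have q2 : L ^+ 2 < mu ^+ 2 by rewrite ltr_sqr ?nnegrE ?ltW.
  have : (mu ^+ 2 - L ^+ 2) * sq (u - c) ^+ 2 <= 0 by rewrite mulrBl subr_le0.
  by rewrite pmulr_rle0// subr_gt0.
elim: K z m => [|K ih] z m Zz Zm; first exact: one.
rewrite /val /=; case: unb => A0 _ _.
rewrite (_ : (fun s => _) = fun=> 0); first exact: avg_cst.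
by apply/funext => s; rewrite -/val !ih ?stepZ// !mulr0 addr0.
Qed.

Lemma value_bound K z : Z z -> val K z z <= (1 - gamma * mu / 2) ^+ K * (2 * sq (z - c)).
Proof.
move=> Zz; have p401 : p / 40 <= 1 by have := p1; lra.
have l6400 : (1 : R) <= 6400 := ler1n R 6400.
have [muL|Lmu] := leP mu L; last first.
  rewrite value_bound_degenerate//.
  by have := value_bound_degenerate 0 Lmu Zz Zz; rewrite /val /= => ->; rewrite !mulr0.
have g0 := gamma_gt0 L0 mu0 delta0 muL p0 p1 gammaE hH.
have y3 := gamma_mu_le mu0 gammaE.
have xx0 := rate_gt0 L0 mu0 p0; have xl := rate_le L0 mu0 muL p0 p1.
have x2 := rate_sq_le L0 mu0 muL p0.
set x : R := Num.sqrt (mu * p / (40 * L)) in xx0 xl x2.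
have gp : 0 < gamma * L by exact: mulr_gt0.
have c0 : 0 <= 1 - (2 * (1 + gamma * L) + 16 / 15)^-1.
  by rewrite subr_ge0 invf_le1; lra.
case: (unb) => A0 _ _.
have [xy|/ltW yx] := leP (x ^+ 5) (gamma * mu).
  have [k1 k2] := easy_rate L0 mu0 delta0 muL p0 p1 gammaE hH xy.
  have hd := gamma_delta_le L0 mu0 delta0 muL p0 p1 gammaE hH.
  rewrite mulr2n [(1 + 1) * _]mulrDl mul1r.
  apply: (easy_chain (dd := (gamma * delta) ^+ 2) A0 cZ p0 p1 stepZ Fc g0 mu0 y3 _ k1 k2 _ hd Fsmono) => //.
  - exact: exprn_ge0.
  - exact: sqr_ge0.
  - by move=> v w Zv Zw; apply: (gap_op_sim _ Fsim).
  - move=> z' m Zz' Zm.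
    have hdd (m' u' : 'rV[R]_d) : Z m' -> Z u' -> gamma ^+ 2 * (n%:R^-1 * \sum_(i < n)
        sq (F i m' - F i1 m' - F i u' + F i1 u')) <= (gamma * delta) ^+ 2 * sq (m' - u').
      move=> Zm' Zu'; rewrite exprMn -[leRHS]mulrA.
      by apply: ler_wpM2l; [exact: sqr_ge0|exact: Fsim].
    have [s [u [N [r hu _]]]] := round_ex p Z0 Zcl Zcv L0 g0 Flip Fmono unb etaE H0 Zz' Zm hdd c0.
    by exists s, u, N.
have xE := gL_relation gamma L0 mu0 p0.
have y0 : 0 < gamma * mu by exact: mulr_gt0.
have [[_ _ gl _ _] _] := hard_param_bounds xx0 xl p0 p1 x2 y0 yx (ltW gp) xE (lexx 0)
  (exprn_ge0 3 (ltW xx0)).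
have kd := rate_drift L0 mu0 delta0 muL p0 p1 gammaE hH gl; cbv zeta in kd.
move: kd => [kx k0].
have hc6 := rate_contract_small L0 mu0 delta0 muL p0 p1 gammaE hH gl.
rewrite -/x in kx hc6.
(* The cap of the auxiliary weight, of the order at which [550 x^3 / t^2] falls below
   [gamma mu / 5]. *)
pose B := Num.sqrt (6400 * x ^+ 3 / (gamma * mu)).
have x3 : 0 <= 6400 * x ^+ 3 := mulr_ge0 (ler0n R 6400) (exprn_ge0 3 (ltW xx0)).
have B0 : 0 <= B by exact: sqrtr_ge0.
have yB : gamma * mu * B ^+ 2 = 6400 * x ^+ 3.
  by rewrite sqr_sqrtr ?divr_ge0 ?(ltW y0)// mulrC divfK// gt_eqF.
have B1 : 1 <= B.
  rewrite -(@sqrtr1 R) ler_sqrt; last by rewrite divr_ge0// ltW.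
  rewrite ler_pdivlMr// mul1r; apply: (le_trans yx).
  have x30 : 0 <= x ^+ 3 := exprn_ge0 3 (ltW xx0).
  have x21 : x ^+ 2 <= 1 by exact: le_trans x2 p401.
  rewrite (_ : x ^+ 5 = x ^+ 3 * x ^+ 2); last by ring.
  by apply: (le_trans (ler_wpM2l x30 x21)); rewrite mulr1 ler_peMl.
apply: (hard_bound A0 cZ p0 p1 stepZ Fc Zcv g0 L0 mu0 k0 xx0 xl x2 kx yx xE B0 yB
  (erefl _) Fsmono (mean_op_lip i1 Flip) (gap_op_lip i1 Flip) _ K Zz B1).
move=> z' m Zz' Zm.
have hdd (m' u' : 'rV[R]_d) : Z m' -> Z u' -> gamma ^+ 2 * (n%:R^-1 * \sum_(i < n)
    sq (F i m' - F i1 m' - F i u' + F i1 u')) <= 4 * (gamma * L) ^+ 2 * sq (m' - u').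
  move=> Zm' Zu'; have hl := ler_wpM2l (sqr_ge0 gamma) (noise_lip i1 Flip Zm' Zu').
  apply: (le_trans hl).
  by rewrite le_eqVlt; apply/orP; left; apply/eqP; ring.
have [s [u [N [r hu hdr]]]] := round_ex p Z0 Zcl Zcv L0 g0 Flip Fmono unb etaE H0 Zz' Zm hdd c0.
exists s, u, N; split=> //; last by move=> y Zy; exact: hdr.
apply: (le_trans hu); apply: ler_wpM2r => //; exact: sq_ge0.
Qed.

End value_bound.

Section expected_value.
Variables (R : realType) (d n : nat) (Z : set 'rV[R]_d).
Variables (F : 'I_n -> 'rV[R]_d -> 'rV[R]_d) (i1 : 'I_n).
Variables (C : compressors R d n) (gamma eta p : R) (H : nat) (c : 'rV[R]_d).

Let T : finType := (draw C * bool)%type.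

Definition transition (st : 'rV[R]_d * 'rV[R]_d) (x : T) : 'rV[R]_d * 'rV[R]_d :=
  (outer_step Z F i1 gamma eta p H x.1 st.1 st.2, if x.2 then st.1 else st.2).

Lemma three_pillars_foldl (pi : nat -> draw C) (co : nat -> bool) z0 K :
  three_pillars Z F i1 gamma eta p H pi co z0 K =
  foldl transition (z0, z0) (mkseq (fun k => (pi k, co k)) K).
Proof.
elim: K => // K ih; rewrite mkseqS foldl_rcons -ih /=.
by case: (three_pillars _ _ _ _ _ _ _ _ _ _ K).
Qed.

Lemma value_histories K st :
  \sum_(h <- histories T K) sq ((foldl transition st h).1 - c) * \prod_(x <- h) mass p x =
  value (arrangements C) p (fun s z m => outer_step Z F i1 gamma eta p H s z m) c K st.1 st.2.
Proof.
elim: K st => [|K ih] st; first by rewrite big_seq1 big_nil mulr1.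
rewrite sum_histories /=.
transitivity (\sum_(x : T) mass p x * value (arrangements C) p
    (fun s z m => outer_step Z F i1 gamma eta p H s z m) c K (transition st x).1 (transition st x).2).
  apply: eq_bigr => x _; rewrite -ih mulr_sumr; apply: eq_bigr => h _.
  by rewrite big_cons mulrCA.
rewrite -(pair_bigA _ (fun s b => mass p (s, b) * value (arrangements C) p
    (fun s z m => outer_step Z F i1 gamma eta p H s z m) c K
    (transition st (s, b)).1 (transition st (s, b)).2)) /=.
rewrite /avg mulr_sumr [RHS]big_mkcond /=; apply: eq_bigr => s _.
rewrite big_bool /mass /unif /coin /=.
by case: ifP => _; [ring|rewrite !mul0r addr0].
Qed.

End expected_value.

Theorem theoremC2 (R : realType) (d n : nat) (hn : (0 < n)%N)
    (Z : set 'rV[R]_d) (F : 'I_n -> 'rV[R]_d -> 'rV[R]_d)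
    (L mu delta : R) (zs z0 : 'rV[R]_d)
    (gamma eta tau p : R) (H : nat) (C : compressors R d n)
    (disp : measure_display) (Omega : measurableType disp)
    (P : probability Omega R)
    (pi : nat -> Omega -> draw C) (c : nat -> Omega -> bool) :
  Z !=set0 -> closed Z -> convex_set (Z : set (convex_lmodType 'rV[R]_d)) ->
  0 < L -> 0 < mu -> 0 < delta ->
  (forall i, enorm_lipschitz_on Z L (F i)) ->
  strongly_monotone_on Z mu (favg F) ->
  (forall i, monotone_on Z (F i)) ->
  delta_similar_on Z delta F ->
  VI_solution Z (favg F) zs ->
  Z z0 ->
  is_perm_compressors C ->
  algorithm_randomness P p pi c ->
  0 < p -> p <= 4^-1 -> tau = p ->
  gamma = Num.min (Num.min (p / (3 * mu)) (Num.sqrt p / (4 * delta)))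
            (L^-1 * (H%:R / (4 * ln (40 * L / (mu * p))) - 1)) ->
  eta = (4 * (L + gamma^-1))^-1 ->
  (1 <= H)%N -> 8 * ln (40 * L / (mu * p)) <= H%:R ->
  forall K : nat,
    ('E_P[fun w => (enorm ((three_pillars Z F (Ordinal hn) gamma eta tau H
             (pi^~ w) (c^~ w) z0 K).1 - zs) ^+ 2)%R]
     <= ((1 - gamma * mu / 2) ^+ K * (2 * enorm (z0 - zs) ^+ 2))%R%:E)%E.
Proof.
move=> Z0 Zcl Zcv L0 mu0 delta0 Flip Fsm Fmono Fsim [cZ Fc] Zz0 hC rand p0 p1 -> gE eE H0 hH K.
have p1' : p <= 1 / 4 by rewrite mul1r.
have Flip' i (u v : 'rV[R]_d) : Z u -> Z v -> sq (F i u - F i v) <= L ^+ 2 * sq (u - v).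
  by move=> Zu Zv; apply: enorm_le_sq; [exact: ltW|exact: Flip].
have Fsm' (v w : 'rV[R]_d) : Z v -> Z w ->
    mu * sq (v - w) <= dotp (favg F v - favg F w) (v - w).
  by move=> Zv Zw; rewrite -enorm_sq; exact: Fsm.
have Fsim' (u v : 'rV[R]_d) : Z u -> Z v -> n%:R^-1 * \sum_(i < n)
    sq (F i u - F (Ordinal hn) u - F i v + F (Ordinal hn) v) <= delta ^+ 2 * sq (u - v).
  move=> Zu Zv; have := Fsim (Ordinal hn) u v Zu Zv; rewrite enorm_sq.
  by under eq_bigr do rewrite enorm_sq.
have [B0 _ _] := perm_unbiased hn hC.
(* Provides the default element for [nth] on histories. *)
have [s0 _] := set0Pn _ B0.
pose f (h : seq (draw C * bool)) : R :=
  sq ((foldl (transition Z F (Ordinal hn) gamma eta p H) (z0, z0) h).1 - zs).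
rewrite (_ : (fun w => _) = (fun w => f (history pi c K w))); last first.
  by apply/funext => w; rewrite enorm_sq three_pillars_foldl.
rewrite (@finite_expectation _ _ _ _ _ _ (histories _ K)); last 4 first.
- exact: histories_uniq.
- by move=> w; rewrite mem_histories size_mkseq.
- by move=> h; rewrite mem_histories => /eqP <-; exact: (history_measurable rand (s0, true)).
- by move=> h; exact: sq_ge0.
rewrite (eq_big_seq (fun h => (f h * \prod_(x <- h) mass p x)%:E)); last first.
  move=> h; rewrite mem_histories => /eqP <-.
  by rewrite (history_prob rand (s0, true)) -EFinM.
rewrite sumEFin lee_fin (value_histories Z F (Ordinal hn) C gamma eta p H zs K (z0, z0)) /=.
rewrite enorm_sq.
exact: (value_bound Z0 Zcl Zcv L0 mu0 delta0 p0 p1' Flip' (fun i u v => @Fmono i u v)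
  Fsm' Fsim' (perm_unbiased hn hC) eE cZ Fc gE H0 hH K Zz0).
Qed.
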